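(* Let $W$ be a set of at most $k$ ordinary Wang tiles, and suppose at most $c$ colors are used on boundaries of input regions. Then there exists a set $\mathcal{R}$ of at most $8(k+4c)^2$ rectangular tiles with the following property: for every simply connected colored region $\Gamma$ there is a simply connected region $\Gamma'$, computable from $\Gamma$ in linear time, such that $\Gamma$ is $W$-tileable if and only if $\Gamma'$ is $\mathcal{R}$-tileable. Moreover, the reduction is parsimonious: the number of $W$-tilings of $\Gamma$ equals the number of $\mathcal{R}$-tilings of $\Gamma'$.
   Context: Consider $\mathbb{Z}^2$ as a union of closed unit squares with pairwise disjoint interiors. A region is a finite union of such unit squares with connected interior; it is simply connected if it is simply connected as a plane set. An ordinary Wang tile is a unit square with a color assigned to each of its four edges. A colored region is a region with a color assigned to each unit edge of its boundary. A $W$-tiling of a colored region is a tiling by translated copies of tiles from $W$ such that any two incident edges, including edges on the boundary of the region, have the same color. A rectangular tile is a rectangle of unit squares, and an $\mathcal{R}$-tiling of a region is a collection of translated copies of tiles from $\mathcal{R}$ (no rotations) with pairwise disjoint interiors whose union is the region. *)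

(* Defs.v *)
From HB Require Import structures.
From mathcomp Require Import all_boot all_order all_algebra finmap.
From mathcomp Require Import all_classical all_reals all_analysis.

Set Implicit Arguments.
Unset Strict Implicit.
Unset Printing Implicit Defensive.

Import Order.TTheory GRing.Theory Num.Theory.
Import numFieldNormedType.Exports.

Local Open Scope classical_set_scope.
Local Open Scope ring_scope.

(* The cell (x, y) stands for the closed unit square [x, x+1] * [y, y+1]. *)
Definition cell : choiceType := (int * int)%type.

Section PlaneSets.
Variable K : realType.

Definition unit_square (p : cell) : set (K * K) :=
  `[p.1%:~R, (p.1 + 1)%:~R]%classic `*` `[p.2%:~R, (p.2 + 1)%:~R]%classic.

Definition plane_set (G : {fset cell}) : set (K * K) :=
  \bigcup_(p in [set` G]) unit_square p.

Definition region (G : {fset cell}) : Prop :=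
  G != fset0 /\ connected (interior (plane_set G)).

Definition path_connected (T : topologicalType) (X : set T) : Prop :=
  forall x y : T, X x -> X y -> exists f : K -> T,
    [/\ {within `[0, 1]%classic, continuous f},
        f @` `[0, 1]%classic `<=` X, f 0 = x & f 1 = y].

(* The homotopy H contracts the loop f to its base point, keeping the base
   point fixed and staying inside X. *)
Definition null_homotopic (T : topologicalType) (X : set T) (f : K -> T) : Prop :=
  exists H : K * K -> T,
    [/\ {within `[0, 1]%classic `*` `[0, 1]%classic, continuous H},
        H @` (`[0, 1]%classic `*` `[0, 1]%classic) `<=` X,
        forall s, 0 <= s <= 1 -> H (s, 0) = f s,
        forall s, 0 <= s <= 1 -> H (s, 1) = f 0 &
        forall t, 0 <= t <= 1 -> H (0, t) = f 0 /\ H (1, t) = f 0].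

Definition simply_connected (T : topologicalType) (X : set T) : Prop :=
  [/\ X !=set0, path_connected X &
      forall f : K -> T, {within `[0, 1]%classic, continuous f} ->
        f @` `[0, 1]%classic `<=` X -> f 0 = f 1 -> null_homotopic X f].

Definition simply_connected_region (G : {fset cell}) : Prop :=
  region G /\ simply_connected (plane_set G).

End PlaneSets.

Inductive side := East | North | West | South.

Definition side_code (s : side) : bool * bool :=
  match s with
  | East => (false, false) | North => (false, true)
  | West => (true, false) | South => (true, true)
  end.

Definition side_decode (b : bool * bool) : side :=
  match b with
  | (false, false) => East | (false, true) => North
  | (true, false) => West | (true, true) => South
  end.

Lemma side_codeK : cancel side_code side_decode.
Proof. by case. Qed.

HB.instance Definition _ := Finite.copy side (can_type side_codeK).

(* (true, (x, y)) is the horizontal unit edge from (x, y) to (x+1, y);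
   (false, (x, y)) is the vertical unit edge from (x, y) to (x, y+1). *)
Definition edge : choiceType := (bool * cell)%type.

Definition cell_edge (p : cell) (s : side) : edge :=
  match s with
  | East => (false, (p.1 + 1, p.2))
  | North => (true, (p.1, p.2 + 1))
  | West => (false, p)
  | South => (true, p)
  end.

(* A unit edge lies on the boundary iff exactly one of the two cells on its
   sides belongs to G. *)
Definition boundary_edge (G : {fset cell}) (e : edge) : bool :=
  let: (horizontal, (x, y)) := e in
  ((x, y) \in G) (+)
  ((if horizontal then (x, y - 1) else (x - 1, y)) \in G).

Section WangTiles.
Variable C : choiceType.

Record colored_region := ColoredRegion {
  cells : {fset cell};
  color : {fmap edge -> C};
  color_dom : forall e, (e \in domf color) = boundary_edge cells e }.

Definition wang_tile : choiceType := {ffun side -> C}.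

Variables (W : {fset wang_tile}) (G : colored_region).

Definition is_wang_tiling (t : {ffun cells G -> W}) : bool :=
  [forall p : cells G, forall q : cells G, forall s : side, forall s' : side,
     (cell_edge (val p) s == cell_edge (val q) s') ==>
     (val (t p) s == val (t q) s')] &&
  [forall p : cells G, forall s : side,
     if (color G).[? cell_edge (val p) s]%fmap is Some a
     then val (t p) s == a else true].

Definition wang_tileable : Prop :=
  exists t : {ffun cells G -> W}, is_wang_tiling t.

Definition nb_wang_tilings : nat := #|[pred t | is_wang_tiling t]|.

End WangTiles.

(* (a, b) is the rectangle of width a and height b. *)
Definition rect : choiceType := (nat * nat)%type.

Definition rect_tile_set (R : {fset rect}) : Prop :=
  forall r, r \in R -> (0 < r.1)%N && (0 < r.2)%N.

(* (p, r) is the copy of r whose lower left unit square is p. *)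
Definition placement : choiceType := (cell * rect)%type.

Definition placed_cells (P : placement) : {fset cell} :=
  [fset ((P.1.1 + i%:Z)%R, (P.1.2 + j%:Z)%R)
    | i in iota 0 P.2.1, j in iota 0 P.2.2]%fset.

Section RectTilings.
Variables (R : {fset rect}) (G : {fset cell}).

Definition is_rect_tiling (T : {fset placement}) : bool :=
  [&& all (fun P : placement => P.2 \in R) T,
      all (fun P => all (fun Q => (P != Q) ==>
        [disjoint placed_cells P & placed_cells Q]%fset) T) T &
      (\bigcup_(P <- T) placed_cells P)%fset == G].

Definition rect_tileable : Prop := exists T, is_rect_tiling T.

(* When the tiles of R are nonempty, every tiling of G is a subset of G * R,
   because the lower left unit square of each of its tiles lies in G. *)
Definition nb_rect_tilings : nat :=
  #|` [fset T in fpowerset (G `*` R) | is_rect_tiling T]|%fset.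

End RectTilings.

(* Unit-cost random access machines with integer registers indexed by integers,
   addition and subtraction as only arithmetic, and a one-way input and output
   tape. (Multiplication is left out: at unit cost it would make the model
   unreasonably powerful.) *)
Inductive instr :=
| Const of int & int         (* X_i := v *)
| Add of int & int & int     (* X_i := X_j + X_l *)
| Sub of int & int & int     (* X_i := X_j - X_l *)
| Fetch of int & int         (* X_i := X_(X_j) *)
| Store of int & int         (* X_(X_i) := X_j *)
| JumpPos of int & nat       (* if X_i > 0, go to instruction m *)
| Read of int & nat          (* read X_i; on exhausted input go to m *)
| Write of int.              (* print X_i *)

Record ram_state := RamState {
  pc : nat; mem : int -> int; input : seq int; output : seq int }.

Definition upd (M : int -> int) (i v : int) : int -> int :=
  fun j => if j == i then v else M j.

Definition exec (ins : instr) (st : ram_state) : ram_state :=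
  let: RamState n M inp out := st in
  match ins with
  | Const i v => RamState n.+1 (upd M i v) inp out
  | Add i j l => RamState n.+1 (upd M i (M j + M l)) inp out
  | Sub i j l => RamState n.+1 (upd M i (M j - M l)) inp out
  | Fetch i j => RamState n.+1 (upd M i (M (M j))) inp out
  | Store i j => RamState n.+1 (upd M (M i) (M j)) inp out
  | JumpPos i m => RamState (if 0 < M i then m else n.+1) M inp out
  | Read i m =>
      if inp is v :: inp' then RamState n.+1 (upd M i v) inp' out
      else RamState m M inp out
  | Write i => RamState n.+1 M inp (rcons out (M i))
  end.

(* The machine halts by leaving its program. *)
Definition step (P : seq instr) (st : ram_state) : ram_state :=
  if onth P (pc st) is Some ins then exec ins st else st.

Definition outputs_within (P : seq instr) (inp : seq int) (t : nat)
    (out : seq int) : Prop :=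
  let st := iter t (step P) (RamState 0 (fun=> 0) inp [::]) in
  (size P <= pc st)%N /\ output st = out.

(* The colors of B are numbered from 1; 0 marks a side that is not on the
   boundary and hence carries no color. *)
Definition color_code (C : choiceType) (B : {fset C}) (a : option C) : int :=
  if a is Some a then (index a (enum_fset B)).+1%:Z else 0.

Definition encode_colored_cell (C : choiceType) (B : {fset C})
    (G : colored_region C) (p : cell) : seq int :=
  [:: p.1, p.2 &
   [seq color_code B (color G).[? cell_edge p s]%fmap
      | s <- [:: East; North; West; South]]].

Definition encodes_colored_region (C : choiceType) (B : {fset C})
    (G : colored_region C) (w : seq int) : Prop :=
  exists2 s : seq cell, perm_eq s (cells G) &
    w = flatten [seq encode_colored_cell B G p | p <- s].

Definition encodes_region (G : {fset cell}) (w : seq int) : Prop :=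
  exists2 s : seq cell, perm_eq s G & w = flatten [seq [:: p.1; p.2] | p <- s].

Definition input_region (K : realType) (C : choiceType) (B : {fset C})
    (G : colored_region C) : Prop :=
  simply_connected_region K (cells G) /\ (codomf (color G) `<=` B)%fset.

Definition linear_time_computable (C : choiceType) (B : {fset C})
    (D : colored_region C -> Prop) (f : colored_region C -> {fset cell}) : Prop :=
  exists (P : seq instr) (a b : nat), forall G, D G ->
    forall w, encodes_colored_region B G w ->
      exists (t : nat) (w' : seq int),
        [/\ (t <= a * size w + b)%N, outputs_within P w t w' &
            encodes_region (f G) w'].

(* Main.v *)
(** Each cell of the colored region is blown up to a block of 40 by [4 (t + gap)] unit
    squares, cut into four vertical slots of widths 8, 9, 12 and 11. The tiles are bricks
    of height [t] covering two adjacent slots and fillers covering one slot, of height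
    close to [gap], where [t] is much larger than [gap]. In every tiling the bricks form
    a running bond: consecutive rows are offset by one slot. The vertical displacement of
    a brick from its nominal place encodes a state, and a filler fitting between two bricks
    exists exactly when their states are compatible. The arithmetic of widths and heights
    (fillers are 0 modulo 3 with a parity depending on the slot, bricks are 1 modulo 3)
    forces this pattern: the only other local possibility is a pile of three fillers in
    place of a filler and a brick, and such a defect forces another one in the row above
    it, one slot to the left or farther, which cannot go on forever in a bounded region.
    The states of four consecutive rows carry the Wang tile chosen in a cell and its colors
    to the neighboring cells; on the boundary, the region is carved along the bricks that
    would encode the prescribed colors. The carving removes unit squares one after the
    other from the scaled region, each time through a retraction, so the region remains
    simply connected. *)
From Stdlib Require Import ZArith Lia.
From HB Require Import structures.
From mathcomp Require Import all_boot all_order all_algebra finmap.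
From mathcomp Require Import all_classical all_reals all_analysis.
From mathcomp Require Import ssrZ zify ring lra.
Require Import Defs.

Set Implicit Arguments.
Unset Strict Implicit.
Unset Printing Implicit Defensive.

Import Order.TTheory GRing.Theory Num.Theory.
Import numFieldNormedType.Exports.

Local Open Scope classical_set_scope.
Local Open Scope ring_scope.

(** * Simply connected regions *)

Section Clamp.
Variables (d : Order.disp_t) (T : orderType d).
Implicit Types lo hi x : T.

Definition clamp lo hi x : T := Order.max lo (Order.min x hi).

Lemma clamp_itv lo hi x : (lo <= hi)%O -> (lo <= clamp lo hi x <= hi)%O.
Proof. by move=> lohi; rewrite /clamp le_max lexx ge_max lohi ge_min lexx orbT. Qed.

Lemma clamp_id lo hi x : (lo <= x <= hi)%O -> clamp lo hi x = x.
Proof. by case/andP=> lox xhi; rewrite /clamp min_l // max_r. Qed.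

Lemma clamp_low lo hi x : (x <= lo)%O -> clamp lo hi x = lo.
Proof. by move=> xlo; rewrite /clamp max_l // ge_min xlo. Qed.

Lemma clamp_high lo hi x : (lo <= hi)%O -> (hi <= x)%O -> clamp lo hi x = hi.
Proof. by move=> lohi hix; rewrite /clamp min_r // max_r. Qed.

End Clamp.

Section Continuity.

Lemma within_continuous_comp_sub (T U V : topologicalType) (A : set T) (B : set U)
    (f : T -> U) (g : U -> V) :
  {within A, continuous f} -> f @` A `<=` B -> {within B, continuous g} ->
  {within A, continuous (g \o f)}.
Proof.
move=> /subspace_continuousP cf fAB /subspace_continuousP cg.
have fB x : A x -> B (f x) by move=> Ax; apply: fAB; exists x.
apply/subspace_continuousP => x Ax W /(cg _ (fB _ Ax)) gW.
have := cf _ Ax _ gW; rewrite /= !nbhs_simpl /within /=.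
by apply: filterS => z fzW Az; apply: fzW => //; apply: fB.
Qed.

Lemma within_continuous_eq (T U : topologicalType) (A : set T) (f g : T -> U) :
  (forall x, A x -> f x = g x) -> {within A, continuous f} -> {within A, continuous g}.
Proof. by move=> fg; apply: subspace_eq_continuous => x /set_mem; apply: fg. Qed.

Lemma continuous_pair (T U V : topologicalType) (f : T -> U) (g : T -> V) :
  continuous f -> continuous g -> continuous (fun x => (f x, g x)).
Proof. by move=> cf cg x; apply: cvg_pair; [exact: cf | exact: cg]. Qed.

Variable K : realType.

Lemma continuous_affine (a b c : K) : continuous (fun z : K * K => a * z.1 + b * z.2 + c).
Proof.
move=> z; apply: cvgD; last exact: cvg_cst.
by apply: cvgD; apply: cvgM; [exact: cvg_cst | exact: cvg_fst | exact: cvg_cst | exact: cvg_snd].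
Qed.

Lemma continuous_eq (T U : topologicalType) (f g : T -> U) :
  continuous f -> f =1 g -> continuous g.
Proof. by move=> cf /funext <-. Qed.

Lemma continuous_affine_pair (a b c a' b' c' : K) (f : K * K -> K * K) :
  (forall z, (a * z.1 + b * z.2 + c, a' * z.1 + b' * z.2 + c') = f z) -> continuous f.
Proof. by apply: continuous_eq; apply: continuous_pair; apply: continuous_affine. Qed.

Lemma continuous_affine1 (a b : K) : continuous (fun t : K => a * t + b).
Proof.
by move=> t; apply: cvgD; [apply: cvgM; [exact: cvg_cst | exact: cvg_id] | exact: cvg_cst].
Qed.

Lemma continuous_clamp (T : topologicalType) (lo hi f : T -> K) :
  continuous lo -> continuous hi -> continuous f ->
  continuous (fun x => clamp (lo x) (hi x) (f x)).
Proof.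
move=> clo chi cf x; apply: (continuous_max (clo x)).
exact: continuous_min (cf x) (chi x).
Qed.

Lemma simply_connected_retract (T U : topologicalType) (X : set T) (Y : set U)
    (i : U -> T) (r : T -> U) :
  {within Y, continuous i} -> i @` Y `<=` X -> {within X, continuous r} -> r @` X `<=` Y ->
  (forall y, Y y -> r (i y) = y) -> simply_connected K X -> simply_connected K Y.
Proof.
move=> ci iX cr rY ri [[x Xx] path_X loop_X].
have rY' z : X z -> Y (r z) by move=> Xz; apply: rY; exists z.
have iX' y : Y y -> X (i y) by move=> Yy; apply: iX; exists y.
split.
- by exists (r x); apply: rY'.
- move=> y y' Yy Yy'; have [f [cf fX f0 f1]] := path_X _ _ (iX' _ Yy) (iX' _ Yy').
  exists (r \o f); split=> /=; rewrite ?f0 ?f1 ?ri //;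
    first exact: within_continuous_comp_sub cf fX cr.
  by move=> _ [s Hs <-]; apply/rY'/fX; exists s.
- move=> f cf fY f01.
  have fYs s : `[0, 1]%classic s -> Y (f s) by move=> Hs; apply: fY; exists s.
  have [||/=|H [cH HX H0 H1 Hbase]] := loop_X (i \o f).
  + exact: within_continuous_comp_sub cf fY ci.
  + by move=> _ [s Hs <-]; apply/iX'/fYs.
  + by rewrite f01.
  have unit0 : `[0, 1]%classic (0 : K) by rewrite /= in_itv /= lexx ler01.
  exists (r \o H); split=> /=; first exact: within_continuous_comp_sub cH HX cr.
  + by move=> _ [s Hs <-]; apply/rY'/HX; exists s.
  + by move=> s Hs; rewrite H0 //= ri //; apply: fYs; rewrite /= in_itv.
  + by move=> s Hs; rewrite H1 //= ri //; apply: fYs.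
  + by move=> s Hs; have [-> ->] := Hbase _ Hs; rewrite /= ri //; apply: fYs.
Qed.

End Continuity.

Section SquareRetraction.
Variable K : realType.

(* Retracts the square [-1,1] * [0,1] onto its bottom, together with its left side
   if [l] and its right side if [r]: a horizontal stretching with clamping pushes
   the square onto three sides, then the unwanted ones are dropped to the bottom. *)
Definition square_retract (l r : bool) (w : K * K) : K * K :=
  let x := w.1 * (1 + w.2) in
  let a := clamp (-1) 1 x in
  (a, Num.min (clamp 0 w.2 (`|x| - 1)) (Num.max (Num.max (l%:R * - a) (r%:R * a)) 0)).

Definition standard_square (w : K * K) : Prop := -1 <= w.1 <= 1 /\ 0 <= w.2 <= 1.

Definition standard_sides (l r : bool) (w : K * K) : Prop :=
  [\/ w.2 = 0 /\ -1 <= w.1 <= 1, [/\ l, w.1 = -1 & 0 <= w.2 <= 1] |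
      [/\ r, w.1 = 1 & 0 <= w.2 <= 1]].

Lemma square_retract_sides l r w :
  standard_square w -> standard_sides l r (square_retract l r w).
Proof.
case: w => u v [/= /andP[u_ge u_le] /andP[v_ge v_le]]; rewrite /square_retract /standard_sides /=.
set x := u * (1 + v); set b := clamp 0 v _.
have /andP[b_ge b_le] : 0 <= b <= v by apply: clamp_itv.
have height_itv c : 0 <= Num.min b (Num.max c 0) <= 1.
  rewrite le_min b_ge le_max lexx orbT ge_min (le_trans b_le v_le); exact: isT.
have height0 c : c <= 0 -> Num.min b (Num.max c 0) = 0.
  by move=> c_le; rewrite (max_r c_le) min_r.
have [x_gt|x_le] := ltP 1 x.
  rewrite (clamp_high _ (ltW x_gt)); last by lra.
  case: r; first by constructor 3; split=> //; apply: height_itv.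
  constructor 1; split; last by lra.
  by apply: height0; rewrite mul0r ge_max lexx andbT; case: l; rewrite /= ?mul1r ?mul0r; lra.
have [x_lt|x_ge] := ltP x (-1).
  rewrite (clamp_low _ (ltW x_lt)).
  case: l; first by constructor 2; split=> //; apply: height_itv.
  constructor 1; split; last by lra.
  by apply: height0; rewrite mul0r ge_max lexx /=; case: r; rewrite /= ?mul1r ?mul0r; lra.
constructor 1; split; last by rewrite clamp_id x_ge x_le.
have -> : b = 0 by apply: clamp_low; rewrite subr_le0 ler_norml x_ge.
by rewrite min_l // le_max lexx orbT.
Qed.

Lemma square_retract_id l r w : standard_sides l r w -> square_retract l r w = w.
Proof.
case: w => u v; rewrite /standard_sides /square_retract /=.
case=> [[-> u_itv]|[-> -> /andP[v_ge v_le]]|[-> -> /andP[v_ge v_le]]].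
- rewrite addr0 mulr1 clamp_id // clamp_low; last by rewrite subr_le0 ler_norml.
  by rewrite min_l // le_max lexx orbT.
- rewrite mulN1r normrN ger0_norm; last by lra.
  rewrite (clamp_low _ (_ : - (1 + v) <= -1)) ?opprK; last by lra.
  rewrite (_ : 1 + v - 1 = v) ?clamp_id ?v_ge ?lexx //; last by lra.
  by congr pair; rewrite mul1r min_l // !le_max v_le.
- rewrite mul1r ger0_norm; last by lra.
  rewrite (clamp_high _ (_ : 1 <= 1 + v)); [|lra..].
  rewrite (_ : 1 + v - 1 = v) ?clamp_id ?v_ge ?lexx //; last by lra.
  by congr pair; rewrite mul1r min_l // !le_max v_le orbT.
Qed.

Lemma square_retract_continuous l r : continuous (square_retract l r).
Proof.
have cst (c : K) : continuous (fun _ : K * K => c) by exact: cst_continuous.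
have cx : continuous (fun w : K * K => w.1 * (1 + w.2)).
  move=> w; apply: cvgM; first exact: cvg_fst.
  by apply: cvgD; [exact: cvg_cst | exact: cvg_snd].
have ca := continuous_clamp (cst (-1)) (cst 1) cx.
have cb : continuous (fun w : K * K => clamp 0 w.2 (`|w.1 * (1 + w.2)| - 1)).
  apply: continuous_clamp => // w; first exact: cvg_snd.
  by apply: cvgB; [apply: cvg_norm; exact: cx | exact: cvg_cst].
have cl : continuous (fun w : K * K => l%:R * - clamp (-1) 1 (w.1 * (1 + w.2))).
  by move=> w; apply: cvgM; [exact: cvg_cst | apply: cvgN; exact: ca].
have cr : continuous (fun w : K * K => r%:R * clamp (-1) 1 (w.1 * (1 + w.2))).
  by move=> w; apply: cvgM; [exact: cvg_cst | exact: ca].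
apply: continuous_pair => // w; apply: (continuous_min (cb w)).
exact: continuous_max (continuous_max (cl w) (cr w)) (cst 0 w).
Qed.

Lemma simply_connected_glued_square (Q Y : set (K * K)) (l r : bool) (phi psi : K * K -> K * K) :
  closed Q -> closed Y -> continuous phi -> continuous psi ->
  (forall z, Q z -> psi (phi z) = z) -> (forall z, Q z -> standard_square (phi z)) ->
  (forall z, Q z -> Y z -> standard_sides l r (phi z)) ->
  (forall w, standard_sides l r w -> Y (psi w)) ->
  simply_connected K (Y `|` Q) -> simply_connected K Y.
Proof.
move=> cQ cY cphi cpsi phiK Qsquare QYsides sidesY.
pose rho z := if `[< Y z >] then z else psi (square_retract l r (phi z)).
have rhoQ z : Q z -> rho z = psi (square_retract l r (phi z)).
  rewrite /rho => Qz; case: asboolP => // Yz.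
  by rewrite square_retract_id ?phiK //; apply: QYsides.
have rhoY z : Y z -> rho z = z by rewrite /rho => Yz; case: asboolP.
apply: (@simply_connected_retract _ _ _ _ _ id rho).
- by apply: continuous_subspaceT => x.
- by move=> _ [z Yz <-]; left.
- apply: withinU_continuous => //.
    apply: (@within_continuous_eq _ _ _ id) => [z Yz|]; first by rewrite rhoY.
    by apply: continuous_subspaceT => x.
  apply: (@within_continuous_eq _ _ _ (psi \o (square_retract l r \o phi))) => [z Qz|].
    by rewrite rhoQ.
  apply: continuous_subspaceT => x; apply: continuous_comp; last exact: cpsi.
  by apply: continuous_comp; [exact: cphi | exact: square_retract_continuous].
- move=> _ [z YQz <-]; case: (pselect (Y z)) => [Yz|nYz]; first by rewrite rhoY.
  case: YQz => // Qz; rewrite rhoQ //.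
  by apply/sidesY/square_retract_sides/Qsquare.
- by move=> z Yz; rewrite rhoY.
Qed.

End SquareRetraction.

Section Cells.
Implicit Types (s : side) (p q : cell) (i j : int) (Y : {fset cell}).

Definition neighbor s p : cell :=
  match s with
  | East => (p.1 + 1, p.2) | North => (p.1, p.2 + 1)
  | West => (p.1 - 1, p.2) | South => (p.1, p.2 - 1)
  end.

Definition adjacent p q : bool := `|p.1 - q.1| + `|p.2 - q.2| == 1.

Lemma adjacent_sym p q : adjacent p q = adjacent q p.
Proof. by rewrite /adjacent !(distrC _ q.1) !(distrC _ q.2). Qed.

Lemma adjacentP p q : reflect (exists s, q = neighbor s p) (adjacent p q).
Proof.
case: p q => [x y] [x' y']; apply: (iffP idP); rewrite /adjacent /=; last first.
  by case=> -[] [-> ->]; lia.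
move=> dist1; have [x'E|[x'E|x'E]] : x' = x \/ x' = x + 1 \/ x' = x - 1 by lia.
- have [y'E|y'E] : y' = y + 1 \/ y' = y - 1 by lia.
    by exists North; rewrite x'E y'E.
  by exists South; rewrite x'E y'E.
- by exists East => /=; congr pair; lia.
- by exists West => /=; congr pair; lia.
Qed.

Lemma adjacent_neighbor s p : adjacent p (neighbor s p).
Proof. by apply/adjacentP; exists s. Qed.

(* The cell reached from [p] by [i] steps along its side [s] and [j] steps away from
   that side, towards the opposite one. *)
Definition frame s p i j : cell :=
  match s with
  | East => (p.1 - j, p.2 + i) | North => (p.1 + i, p.2 - j)
  | West => (p.1 + j, p.2 + i) | South => (p.1 + i, p.2 + j)
  end.

Lemma frame0 s p : frame s p 0 0 = p.
Proof. by case: p => x y; case: s; rewrite /= ?addr0 ?subr0. Qed.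

Lemma frame_neighbor s p : frame s p 0 (-1) = neighbor s p.
Proof. by case: s; rewrite /= ?addr0 ?opprK. Qed.

Lemma frame_frame s p i j i' j' : frame s (frame s p i j) i' j' = frame s p (i + i') (j + j').
Proof. by case: s => /=; congr pair; lia. Qed.

Lemma frame_inj s p i j i' j' : frame s p i j = frame s p i' j' -> i = i' /\ j = j'.
Proof. by case: s => /= -[]; lia. Qed.

Lemma frame_surj s p q : exists i j, q = frame s p i j.
Proof.
case: q => x y; case: s.
- by exists (y - p.2), (p.1 - x) => /=; congr pair; lia.
- by exists (x - p.1), (p.2 - y) => /=; congr pair; lia.
- by exists (y - p.2), (x - p.1) => /=; congr pair; lia.
- by exists (x - p.1), (y - p.2) => /=; congr pair; lia.
Qed.

Lemma mem_frame_remove Y q s i j :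
  (frame s q i j \in (Y `\ q)%fset) = ((i, j) != (0, 0)) && (frame s q i j \in Y).
Proof.
rewrite !inE; congr (~~ _ && _); apply/eqP/eqP => [|[-> ->]]; last exact: frame0.
by rewrite -[X in _ = X](frame0 s) => /frame_inj[-> ->].
Qed.

Lemma frame_adjacent s p i j i' j' :
  adjacent (frame s p i j) (frame s p i' j') = (`|i - i'| + `|j - j'| == 1).
Proof. by case: s => /=; rewrite /adjacent /=; lia. Qed.

Definition edge_closed Y (P : cell -> Prop) : Prop :=
  forall p q, p \in Y -> q \in Y -> adjacent p q -> P p -> P q.

Definition edge_connected Y : Prop := forall P : cell -> Prop,
  (exists2 p, p \in Y & P p) -> edge_closed Y P -> forall p, p \in Y -> P p.

Lemma edge_closed_iff Y P p q :
  edge_closed Y P -> p \in Y -> q \in Y -> adjacent p q -> P p <-> P q.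
Proof.
move=> closedP pY qY pq; split; apply: closedP => //.
by rewrite adjacent_sym.
Qed.

(* The cell [q] is exposed on its side [s], and every cell of [Y] around [q] is joined
   to the cell opposite to that side by cells of [Y] around [q]. *)
Definition removable Y q s : Prop :=
  [/\ q \in Y, neighbor s q \notin Y, frame s q 0 1 \in Y &
    forall i, i = -1 \/ i = 1 -> (frame s q i (-1) \in Y -> frame s q i 0 \in Y) /\
      (frame s q i 0 \in Y -> frame s q i 1 \in Y)].

Lemma edge_connected_remove Y q s :
  removable Y q s -> edge_connected Y -> edge_connected (Y `\ q)%fset.
Proof.
move=> [qY exposed baseY lateral] connY P [p0 /fsetD1P[p0q p0Y] Pp0] closedP p /fsetD1P[pq pY].
have around c : c \in Y -> adjacent q c -> P c <-> P (frame s q 0 1).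
  have [i [j ->]] := frame_surj s q c => cY; rewrite -{1}(frame0 s q) frame_adjacent => ij1.
  have [j0|[ij|ij]] : j = 0 \/ (i, j) = (0, -1) \/ (i, j) = (0, 1).
    by have [|[|]] : j = 0 \/ j = -1 \/ j = 1; [lia| |move=> jE..]; auto; right;
      [left | right]; congr pair; lia.
  - have i1 : i = -1 \/ i = 1 by lia.
    rewrite {}j0 in cY *; have i1Y := (lateral i i1).2 cY.
    rewrite (@edge_closed_iff _ _ _ (frame s q i 1) closedP).
    + by apply: (edge_closed_iff closedP);
        rewrite ?mem_frame_remove ?i1Y ?baseY ?frame_adjacent ?xpair_eqE; lia.
    + by rewrite mem_frame_remove cY andbT xpair_eqE; lia.
    + by rewrite mem_frame_remove i1Y andbT xpair_eqE; lia.
    + by rewrite frame_adjacent; lia.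
  - by case: ij cY => -> ->; rewrite frame_neighbor (negbTE exposed).
  - by case: ij => -> ->.
suff /(_ p pY)[Pp _] : forall c, c \in Y -> (c != q -> P c) /\ (c = q -> P (frame s q 0 1)).
  exact: Pp.
apply: connY; first by exists p0 => //; split=> // p0E; rewrite p0E eqxx in p0q.
move=> c c' cY c'Y cc' [Pc Pbase]; split=> [c'q|c'q].
  have [cq|cq] := eqVneq c q.
    by apply/(around c') => //; [rewrite -cq | apply: Pbase].
  by apply: (closedP c c') => //; rewrite ?inE ?cq ?c'q //; apply: Pc.
have cq : c != q by apply: contraTneq cc' => ->; rewrite c'q /adjacent !subrr.
by apply/(around c) => //; [rewrite -c'q adjacent_sym | apply: Pc].
Qed.

End Cells.

Section UnitSquares.
Variable K : realType.
Implicit Types (s : side) (p q : cell) (z w : K * K) (Y : {fset cell}).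

Lemma unit_squareP p z : unit_square p z <->
  p.1%:~R <= z.1 <= p.1%:~R + 1 /\ p.2%:~R <= z.2 <= p.2%:~R + 1.
Proof. by rewrite /unit_square /= !in_itv /= !intrD; split. Qed.

Lemma closed_unit_square p : closed (unit_square p : set (K * K)).
Proof.
apply: closedI; apply: closed_comp; try exact: itv_closed.
- by move=> z _; exact: cvg_fst.
- by move=> z _; exact: cvg_snd.
Qed.

Lemma closed_plane_set Y : closed (plane_set Y : set (K * K)).
Proof.
by apply: closed_bigcup => [|p _]; [exact: finite_fset | exact: closed_unit_square].
Qed.

Lemma plane_set_remove Y q : q \in Y ->
  plane_set Y = plane_set (Y `\ q)%fset `|` unit_square q :> set (K * K).
Proof.
move=> qY; apply/seteqP; split=> z.
  case=> p /= pY zp; have [<-|pq] := eqVneq p q; first by right.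
  by left; exists p => //=; rewrite !inE pq.
by case=> [[p /= /fsetD1P[_ pY] zp]|zq]; [exists p | exists q].
Qed.

(* Affine coordinates in which the unit square of [p] is [[-1,1] * [0,1]] with its side
   [s] on top. *)
Definition frame_coord s p z : K * K :=
  match s with
  | East => (2 * (z.2 - p.2%:~R) - 1, z.1 - p.1%:~R)
  | North => (2 * (z.1 - p.1%:~R) - 1, z.2 - p.2%:~R)
  | West => (2 * (z.2 - p.2%:~R) - 1, p.1%:~R + 1 - z.1)
  | South => (2 * (z.1 - p.1%:~R) - 1, p.2%:~R + 1 - z.2)
  end.

Definition frame_point s p w : K * K :=
  match s with
  | East => (p.1%:~R + w.2, p.2%:~R + (w.1 + 1) / 2)
  | North => (p.1%:~R + (w.1 + 1) / 2, p.2%:~R + w.2)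
  | West => (p.1%:~R + 1 - w.2, p.2%:~R + (w.1 + 1) / 2)
  | South => (p.1%:~R + (w.1 + 1) / 2, p.2%:~R + 1 - w.2)
  end.

Lemma frame_coordK s p : cancel (frame_coord s p) (frame_point s p).
Proof. by case=> x y; case: s => /=; congr pair; field. Qed.

Lemma frame_pointK s p : cancel (frame_point s p) (frame_coord s p).
Proof. by case=> x y; case: s => /=; congr pair; field. Qed.

Lemma frame_coord_continuous s p : continuous (frame_coord s p).
Proof.
case: s;
  [ apply: (@continuous_affine_pair K 0 2 (- 2 * p.2%:~R - 1) 1 0 (- p.1%:~R))
  | apply: (@continuous_affine_pair K 2 0 (- 2 * p.1%:~R - 1) 0 1 (- p.2%:~R))
  | apply: (@continuous_affine_pair K 0 2 (- 2 * p.2%:~R - 1) (-1) 0 (p.1%:~R + 1))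
  | apply: (@continuous_affine_pair K 2 0 (- 2 * p.1%:~R - 1) 0 (-1) (p.2%:~R + 1)) ] => z;
  by congr pair; ring.
Qed.

Lemma frame_point_continuous s p : continuous (frame_point s p).
Proof.
case: s;
  [ apply: (@continuous_affine_pair K 0 1 p.1%:~R 2^-1 0 (p.2%:~R + 2^-1))
  | apply: (@continuous_affine_pair K 2^-1 0 (p.1%:~R + 2^-1) 0 1 p.2%:~R)
  | apply: (@continuous_affine_pair K 0 (-1) (p.1%:~R + 1) 2^-1 0 (p.2%:~R + 2^-1))
  | apply: (@continuous_affine_pair K 2^-1 0 (p.1%:~R + 2^-1) 0 (-1) (p.2%:~R + 1)) ] => w;
  by congr pair; field.
Qed.

Lemma unit_square_frame s p (i j : int) z : unit_square (frame s p i j) z <->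
  2 * i%:~R - 1 <= (frame_coord s p z).1 <= 2 * i%:~R + 1 /\
  - j%:~R <= (frame_coord s p z).2 <= 1 - j%:~R.
Proof.
rewrite unit_squareP; case: s => /=; rewrite !intrD ?intrN;
  by split=> -[/andP[? ?] /andP[? ?]]; split; apply/andP; split; lra.
Qed.

Lemma unit_square_standard s p z : unit_square p z <-> standard_square (frame_coord s p z).
Proof.
by rewrite -{1}(frame0 s p) unit_square_frame mulr0 !sub0r !add0r oppr0 addr0.
Qed.

Lemma int_itv_overlap (a : K) (i j : int) : i%:~R <= a <= i%:~R + 1 ->
  j%:~R <= a <= j%:~R + 1 -> [\/ i = j - 1 /\ a = j%:~R, i = j | i = j + 1 /\ a = j%:~R + 1].
Proof.
move=> /andP[a_ge_i a_le_i] /andP[a_ge_j a_le_j].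
have ij : i <= j + 1 by rewrite -(ler_int K) intrD; lra.
have ji : j <= i + 1 by rewrite -(ler_int K) intrD; lra.
have [iE|[iE|iE]] : i = j - 1 \/ i = j \/ i = j + 1 by lia.
- by constructor 1; split=> //; move: a_le_i; rewrite iE intrB; lra.
- by constructor 2.
- by constructor 3; split=> //; move: a_ge_i; rewrite iE intrD; lra.
Qed.

Lemma int_itv_near (a : K) (i j : int) : i%:~R <= a <= i%:~R + 1 ->
  j%:~R <= a <= j%:~R + 1 -> `|i - j| <= 1.
Proof. by move=> ai /(int_itv_overlap ai) {ai}[[-> _]|->|[-> _]]; lia. Qed.

Lemma exposed_square_sides Y q s z : removable Y q s -> unit_square q z ->
  plane_set (Y `\ q)%fset z ->
  standard_sides (frame s q (-1) 0 \in Y) (frame s q 1 0 \in Y) (frame_coord s q z).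
Proof.
move=> [_ exposed _ lateral] /(unit_square_standard s).
case=> /andP[u_ge u_le] /andP[v_ge v_le] [p /= /fsetD1P[pq pY]].
have [i [j pE]] := frame_surj s q p; rewrite {p}pE in pq pY *.
case/unit_square_frame; move: (frame_coord s q z) u_ge u_le v_ge v_le => [u v] /= *.
have := @int_itv_overlap ((u + 1) / 2) i 0; have := @int_itv_overlap (1 - v) j 0.
rewrite /standard_sides /=.
case=> [||[jE vE]|jE|[jE vE]]; [by apply/andP; split; lra..| | |].
- case=> [||[iE uE]|iE|[iE uE]]; [by apply/andP; split; lra..| | |]; rewrite iE jE in pq pY.
  + by constructor 2; rewrite (lateral _ _).1 //; [split; lra | left].
  + by rewrite sub0r frame_neighbor (negbTE exposed) in pY.
  + by constructor 3; rewrite (lateral _ _).1 //; [split; lra | right].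
- case=> [||[iE uE]|iE|[iE uE]]; [by apply/andP; split; lra..| | |]; rewrite iE jE in pq pY.
  + by constructor 2; rewrite pY; split; lra.
  + by rewrite frame0 eqxx in pq.
  + by constructor 3; rewrite pY; split; lra.
- by constructor 1; split; lra.
Qed.

Lemma standard_sides_plane_set Y q s w : removable Y q s ->
  standard_sides (frame s q (-1) 0 \in Y) (frame s q 1 0 \in Y) w ->
  plane_set (Y `\ q)%fset (frame_point s q w).
Proof.
move=> [_ _ baseY _] sides.
have in_frame (i j : int) : frame s q i j \in Y -> (i, j) != (0, 0) ->
    2 * i%:~R - 1 <= w.1 <= 2 * i%:~R + 1 -> - j%:~R <= w.2 <= 1 - j%:~R ->
    plane_set (Y `\ q)%fset (frame_point s q w).
  move=> ijY ij0 w1 w2; exists (frame s q i j); last first.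
    by apply/unit_square_frame; rewrite frame_pointK.
  by rewrite /= mem_frame_remove ij0.
case: sides => [[v0 u_itv]|[leftY u_left v_itv]|[rightY u_right v_itv]].
- by apply: (in_frame 0 1) => //; lra.
- by apply: (in_frame (-1) 0) => //; rewrite ?intrN; lra.
- by apply: (in_frame 1 0) => //; lra.
Qed.

Lemma simply_connected_remove Y q s : removable Y q s ->
  simply_connected K (plane_set Y : set (K * K)) ->
  simply_connected K (plane_set (Y `\ q)%fset : set (K * K)).
Proof.
move=> removable_q; have [qY _ _ _] := removable_q; rewrite (plane_set_remove qY).
apply: (@simply_connected_glued_square K _ _ (frame s q (-1) 0 \in Y) (frame s q 1 0 \in Y)
  (frame_coord s q) (frame_point s q)).
- exact: closed_unit_square.
- exact: closed_plane_set.
- exact: frame_coord_continuous.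
- exact: frame_point_continuous.
- by move=> z _; rewrite frame_coordK.
- by move=> z /(unit_square_standard s).
- by move=> z; apply: exposed_square_sides removable_q.
- by move=> w; apply: standard_sides_plane_set removable_q.
Qed.

End UnitSquares.

Section Regions.
Variable K : realType.
Implicit Types (p q : cell) (z w : K * K) (Y : {fset cell}).

Definition open_square p : set (K * K) :=
  [set z | p.1%:~R < z.1 < p.1%:~R + 1 /\ p.2%:~R < z.2 < p.2%:~R + 1].

Definition center p : K * K := (p.1%:~R + 2^-1, p.2%:~R + 2^-1).

Definition line_point z w (t : K) : K * K :=
  (z.1 + t * (w.1 - z.1), z.2 + t * (w.2 - z.2)).

Lemma line_point0 z w : line_point z w 0 = z.
Proof. by case: z => x y; rewrite /line_point /= !mul0r !addr0. Qed.

Lemma line_point1 z w : line_point z w 1 = w.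
Proof. by case: z w => [x y] [x' y']; rewrite /line_point /= !mul1r !(addrC _ (_ - _)) !subrK. Qed.

Lemma line_point_continuous z w : continuous (line_point z w).
Proof.
apply: continuous_pair.
  by apply: continuous_eq (@continuous_affine1 K (w.1 - z.1) z.1) _ => t; ring.
by apply: continuous_eq (@continuous_affine1 K (w.2 - z.2) z.2) _ => t; ring.
Qed.

Lemma open_square_sub p z : open_square p z -> unit_square p z.
Proof.
by case=> /andP[? ?] /andP[? ?]; apply/unit_squareP; split; apply/andP; split; exact: ltW.
Qed.

Lemma open_square_uniq p q z : open_square p z -> unit_square q z -> q = p.
Proof.
case: p q => [x y] [x' y'] zp; have /unit_squareP[zp1 zp2] := open_square_sub zp.
case: zp => /andP[? ?] /andP[? ?] /unit_squareP[zq1 zq2]; congr pair.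
- by case: (int_itv_overlap zq1 zp1) => // -[_ zE]; exfalso; move: zE => /=; lra.
- by case: (int_itv_overlap zq2 zp2) => // -[_ zE]; exfalso; move: zE => /=; lra.
Qed.

Lemma center_open_square p : open_square p (center p).
Proof. by split; apply/andP; split=> /=; lra. Qed.

Lemma center_unit_square p : unit_square p (center p).
Proof. exact/open_square_sub/center_open_square. Qed.

Lemma line_point_center p z t :
  unit_square p z -> 0 < t <= 1 -> open_square p (line_point z (center p) t).
Proof.
move=> /unit_squareP[z1 z2] /andP[t_gt0 t_le1].
have inside (a b : K) : a <= b <= a + 1 -> a < b + t * (a + 2^-1 - b) < a + 1.
  move=> /andP[ab ba].
  have low : 0 <= (1 - t) * (b - a) by apply: mulr_ge0; lra.
  have high : 0 <= (1 - t) * (a + 1 - b) by apply: mulr_ge0; lra.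
  by apply/andP; split; nra.
by split; apply: inside.
Qed.

Lemma nbhs_line_point z w (V : set (K * K)) :
  nbhs z V -> exists2 t, 0 < t <= 1 & V (line_point z w t).
Proof.
move=> zV; have : nbhs (0 : K) (line_point z w @^-1` V).
  by apply: line_point_continuous; rewrite line_point0.
case/nbhs_ballP=> e /= e_gt0 ballV.
exists (Num.min (e / 2) 1); first by rewrite lt_min ltr01 divr_gt0 //= ge_min lexx orbT.
apply: ballV; rewrite /ball /= sub0r normrN ger0_norm; last first.
  by rewrite le_min ler01 divr_ge0 // ltW.
by rewrite gt_min; apply/orP; left; lra.
Qed.

Lemma interior_unit_square Y p z :
  interior (plane_set Y : set (K * K)) z -> unit_square p z -> p \in Y.
Proof.
move=> /(nbhs_line_point (center p))[t t01 [q /= qY zq]] zp.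
by rewrite -(open_square_uniq (line_point_center zp t01) zq).
Qed.

Lemma open_square_interior Y p z :
  p \in Y -> open_square p z -> interior (plane_set Y : set (K * K)) z.
Proof.
move=> pY [/andP[? ?] /andP[? ?]]; apply/nbhs_ballP.
exists (Num.min (Num.min (z.1 - p.1%:~R) (p.1%:~R + 1 - z.1))
                (Num.min (z.2 - p.2%:~R) (p.2%:~R + 1 - z.2))) => /=.
  by rewrite !lt_min !subr_gt0; apply/andP; split; apply/andP; split.
move=> w [/= zw1 zw2]; exists p => //; apply/unit_squareP; move: zw1 zw2.
rewrite /ball /= !lt_min !ltr_norml => /andP[/andP[? ?] _] /andP[_ /andP[? ?]].
by split; apply/andP; split; lra.
Qed.

Lemma center_interior Y p : p \in Y -> interior (plane_set Y : set (K * K)) (center p).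
Proof. by move=> pY; apply: open_square_interior pY _; apply: center_open_square. Qed.

Lemma edge_closed_interior Y (P : cell -> Prop) p q z : edge_closed Y P ->
  interior (plane_set Y : set (K * K)) z -> unit_square p z -> unit_square q z -> P p -> P q.
Proof.
move=> closedP intz zp zq.
have step c c' : unit_square c z -> unit_square c' z -> c.1 = c'.1 \/ c.2 = c'.2 -> P c -> P c'.
  move=> zc zc' aligned.
  have [cY c'Y] := (interior_unit_square intz zc, interior_unit_square intz zc').
  have [->//|cc'] := eqVneq c c'; apply: closedP => //.
  have [[zc1 zc2] [zc'1 zc'2]] := ((unit_squareP _ _).1 zc, (unit_squareP _ _).1 zc').
  have near1 := int_itv_near zc1 zc'1; have near2 := int_itv_near zc2 zc'2.
  move: {intz zc zc' cY c'Y zc1 zc2 zc'1 zc'2} cc' aligned near1 near2.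
  by case: c c' => [a b] [a' b']; rewrite /adjacent xpair_eqE /=; lia.
have zmid : unit_square (p.1, q.2) z.
  by apply/unit_squareP; split; [case/unit_squareP: zp | case/unit_squareP: zq].
by move=> /(step _ _ zp zmid (or_introl erefl)); apply: step => //; right.
Qed.

Lemma region_edge_connected Y : region K Y -> edge_connected Y.
Proof.
case=> _ connU P [p0 p0Y Pp0] closedP p1 p1Y; apply: contrapT => nPp1.
pose U := interior (plane_set Y : set (K * K)).
pose part (b : bool) := [fset p in Y | `[< P p >] == b]%fset.
have partP b p : (p \in part b) = (p \in Y) && (`[< P p >] == b) by rewrite !inE.
have part_split : U `&` plane_set (part true) = U `&` ~` plane_set (part false).
  apply/seteqP; split=> z [Uz]; last first.
    have [p pY zp] := interior_subset Uz; move=> out; split=> //; exists p => //=.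
    rewrite partP pY; apply: contrapT => nP; apply: out; exists p => //=.
    by rewrite partP pY; move: nP; case: `[< _ >].
  case=> p /=; rewrite partP => /andP[_ /eqP/asboolP Pp] zp; split=> // -[q /=].
  rewrite partP => /andP[_ /eqP/asboolP nPq] zq.
  exact/nPq/(edge_closed_interior closedP Uz zp zq).
have UE : U `&` plane_set (part true) = U.
  apply: connU.
  - exists (center p0); split; first exact: center_interior.
    exists p0 => /=; last exact: center_unit_square.
    by rewrite partP p0Y; apply/eqP/asboolP.
  - by exists (~` plane_set (part false)) => //; apply/closed_openC/closed_plane_set.
  - by exists (plane_set (part true)) => //; apply: closed_plane_set.
have : (U `&` plane_set (part true)) (center p1) by rewrite UE; apply: center_interior.
rewrite part_split => -[_]; apply; exists p1 => /=; last exact: center_unit_square.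
by rewrite partP p1Y; apply/eqP/asboolP.
Qed.

Lemma center_line_interior Y p q t : p \in Y -> q \in Y -> adjacent p q -> 0 <= t <= 1 ->
  interior (plane_set Y : set (K * K)) (line_point (center p) (center q) t).
Proof.
move=> pY + /adjacentP[s qE]; rewrite {q}qE => qY /andP[t_ge0 t_le1].
apply/nbhs_ballP; exists 2^-1 => //= w [/= w1 w2].
suff [|] : unit_square p w \/ unit_square (neighbor s p) w by [exists p|exists (neighbor s p)].
case: s qY w1 w2 => qY; rewrite !unit_squareP /ball /= ?intrD ?intrN !ltr_norml;
  move=> /andP[? ?] /andP[? ?].
- by case: (leP w.1 (p.1%:~R + 1)) => ?; [left | right]; split; apply/andP; split; lra.
- by case: (leP w.2 (p.2%:~R + 1)) => ?; [left | right]; split; apply/andP; split; lra.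
- by case: (leP p.1%:~R w.1) => ?; [left | right]; split; apply/andP; split; lra.
- by case: (leP p.2%:~R w.2) => ?; [left | right]; split; apply/andP; split; lra.
Qed.

Lemma line_connected_component (U : set (K * K)) z w :
  (forall t, 0 <= t <= 1 -> U (line_point z w t)) -> connected_component U z w.
Proof.
move=> lineU; apply: (@connected_component_max _ U (line_point z w @` `[0, 1]%classic)).
- by exists 0; rewrite ?line_point0 //= in_itv /= lexx ler01.
- by move=> _ [t + <-]; rewrite /= in_itv /=; apply: lineU.
- apply: connected_continuous_connected; first exact: segment_connected.
  by apply: continuous_subspaceT; exact: line_point_continuous.
- by exists 1; rewrite ?line_point1 //= in_itv /= lexx ler01.
Qed.

Lemma edge_connected_region Y : Y != fset0 -> edge_connected Y -> region K Y.
Proof.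
move=> Y0 connY; split=> //; have [p0 p0Y] := fset0Pn _ Y0.
set U := interior _; suff <- : connected_component U (center p0) = U.
  exact: component_connected.
have from_center p z : p \in Y -> U z -> unit_square p z -> connected_component U (center p) z.
  move=> pY Uz zp; apply/connected_component_sym/line_connected_component => t /andP[t_ge0 t_le1].
  have [t_gt0|t_le0] := ltP 0 t.
    by apply: open_square_interior pY _; apply: line_point_center => //; rewrite t_gt0.
  by rewrite (_ : t = 0) ?line_point0 //; apply/le_anti/andP.
have centers p : p \in Y -> connected_component U (center p0) (center p).
  apply: (connY (fun p => connected_component U (center p0) (center p))).
    by exists p0 => //; apply/connected_component_refl/center_interior.
  move=> q q' qY q'Y qq'.
  move/connected_component_trans; apply; apply: line_connected_component => t.
  exact: center_line_interior.
apply/seteqP; split=> [|z Uz]; first exact: connected_component_sub.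
have [p pY zp] := interior_subset Uz.
exact: connected_component_trans (centers p pY) (from_center p z pY Uz zp).
Qed.

End Regions.

Section Paths.
Variable K : realType.

Lemma compact_within_unif_continuous (T U : pseudoMetricType K) (A : set T) (f : T -> U) (e : K) :
  compact A -> {within A, continuous f} -> 0 < e ->
  exists2 d : K, 0 < d & forall z w, A z -> A w -> ball z d w -> ball (f z) e (f w).
Proof.
move=> cptA /subspace_continuousP cf e_gt0.
have := (compact_near_coveringP A).1 cptA K (0 : K)^'+
  (fun d z => A z -> forall w, A w -> ball z d w -> ball (f z) e (f w)) _.
case=> [x Ax|d /= d_gt0 unif].
  have /nbhs_ballP[r /= r_gt0 near_x] := cf x Ax _ (nbhsx_ballx (f x) (e / 2) ltac:(lra)).
  exists (ball x (r / 2), [set d | d < r / 2]).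
    by split; [apply: nbhsx_ballx; lra | apply: nbhs_right_lt; lra].
  move=> [z d] [/= xz dr] Az w Aw zw; rewrite [e]splitr; apply: (@ball_triangle _ _ (f x)).
    by apply/ball_sym/near_x => //; apply: le_ball xz; lra.
  apply: near_x => //; rewrite [r]splitr; apply: ball_triangle xz _.
  by apply: le_ball zw; exact: ltW.
exists (d / 2); first by lra.
move=> z w Az Aw zw; apply: (unif (d / 2) _ _ z Az Az w Aw zw) => /=; last by lra.
by rewrite sub0r normrN ger0_norm; lra.
Qed.

Definition path_join (T : Type) (f g : K -> T) (s : K) : T :=
  if s <= 2^-1 then f (2 * s) else g (2 * s - 1).

Section Join.
Variables (T : topologicalType) (f g : K -> T).
Hypothesis fg : f 1 = g 0.

Lemma path_join_left s : s <= 2^-1 -> path_join f g s = f (2 * s).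
Proof. by rewrite /path_join => ->. Qed.

Lemma path_join_right s : 2^-1 <= s -> path_join f g s = g (2 * s - 1).
Proof.
rewrite /path_join => s_ge; case: ifP => // s_le.
have -> : s = 2^-1 by apply/le_anti/andP.
by rewrite divff ?subrr // -fg; congr f; field.
Qed.

Lemma path_join0 : path_join f g 0 = f 0.
Proof. by rewrite path_join_left ?mulr0 //; lra. Qed.

Lemma path_join1 : path_join f g 1 = g 1.
Proof. by rewrite path_join_right; [congr g | ]; lra. Qed.

Lemma path_join_forall (P : T -> Prop) :
  (forall s, 0 <= s <= 1 -> P (f s)) -> (forall s, 0 <= s <= 1 -> P (g s)) ->
  forall s, 0 <= s <= 1 -> P (path_join f g s).
Proof.
move=> Pf Pg s /andP[s_ge s_le]; have [s_half|s_half] := leP s 2^-1.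
  by rewrite path_join_left //; apply: Pf; apply/andP; split; lra.
by rewrite path_join_right; [apply: Pg; apply/andP; split|]; lra.
Qed.

Lemma path_join_continuous : {within `[0, 1]%classic, continuous f} ->
  {within `[0, 1]%classic, continuous g} -> {within `[0, 1]%classic, continuous (path_join f g)}.
Proof.
move=> cf cg.
have -> : `[0, 1]%classic = `[0, 2^-1]%classic `|` `[2^-1, 1]%classic :> set K.
  apply/seteqP; split=> s; rewrite /= !in_itv /=; last by case=> /andP[? ?]; apply/andP; split; lra.
  move=> /andP[s_ge s_le]; have [s_half|s_half] := leP s 2^-1; [left | right].
    by rewrite s_ge.
  by rewrite s_le ltW.
apply: withinU_continuous; [exact: itv_closed | exact: itv_closed | |].
  apply: (@within_continuous_eq _ _ _ (f \o (fun s : K => 2 * s + 0))) => [s|].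
    by rewrite /= in_itv /= addr0 => /andP[_ s_half]; rewrite path_join_left.
  apply: within_continuous_comp_sub cf; first exact/continuous_subspaceT/continuous_affine1.
  by move=> _ [s + <-]; rewrite /= !in_itv /= => /andP[? ?]; apply/andP; split; lra.
apply: (@within_continuous_eq _ _ _ (g \o (fun s : K => 2 * s + -1))) => [s|].
  by rewrite /= in_itv /= => /andP[s_half _]; rewrite path_join_right.
apply: within_continuous_comp_sub cg; first exact/continuous_subspaceT/continuous_affine1.
by move=> _ [s + <-]; rewrite /= !in_itv /= => /andP[? ?]; apply/andP; split; lra.
Qed.

End Join.
End Paths.

Lemma grid_parity (n : nat) (h v : nat -> nat -> bool) :
  (forall i j, (i < n)%N -> (j < n)%N -> h i j (+) v i.+1 j (+) h i j.+1 (+) v i j = false) ->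
  (forall j, (j < n)%N -> v 0 j = false /\ v n j = false) ->
  (forall i, (i < n)%N -> h i n = false) ->
  \big[addb/false]_(i < n) h i 0 = false.
Proof.
move=> even_squares vertical_sides top_side.
have two_rows j k : (j < n)%N -> (k <= n)%N ->
    \big[addb/false]_(i < k) h i j (+) \big[addb/false]_(i < k) h i j.+1 = v k j (+) v 0 j.
  move=> jn; elim: k => [|k IH] kn; first by rewrite !big_ord0; case: (v 0 j).
  have := IH (ltnW kn); have := even_squares k j kn jn; rewrite !big_ord_recr /=.
  move: (bigop _ _ _) (bigop _ _ _) => low high.
  by case: low; case: high; case: (h k j); case: (h k j.+1); case: (v k j); case: (v k.+1 j);
    case: (v 0 j).
have all_rows j : (j <= n)%N ->
    \big[addb/false]_(i < n) h i 0 = \big[addb/false]_(i < n) h i j.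
  elim: j => // j IH jn; rewrite (IH (ltnW jn)).
  have := two_rows j n jn (leqnn n); have [-> ->] := vertical_sides j jn.
  by move: (bigop _ _ _) (bigop _ _ _) => [] [].
by rewrite (all_rows n (leqnn n)); apply: big1 => i _; exact: top_side.
Qed.

(* A set [X] that near the point [(x, y)] consists of two opposite quadrants is not
   simply connected if the two quadrants are joined by a path [far] from the point: the
   number of times that a discretized loop passes from one quadrant to the other is
   invariant modulo 2 under homotopies. *)
Section Pinch.
Variables (K : realType) (X : set (K * K)) (x y eps : K).
Hypothesis eps_sign : eps = 1 \/ eps = -1.
Implicit Types z w : K * K.

Definition near_vertex z : bool := (`|z.1 - x| < 2^-1) && (`|z.2 - y| < 2^-1).

Definition first_quadrant z : bool := (0 <= z.1 - x) && (0 <= eps * (z.2 - y)).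

Definition crosses z w : bool :=
  [&& near_vertex z, near_vertex w & first_quadrant z != first_quadrant w].

Hypothesis near_vertex_quadrants : forall z, X z -> near_vertex z -> ~~ first_quadrant z ->
  z.1 - x <= 0 /\ eps * (z.2 - y) <= 0.

Lemma crosses_self z : crosses z z = false.
Proof. by rewrite /crosses eqxx !andbF. Qed.

Lemma crosses_close z w : X z -> X w -> ball z 8^-1 w -> crosses z w ->
  `|z.1 - x| <= 8^-1 /\ `|z.2 - y| <= 8^-1.
Proof.
move=> Xz Xw zw /and3P[near_z near_w sides].
move: sides; case zE: (first_quadrant z); case wE: (first_quadrant w) => //= _.
- have [w1_le w2_le] := near_vertex_quadrants Xw near_w (negbT wE); case/andP: zE => z1_ge z2_ge.
  case: zw; rewrite /ball /= !ltr_norml !ler_norml => /andP[? ?] /andP[? ?].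
  by move: z2_ge w2_le; case: eps_sign => -> ? ?; split; apply/andP; split; lra.
- have [z1_le z2_le] := near_vertex_quadrants Xz near_z (negbT zE); case/andP: wE => w1_ge w2_ge.
  case: zw; rewrite /ball /= !ltr_norml !ler_norml => /andP[? ?] /andP[? ?].
  by move: w2_ge z2_le; case: eps_sign => -> ? ?; split; apply/andP; split; lra.
Qed.

Lemma close_near_vertex z w :
  `|z.1 - x| <= 8^-1 /\ `|z.2 - y| <= 8^-1 -> ball z 4^-1 w -> near_vertex w.
Proof.
rewrite /near_vertex !ler_norml => -[/andP[? ?] /andP[? ?]] [].
rewrite /ball /= !ltr_norml => /andP[? ?] /andP[? ?].
by apply/andP; split; apply/andP; split; lra.
Qed.

Lemma square_crosses z1 z2 z3 z4 : X z1 -> X z2 -> X z3 -> X z4 ->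
  ball z1 8^-1 z2 -> ball z2 8^-1 z3 -> ball z4 8^-1 z3 -> ball z1 8^-1 z4 ->
  crosses z1 z2 (+) crosses z2 z3 (+) crosses z4 z3 (+) crosses z1 z4 = false.
Proof.
move=> X1 X2 X3 X4 z12 z23 z43 z14.
case: (boolP [&& near_vertex z1, near_vertex z2, near_vertex z3 & near_vertex z4]).
  case/and4P=> near1 near2 near3 near4; rewrite /crosses near1 near2 near3 near4 /=.
  by do 4 case: first_quadrant.
move=> not_all_near.
have refl4 z : ball z 4^-1 z by apply: ballxx; lra.
have ball4 z w : ball z 8^-1 w -> ball z 4^-1 w by apply: le_ball; lra.
have tri4 z w u : ball z 8^-1 w -> ball w 8^-1 u -> ball z 4^-1 u.
  by move=> zw wu; rewrite (_ : 4^-1 = 8^-1 + 8^-1); [apply: ball_triangle zw wu | lra].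
have no_cross z w : X z -> X w -> ball z 8^-1 w -> ball z 4^-1 z1 -> ball z 4^-1 z2 ->
    ball z 4^-1 z3 -> ball z 4^-1 z4 -> crosses z w = false.
  move=> Xz Xw zw zz1 zz2 zz3 zz4; apply/negP => /(crosses_close Xz Xw zw) z_close.
  by case/negP: not_all_near; apply/and4P; split; apply: close_near_vertex z_close _.
by rewrite !no_cross //; eauto using ball_sym.
Qed.

Hypothesis scX : simply_connected K X.

Definition first_end : K * K := (x + 2^-1, y + eps * 2^-1).
Definition second_end : K * K := (x - 2^-1, y - eps * 2^-1).

Hypothesis first_diagonal : forall t, 0 <= t <= 1 -> X (line_point (x, y) first_end t).
Hypothesis second_diagonal : forall t, 0 <= t <= 1 -> X (line_point second_end (x, y) t).

Variable far : K -> K * K.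
Hypotheses (far_continuous : {within `[0, 1]%classic, continuous far})
  (farX : forall s, 0 <= s <= 1 -> X (far s)) (far0 : far 0 = first_end) (far1 : far 1 = second_end)
  (far_vertex : forall s, 0 <= s <= 1 -> ~~ near_vertex (far s)).

Definition return_path : K -> K * K := path_join far (line_point second_end (x, y)).

Definition pinch_loop : K -> K * K := path_join (line_point (x, y) first_end) return_path.

Lemma far_joined : far 1 = line_point second_end (x, y) 0.
Proof. by rewrite line_point0. Qed.

Lemma return_joined : line_point (x, y) first_end 1 = return_path 0.
Proof. by rewrite line_point1 /return_path path_join0. Qed.

Lemma pinch_loop_in s : 0 <= s <= 1 -> X (pinch_loop s).
Proof.
apply: path_join_forall; [exact: return_joined | exact: first_diagonal |].
by apply: path_join_forall; [exact: far_joined | exact: farX | exact: second_diagonal].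
Qed.

Lemma pinch_loop_continuous : {within `[0, 1]%classic, continuous pinch_loop}.
Proof.
apply: path_join_continuous; first exact: return_joined.
  by apply: continuous_subspaceT; exact: line_point_continuous.
apply: path_join_continuous => //; first exact: far_joined.
by apply: continuous_subspaceT; exact: line_point_continuous.
Qed.

Lemma pinch_loop_outward s : 0 <= s <= 2^-1 -> first_quadrant (pinch_loop s).
Proof.
move=> /andP[s_ge s_le]; rewrite /pinch_loop path_join_left // /first_quadrant /=.
by case: eps_sign => ->; apply/andP; split; lra.
Qed.

Lemma pinch_loop_far s : 2^-1 <= s <= 3 / 4 -> ~~ near_vertex (pinch_loop s).
Proof.
move=> /andP[s_ge s_le]; rewrite /pinch_loop path_join_right //; last exact: return_joined.
rewrite /return_path path_join_left; last by lra.
by apply: far_vertex; apply/andP; split; lra.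
Qed.

Lemma pinch_loop_inward s :
  3 / 4 <= s -> pinch_loop s = (x - 2 * (1 - s), y - eps * (2 * (1 - s))).
Proof.
move=> s_ge; rewrite /pinch_loop path_join_right; [|exact: return_joined|by lra].
rewrite /return_path path_join_right; [|exact: far_joined|by lra].
by rewrite /line_point /=; congr pair; field.
Qed.

Lemma pinch_loop_first_quadrant s :
  3 / 4 <= s <= 1 -> first_quadrant (pinch_loop s) = (s == 1).
Proof.
move=> /andP[s_ge s_le]; rewrite pinch_loop_inward // /first_quadrant /=.
by apply/idP/eqP => [/andP[? _]|->]; [|case: eps_sign => ->; apply/andP; split]; lra.
Qed.

Lemma pinch_loop_near_vertex s : 3 / 4 < s <= 1 -> near_vertex (pinch_loop s).
Proof.
move=> /andP[s_ge s_le]; rewrite pinch_loop_inward ?ltW // /near_vertex /= !ltr_norml.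
by case: eps_sign => ->; apply/andP; split; apply/andP; split; lra.
Qed.

Lemma pinch_loop_crosses (m i : nat) : (1 < m)%N -> (i < 4 * m)%N ->
  crosses (pinch_loop (i%:R / (4 * m)%:R)) (pinch_loop (i.+1%:R / (4 * m)%:R)) =
  (i.+1 == 4 * m)%N.
Proof.
move=> m_gt1 i_lt; set n := (4 * m)%:R : K.
have n_gt0 : 0 < n by rewrite ltr0n; lia.
have frac_le (j a b : nat) : (j%:R / n <= a%:R / b.+1%:R) = (j * b.+1 <= a * (4 * m))%N.
  by rewrite ler_pdivrMr // mulrAC ler_pdivlMr ?ltr0n // -!natrM ler_nat.
have le_frac (j a b : nat) : (a%:R / b.+1%:R <= j%:R / n) = (a * (4 * m) <= j * b.+1)%N.
  by rewrite ler_pdivlMr // mulrAC ler_pdivrMr ?ltr0n // -!natrM ler_nat.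
have half : 2^-1 = 1%:R / 2%:R :> K by rewrite mul1r.
have [i_out|i_out] := leqP i.+1 (2 * m).
  rewrite (_ : (i.+1 == 4 * m)%N = false); last by lia.
  rewrite /crosses !pinch_loop_outward ?eqxx ?andbF // half frac_le divr_ge0 ?ler0n //=; lia.
have [i_far|i_in] := leqP i (3 * m).
  rewrite (_ : (i.+1 == 4 * m)%N = false); last by lia.
  by rewrite /crosses (negbTE (pinch_loop_far _)) // half le_frac frac_le; lia.
have in_last (j : nat) : (3 * m < j)%N -> (j <= 4 * m)%N -> 3 / 4 < j%:R / n <= 1.
  by move=> *; rewrite ltNge frac_le ler_pdivrMr // mul1r ler_nat; lia.
have is_last (j : nat) : (j%:R / n == 1) = (j == 4 * m)%N.
  have n_neq0 := lt0r_neq0 n_gt0.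
  by rewrite (can2_eq (divfK n_neq0) (mulfK n_neq0)) mul1r eqr_nat.
have [i_last iS_last] := (in_last i i_in (ltnW i_lt), in_last i.+1 (ltnW i_in) i_lt).
rewrite /crosses !pinch_loop_near_vertex //= !pinch_loop_first_quadrant ?is_last.
- by rewrite (ltn_eqF i_lt); case: (i.+1 == _).
- by case/andP: iS_last => /ltW-> ->.
- by case/andP: i_last => /ltW-> ->.
Qed.

(* The mesh is a multiple of 4 so that it contains the corners of [pinch_loop]. *)
Lemma unit_square_mesh (H : K * K -> K * K) (e : K) :
  {within `[0, 1]%classic `*` `[0, 1]%classic, continuous H} -> 0 < e ->
  exists2 m : nat, (1 < m)%N & let u (i : nat) : K := i%:R / (4 * m)%:R in
    forall i j, (i <= 4 * m)%N -> (j <= 4 * m)%N ->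
      ((i < 4 * m)%N -> ball (H (u i, u j)) e (H (u i.+1, u j))) /\
      ((j < 4 * m)%N -> ball (H (u i, u j)) e (H (u i, u j.+1))).
Proof.
move=> cH e_gt0; have cptQ : compact (`[0, 1]%classic `*` `[0, 1]%classic : set (K * K)).
  by apply: compact_setX; exact: segment_compact.
have [d d_gt0 unifH] := compact_within_unif_continuous cptQ cH e_gt0.
have [m m_gt1 m_lt] : exists2 m : nat, (1 < m)%N & ((4 * m)%:R)^-1 < d.
  exists (Num.bound d^-1 + 2)%N; first by lia.
  have := archi_boundP (ltW (_ : 0 < d^-1)); rewrite invr_gt0 => /(_ d_gt0) bound.
  rewrite invf_plt ?posrE ?ltr0n ?addn2 //; apply: (lt_le_trans bound); rewrite ler_nat; lia.
exists m => // u i j i_le j_le; have n_gt0 : 0 < (4 * m)%:R :> K by rewrite ltr0n; lia.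
have unit_u k : (k <= 4 * m)%N -> `[0, 1]%classic (u k).
  by move=> k_le; rewrite /= in_itv /= divr_ge0 ?ler0n //= ler_pdivrMr // mul1r ler_nat.
have step k : ball (u k) d (u k.+1).
  rewrite /ball /= distrC -mulrBl -natrB // subSnn mul1r.
  by rewrite ger0_norm ?invr_ge0 ?ler0n.
by split=> lt; apply: unifH; split=> //=; try exact: unit_u; exact: ballxx.
Qed.

Lemma not_simply_connected_pinch : False.
Proof.
have [_ _ /(_ pinch_loop pinch_loop_continuous)] := scX.
have loop0 : pinch_loop 0 = (x, y) by rewrite /pinch_loop path_join0 line_point0.
have loop1 : pinch_loop 1 = (x, y) by rewrite pinch_loop_inward ?subrr ?mulr0 ?subr0 //; lra.
case=> [_ [s s_itv <-]||H [cH HX H_bottom H_top H_base]]; [|by rewrite loop0 loop1|].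
  by apply: pinch_loop_in; move: s_itv; rewrite /= in_itv.
have eighth_gt0 : 0 < 8^-1 :> K by lra.
have [m m_gt1 mesh] := unit_square_mesh cH eighth_gt0.
set u := fun i : nat => _ in mesh; pose z i j := H (u i, u j).
have n_gt0 : 0 < (4 * m)%:R :> K by rewrite ltr0n; lia.
have unit_u k : (k <= 4 * m)%N -> 0 <= u k <= 1.
  by move=> k_le; rewrite divr_ge0 ?ler0n //= ler_pdivrMr // mul1r ler_nat.
have zX i j : (i <= 4 * m)%N -> (j <= 4 * m)%N -> X (z i j).
  by move=> i_le j_le; apply: HX; exists (u i, u j) => //; split; rewrite /= in_itv /= unit_u.
have u0 : u 0 = 0 by rewrite /u mul0r.
have un : u (4 * m)%N = 1 by rewrite /u divff // lt0r_neq0.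
have : \big[addb/false]_(i < 4 * m) crosses (z i 0) (z i.+1 0) = false.
  apply: (@grid_parity _ (fun i j => crosses (z i j) (z i.+1 j))
    (fun i j => crosses (z i j) (z i j.+1))) => [i j i_lt j_lt|j j_lt|i i_lt].
  - have [[right_low up_left] [right_high _] [_ up_right]] :=
      And3 (mesh i j (ltnW i_lt) (ltnW j_lt)) (mesh i j.+1 (ltnW i_lt) j_lt)
           (mesh i.+1 j i_lt (ltnW j_lt)).
    by apply: square_crosses; try (by apply: zX => //; exact: ltnW);
      [exact: right_low | exact: up_right | exact: right_high | exact: up_left].
  - rewrite /z u0 un; have [-> ->] := H_base _ (unit_u j (ltnW j_lt)).
    by have [-> ->] := H_base _ (unit_u j.+1 j_lt); rewrite crosses_self.
  - by rewrite /z un !H_top ?crosses_self ?unit_u // ltnW.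
have bottom (i : 'I_(4 * m)) : crosses (z i 0) (z i.+1 0) = (i.+1 == 4 * m)%N.
  by rewrite /z u0 !H_bottom ?unit_u ?(ltnW (ltn_ord i)) //; exact: pinch_loop_crosses.
under eq_bigr do rewrite bottom.
have [n ->] : exists n, (4 * m = n.+1)%N by exists (4 * m).-1; lia.
by rewrite big_ord_recr /= eqxx big1 //= => i _; rewrite eqSS ltn_eqF.
Qed.

End Pinch.

Section NoPinch.
Variable K : realType.
Implicit Types (p q : cell) (z : K * K) (Y : {fset cell}).

Definition far_from_vertices z : Prop :=
  forall a b : int, 2^-1 <= `|z.1 - a%:~R| \/ 2^-1 <= `|z.2 - b%:~R|.

Lemma half_integer_far (k a : int) : 2^-1 <= `|(k%:~R + 2^-1 : K) - a%:~R|.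
Proof.
have [ak|ka] : a <= k \/ k + 1 <= a by lia.
  have : a%:~R <= k%:~R :> K by rewrite ler_int.
  by move=> ?; rewrite ger0_norm; lra.
have : (k + 1)%:~R <= a%:~R :> K by rewrite ler_int.
by rewrite intrD => ?; rewrite ler0_norm; lra.
Qed.

Definition far_path Y p q : Prop := exists g : K -> K * K,
  [/\ {within `[0, 1]%classic, continuous g},
      forall s, 0 <= s <= 1 -> plane_set Y (g s) /\ far_from_vertices (g s),
      g 0 = center K p & g 1 = center K q].

Lemma center_line_far p q t :
  adjacent p q -> far_from_vertices (line_point (center K p) (center K q) t).
Proof.
case/adjacentP=> s ->; case: s => a b; [right | left | right | left];
  by rewrite /= subrr mulr0 addr0; apply: half_integer_far.
Qed.

Lemma far_path_exists Y p q : edge_connected Y -> p \in Y -> q \in Y -> far_path Y p q.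
Proof.
move=> connY pY; move: q; apply: (connY (far_path Y p)).
  exists p => //; exists (fun=> center K p); split=> //.
    by apply: continuous_subspaceT; exact: cst_continuous.
  move=> s _; split; first by exists p => //; apply: center_unit_square.
  by move=> a b; left; apply: half_integer_far.
move=> q q' qY q'Y qq' [g [cg gY g0 g1]].
have joined : g 1 = line_point (center K q) (center K q') 0 by rewrite line_point0.
exists (path_join g (line_point (center K q) (center K q'))); split.
- apply: path_join_continuous => //.
  by apply: continuous_subspaceT; exact: line_point_continuous.
- apply: (path_join_forall joined (P := fun z => plane_set Y z /\ far_from_vertices z)) => // t t01.
  split; last exact: center_line_far.
  by apply: interior_subset; apply: center_line_interior.
- by rewrite path_join0.
- by rewrite path_join1 // line_point1.
Qed.

Lemma plane_set_near_vertex Y z (x y : int) : plane_set Y z -> near_vertex x%:~R y%:~R z ->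
  exists a b : bool, [/\ (x - a%:R, y - b%:R) \in Y,
    if a then z.1 <= x%:~R else x%:~R <= z.1 & if b then z.2 <= y%:~R else y%:~R <= z.2].
Proof.
have x_floor (u v : int) (a : K) : u < v + 1 -> v < u + 2 -> u%:~R <= a <= u%:~R + 1 ->
    exists2 b : bool, u = v - b%:R & if b then a <= v%:~R else v%:~R <= a.
  move=> u_lt u_gt /andP[? ?]; have [uE|uE] : u = v - 1 \/ u = v by lia.
    by exists true => //; have : u%:~R = v%:~R - 1 :> K; [rewrite uE intrB | lra].
  by exists false; rewrite ?subr0 // -uE.
move=> [[c d] /= cdY /unit_squareP[/= /andP[? ?] /andP[? ?]]] /andP[].
rewrite !ltr_norml => /andP[? ?] /andP[? ?].
have c_lt : c < x + 1 by rewrite -(ltr_int K) intrD; lra.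
have c_gt : x < c + 2 by rewrite -(ltr_int K) intrD; lra.
have d_lt : d < y + 1 by rewrite -(ltr_int K) intrD; lra.
have d_gt : y < d + 2 by rewrite -(ltr_int K) intrD; lra.
have [a cE za] := x_floor c x z.1 c_lt c_gt ltac:(by apply/andP).
have [b dE zb] := x_floor d y z.2 d_lt d_gt ltac:(by apply/andP).
by exists a, b; rewrite -cE -dE.
Qed.

Lemma no_pinch_rising Y p q (b : bool) : simply_connected_region K Y -> p \in Y -> q \in Y ->
  q = (p.1 + 1, if b then p.2 + 1 else p.2 - 1) -> (q.1, p.2) \in Y \/ (p.1, q.2) \in Y.
Proof.
move=> [/region_edge_connected connY scY] pY qY qE.
apply: contrapT => /not_orP[side1 side2].
pose x := p.1 + 1; pose y := if b then p.2 + 1 else p.2; pose eps : K := if b then 1 else -1.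
have eps_sign : eps = 1 \/ eps = -1 by rewrite /eps; case: (b); [left | right].
have [g [cg gY g0 g1]] := far_path_exists connY qY pY.
have centers : center K q = first_end x%:~R y%:~R eps /\ center K p = second_end x%:~R y%:~R eps.
  rewrite qE /center /first_end /second_end /x /y /eps; case: (b);
    by split; congr pair; rewrite /= ?intrD ?intrN; lra.
have in_square c z : c \in Y -> c.1%:~R <= z.1 <= c.1%:~R + 1 -> c.2%:~R <= z.2 <= c.2%:~R + 1 ->
    plane_set Y z by move=> cY z1 z2; exists c => //; apply/unit_squareP.
apply: (@not_simply_connected_pinch K (plane_set Y) x%:~R y%:~R eps eps_sign _ scY _ _ g cg).
- move=> z Yz near_z; have [a [c [cellY z1 z2]]] := plane_set_near_vertex Yz near_z.
  move: cellY z1 z2 side1 side2; rewrite qE /first_quadrant /x /y /eps.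
  case: (b) a c => -[] [] /=; rewrite ?addrK ?subr0 => ? ? ? ? ?;
    try contradiction; rewrite ?negb_and -?ltNge ?mul1r ?mulN1r; try by split; lra.
- move=> t /andP[t_ge t_le]; apply: (in_square q _ qY); rewrite qE /x /y /eps.
    by rewrite /= !intrD; apply/andP; split; lra.
  by case: (b); rewrite /= !intrD ?intrN; apply/andP; split; lra.
- move=> t /andP[t_ge t_le]; apply: (in_square p _ pY); rewrite /x /y /eps.
    by rewrite /= !intrD; apply/andP; split; lra.
  by case: (b); rewrite /= ?intrD; apply/andP; split; lra.
- by move=> s /gY[].
- by rewrite g0 centers.1.
- by rewrite g1 centers.2.
- move=> s /gY[_ /(_ x y)]; rewrite /near_vertex negb_and -!leNgt.
  by case=> ->; rewrite ?orbT.
Qed.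

Lemma no_pinch Y p q : simply_connected_region K Y -> p \in Y -> q \in Y ->
  `|p.1 - q.1| = 1 -> `|p.2 - q.2| = 1 -> (q.1, p.2) \in Y \/ (p.1, q.2) \in Y.
Proof.
move=> scY; wlog pq : p q / p.1 < q.1 => [rising pY qY dist1 dist2|].
  have [pq|qp] := ltP p.1 q.1; first exact: rising.
  have q_lt_p : q.1 < p.1 by lia.
  rewrite distrC in dist1; rewrite distrC in dist2.
  by case: (rising q p q_lt_p qY pY dist1 dist2); [right | left].
move=> pY qY dist1 dist2; apply: (@no_pinch_rising _ _ _ (p.2 < q.2)) => //.
by case: p q pq dist1 dist2 {pY qY} => [a b] [c d] /= *; case: ltP => ?; congr pair; lia.
Qed.

Lemma no_pinch_frame Y s p (i : int) : simply_connected_region K Y -> i = 1 \/ i = -1 ->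
  p \in Y -> frame s p i (-1) \in Y -> frame s p i 0 \in Y \/ neighbor s p \in Y.
Proof.
move=> scY i1 pY qY; have := no_pinch scY pY qY.
rewrite -frame_neighbor; case: s qY => qY /=; rewrite ?addr0 ?subr0 ?opprK.
- by case=> [||-> | ->]; [lia | lia | right | left].
- by case=> [||-> | ->]; [lia | lia | left | right].
- by case=> [||-> | ->]; [lia | lia | right | left].
- by case=> [||-> | ->]; [lia | lia | left | right].
Qed.

End NoPinch.

Section RemoveRectangle.
Variable K : realType.
Implicit Types (s : side) (c x : cell) (i j : int) (Y : {fset cell}).

Definition edge_simply_connected Y : Prop :=
  edge_connected Y /\ simply_connected K (plane_set Y : set (K * K)).

Lemma edge_simply_connected_remove Y q s :
  removable Y q s -> edge_simply_connected Y -> edge_simply_connected (Y `\ q)%fset.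
Proof.
move=> removable_q [connY scY]; split; first exact: edge_connected_remove removable_q connY.
exact: simply_connected_remove removable_q scY.
Qed.

Definition rectangle s c (w h : int) x : Prop :=
  exists i j, [/\ x = frame s c i j, 0 <= i < w & 0 <= j < h].

Lemma rectangle_frame s c (w h : int) i j :
  rectangle s c w h (frame s c i j) <-> 0 <= i < w /\ 0 <= j < h.
Proof.
by split=> [[i' [j' [/frame_inj[-> ->]]]]|[i_itv j_itv]] //; exists i, j.
Qed.

(* The rectangle is exposed on its side [s], its other rows and the row behind it lie in
   [Y], and the two columns next to it can be retracted away from the side [s]. *)
Definition removable_rectangle Y s c (w h : int) : Prop :=
  [/\ forall i j, 0 <= i < w -> 0 <= j <= h -> frame s c i j \in Y,
      forall i, 0 <= i < w -> frame s c i (-1) \notin Y &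
      forall i j, i = -1 \/ i = w -> -1 <= j < h ->
        frame s c i j \in Y -> frame s c i (j + 1) \in Y].

Lemma edge_simply_connected_remove_empty Y Y' s c (w h : int) : w = 0 \/ h = 0 ->
  (forall x, x \in Y' <-> x \in Y /\ ~ rectangle s c w h x) ->
  edge_simply_connected Y -> edge_simply_connected Y'.
Proof.
move=> empty Y'E; suff -> : Y' = Y by [].
apply/fsetP => x; apply/idP/idP => [/Y'E[]//|xY]; apply/Y'E; split=> //.
by case=> i [j [_ i_itv j_itv]]; lia.
Qed.

Lemma edge_simply_connected_remove_row s (w : nat) Y Y' c :
  removable_rectangle Y s c w%:Z 1 ->
  (forall x, x \in Y' <-> x \in Y /\ ~ rectangle s c w%:Z 1 x) ->
  edge_simply_connected Y -> edge_simply_connected Y'.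
Proof.
elim: w Y c => [|w IH] Y c [inside exposed lateral] Y'E.
  by apply: edge_simply_connected_remove_empty Y'E; left.
have removable_c : removable Y c s.
  split; rewrite -?frame_neighbor; [|by apply: exposed|by apply: inside|move=> i i1].
    by rewrite -(frame0 s c); apply: inside.
  have [iE|[iE w_gt0]] : (i = -1 \/ i = w.+1%:Z) \/ i = 1 /\ (0 < w)%N by lia.
    by split=> ?; [apply: (lateral i (-1)) | apply: (lateral i 0)]; rewrite ?lerr; auto; lia.
  by split=> _; apply: inside; lia.
move/(edge_simply_connected_remove removable_c); apply: (IH _ (frame s c 1 0)).
  have memYc i j : frame s (frame s c 1 0) i j \in (Y `\ c)%fset =
      ((1 + i, j) != (0, 0)) && (frame s c (1 + i) j \in Y).
    by rewrite frame_frame add0r mem_frame_remove.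
  split=> [i j i_itv j_itv|i i_itv|i j i_end j_itv].
  - by rewrite memYc inside ?andbT ?xpair_eqE; lia.
  - by rewrite memYc (negbTE (exposed _ _)) ?andbF; lia.
  - rewrite !memYc => /andP[ij0 ijY].
    case: i_end => iE; last first.
      by rewrite (lateral (1 + i) j) // ?iE ?xpair_eqE; [lia | right; lia].
    rewrite iE /= in ij0 ijY *; rewrite (_ : j = -1) in ijY; last first.
      by move: ij0; rewrite xpair_eqE; lia.
    by rewrite (negbTE (exposed 0 _)) in ijY.
move=> x; rewrite Y'E !inE; split=> [[xY out]|[/andP[xc xY] out]]; split=> //.
- rewrite xY andbT; apply/eqP => xc; apply: out; rewrite xc -[X in rectangle _ _ _ _ X](frame0 s).
  by apply/rectangle_frame.
- case=> i [j [xE i_itv j_itv]]; apply: out; rewrite xE frame_frame.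
  by apply/rectangle_frame; lia.
- case=> i [j [xE i_itv j_itv]]; have jE : j = 0 by lia.
  have i_neq0 : i != 0 by apply: contraNneq xc => i0; rewrite xE i0 jE frame0.
  apply: out; exists (i - 1), 0; split; [|lia|by []].
  by rewrite xE jE frame_frame addrC subrK.
Qed.

Lemma edge_simply_connected_remove_rectangle s (w h : nat) Y Y' c :
  removable_rectangle Y s c w%:Z h%:Z ->
  (forall x, x \in Y' <-> x \in Y /\ ~ rectangle s c w%:Z h%:Z x) ->
  edge_simply_connected Y -> edge_simply_connected Y'.
Proof.
elim: h Y c => [|h IH] Y c [inside exposed lateral] Y'E.
  by apply: edge_simply_connected_remove_empty Y'E; right.
pose Y1 := [fset x in Y | ~~ `[< rectangle s c w%:Z 1 x >]]%fset.
have Y1E x : x \in Y1 <-> x \in Y /\ ~ rectangle s c w%:Z 1 x.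
  by rewrite !inE; split=> [/andP[-> /asboolPn]|[-> /asboolPn]].
have row_removable : removable_rectangle Y s c w%:Z 1.
  by split=> [i j i_itv j_itv|//|i j i_end j_itv]; [apply: inside | apply: lateral]; lia.
move/(edge_simply_connected_remove_row row_removable Y1E); apply: (IH _ (frame s c 0 1)).
  have inY1 i j : frame s (frame s c 0 1) i j \in Y1 <->
      frame s c i (1 + j) \in Y /\ ~ (0 <= i < w%:Z /\ j = -1).
    rewrite frame_frame add0r Y1E rectangle_frame; split=> -[ijY out]; split=> //; lia.
  split=> [i j i_itv j_itv|i i_itv|i j i_end j_itv].
  - by apply/inY1; split; [apply: inside; lia | lia].
  - by apply/negP => /inY1[_]; apply.
  - move=> /inY1[ijY _]; apply/inY1; split; last by lia.
    by rewrite addrA; apply: lateral => //; lia.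
move=> x; rewrite Y'E Y1E; split=> [[xY out]|[[xY row_out] out]]; split=> //.
- by split=> // -[i [j [xE i_itv j_itv]]]; apply: out; exists i, j; split=> //; lia.
- case=> i [j [xE i_itv j_itv]]; apply: out; exists i, (1 + j); split=> //; last by lia.
  by rewrite xE frame_frame add0r.
- case=> i [j [xE i_itv j_itv]]; have [j0|j_gt0] : j = 0 \/ 0 < j by lia.
    by apply: row_out; exists i, j; split=> //; lia.
  by apply: out; exists i, (j - 1); split; [rewrite frame_frame add0r addrC subrK | | lia].
Qed.

End RemoveRectangle.

Section Blocks.
Variables (w h : int).
Hypotheses (w_gt0 : 0 < w) (h_gt0 : 0 < h).
Implicit Types (p q : cell) (i j : int) (Y : {fset cell}).

Definition block p i j : cell := (w * p.1 + i, h * p.2 + j).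

Lemma block_surj c : exists p i j, [/\ c = block p i j, 0 <= i < w & 0 <= j < h].
Proof.
case: c => x y; exists ((x %/ w)%Z, (y %/ h)%Z), (x %% w)%Z, (y %% h)%Z.
have := divz_eq x w; have := divz_eq y h; have := modz_ge0 x (lt0r_neq0 w_gt0).
have := modz_ge0 y (lt0r_neq0 h_gt0); have := ltz_pmod x w_gt0; have := ltz_pmod y h_gt0.
by move=> *; split; [rewrite /block /=; congr pair; lia | lia | lia].
Qed.

Lemma divz_mulDl (m x i : int) : 0 <= i < m -> ((m * x + i) %/ m)%Z = x.
Proof.
move=> i_itv; rewrite mulrC divzMDl ?divz_small ?addr0 //; last by lia.
by rewrite gtz0_abs //; lia.
Qed.

Lemma block_inj p i j p' i' j' : 0 <= i < w -> 0 <= i' < w -> 0 <= j < h -> 0 <= j' < h ->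
  block p i j = block p' i' j' -> [/\ p = p', i = i' & j = j'].
Proof.
case: p p' => [x y] [x' y'] i_w i'_w j_h j'_h; rewrite /block /= => -[xE yE].
have x'E : x = x' by rewrite -(divz_mulDl x i_w) xE divz_mulDl.
have y'E : y = y' by rewrite -(divz_mulDl y j_h) yE divz_mulDl.
by split; [rewrite x'E y'E | move: xE; rewrite x'E; lia | move: yE; rewrite y'E; lia].
Qed.

Definition scaling Y Y' : Prop := forall p i j, 0 <= i < w -> 0 <= j < h ->
  (block p i j \in Y') = (p \in Y).

Lemma scaling_exists Y : exists Y', scaling Y Y'.
Proof.
exists [fset block p k.1%:Z k.2%:Z
  | p in Y, k in [seq (a, b) | a <- iota 0 `|w|%N, b <- iota 0 `|h|%N]]%fset.
move=> p i j i_w j_h; apply/imfset2P/idP => [[p' p'Y [k /allpairsP[[i' j'] []]]]|pY].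
  rewrite !mem_iota /= => i'_w j'_h -> /= ijE.
  by have [||-> _ _ //] := block_inj i_w _ j_h _ ijE; lia.
exists p => //; exists (`|i|%N, `|j|%N); last by rewrite /block /=; congr pair; lia.
by apply/allpairsP; exists (`|i|%N, `|j|%N); split=> //; rewrite mem_iota /=; lia.
Qed.

Lemma edge_closed_line Y (P : cell -> Prop) s c (n : nat) : edge_closed Y P ->
  (forall i : nat, (i <= n)%N -> frame s c i%:Z 0 \in Y) -> P c <-> P (frame s c n%:Z 0).
Proof.
move=> closedP; elim: n => [|n IH] lineY; first by rewrite frame0.
rewrite IH => [|i i_le]; last by apply: lineY; lia.
by apply: (edge_closed_iff closedP); rewrite ?lineY ?frame_adjacent //; lia.
Qed.

Lemma edge_connected_scaling Y Y' : scaling Y Y' -> edge_connected Y -> edge_connected Y'.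
Proof.
move=> memY' connY P [c0 c0Y' Pc0] closedP c cY'.
have block_iff p i j : p \in Y -> 0 <= i < w -> 0 <= j < h ->
    P (block p i j) <-> P (block p 0 0).
  move=> pY i_w j_h; have blockE k l :
      frame North (block p 0 0) k 0 = block p k 0 /\ frame East (block p k 0) l 0 = block p k l.
    by rewrite /block /=; split; congr pair; lia.
  have [iE jE] : i = `|i|%N%:Z /\ j = `|j|%N%:Z by lia.
  rewrite iE jE; transitivity (P (block p `|i|%N 0)); symmetry.
    rewrite -(blockE _ `|j|%N%:Z).2; apply: edge_closed_line closedP _ => l l_le.
    by rewrite (blockE _ _).2 memY' //; lia.
  rewrite -(blockE `|i|%N%:Z 0).1; apply: edge_closed_line closedP _ => k k_le.
  by rewrite (blockE _ 0).1 memY' //; lia.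
have [p0 [i0 [j0 [c0E i0_w j0_h]]]] := block_surj c0.
have [p [i [j [cE i_w j_h]]]] := block_surj c.
have p0Y : p0 \in Y by rewrite -(memY' _ _ _ i0_w j0_h) -c0E.
have pY : p \in Y by rewrite -(memY' _ _ _ i_w j_h) -cE.
rewrite cE; apply/block_iff => //; move: p pY {cE}; apply: (connY (fun p => P (block p 0 0))).
  by exists p0 => //; apply/(block_iff _ _ _ p0Y i0_w j0_h); rewrite -c0E.
move=> p q pY qY /adjacentP[s qE] Pp; rewrite {}qE in qY *.
have [k [l [k' [l' [k_w l_h k'_w l'_h [nextE]]]]]] : exists k l k' l',
    [/\ 0 <= k < w, 0 <= l < h, 0 <= k' < w, 0 <= l' < h &
        neighbor s (block p k l) = block (neighbor s p) k' l'].
  case: s qY => _; [exists (w - 1), 0, 0, 0 | exists 0, (h - 1), 0, 0 |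
    exists 0, 0, (w - 1), 0 | exists 0, 0, 0, (h - 1)];
    by split; rewrite /block /=; [lia..|congr pair; lia].
apply/(block_iff _ k' l' qY) => //; rewrite -nextE.
apply: (closedP (block p k l)); rewrite ?nextE ?memY' //; last exact/block_iff.
by rewrite -nextE adjacent_neighbor.
Qed.

Variable K : realType.

Lemma unit_itv_scale (m a : int) (u : K) : 0 < m -> a%:~R <= u <= a%:~R + 1 ->
  exists2 i, 0 <= i < m & (m * a + i)%:~R <= m%:~R * u <= (m * a + i)%:~R + 1.
Proof.
move=> m_gt0 /andP[u_ge u_le]; have mK_gt0 : 0 < m%:~R :> K by rewrite ltr0z.
have [u_lt|u_ge1] := ltP u (a%:~R + 1).
  exists (Num.floor (m%:~R * (u - a%:~R))).
    rewrite floor_ge_int floor_lt_int mulr_ge0 ?subr_ge0 // ?ltW //=.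
    by rewrite -[X in _ < X]mulr1 ltr_pM2l //; lra.
  have := floor_le (m%:~R * (u - a%:~R)); have := floorD1_gt (m%:~R * (u - a%:~R)).
  by rewrite !intrD intrM => *; apply/andP; split; lra.
have -> : u = a%:~R + 1 by apply/le_anti; rewrite u_le.
by exists (m - 1); rewrite ?intrD ?intrM ?intrN; [lia | apply/andP; split; lra].
Qed.

Lemma unit_itv_unscale (m a i : int) (u : K) : 0 <= i < m ->
  (m * a + i)%:~R <= u <= (m * a + i)%:~R + 1 -> a%:~R <= m%:~R^-1 * u <= a%:~R + 1.
Proof.
move=> i_m /andP[u_ge u_le]; have mK_gt0 : 0 < m%:~R :> K by rewrite ltr0z; lia.
rewrite ler_pdivlMl // ler_pdivrMl //; apply/andP; split.
  by apply: le_trans u_ge; rewrite -intrM ler_int; lia.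
have : (m * a + i + 1)%:~R <= (m * (a + 1))%:~R :> K by rewrite ler_int; lia.
by rewrite intrM !(intrD _ _ 1); apply: le_trans.
Qed.

Lemma simply_connected_scaling Y Y' : scaling Y Y' ->
  simply_connected K (plane_set Y : set (K * K)) ->
  simply_connected K (plane_set Y' : set (K * K)).
Proof.
move=> memY' scY.
have linear_continuous (a b : K) : continuous (fun z : K * K => (a * z.1, b * z.2)).
  by apply: (@continuous_affine_pair K a 0 0 0 b 0) => z; congr pair; ring.
apply: (simply_connected_retract (i := fun z : K * K => (w%:~R^-1 * z.1, h%:~R^-1 * z.2))
  (r := fun z : K * K => (w%:~R * z.1, h%:~R * z.2)) _ _ _ _ _ scY).
- by apply: continuous_subspaceT; exact: linear_continuous.
- move=> _ [z [c /= cY' /unit_squareP[z1 z2]] <-].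
  have [p [i [j [cE i_w j_h]]]] := block_surj c; rewrite cE memY' // in cY'.
  by exists p => //; apply/unit_squareP; rewrite cE in z1 z2; split;
    apply: unit_itv_unscale _ z1 || apply: unit_itv_unscale _ z2.
- by apply: continuous_subspaceT; exact: linear_continuous.
- move=> _ [z [p /= pY /unit_squareP[z1 z2]] <-].
  have [i i_w zi] := unit_itv_scale w_gt0 z1; have [j j_h zj] := unit_itv_scale h_gt0 z2.
  by exists (block p i j); [rewrite /= memY' | apply/unit_squareP].
- by move=> [u v] _ /=; rewrite !mulVKf // intr_eq0 gt_eqF.
Qed.

End Blocks.

Section BlockFrames.
Variables (w h : int).
Hypotheses (w_gt0 : 0 < w) (h_gt0 : 0 < h).
Implicit Types (s : side) (p q c : cell) (i j : int).

Definition in_block p c : Prop := exists i j, [/\ c = block w h p i j, 0 <= i < w & 0 <= j < h].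

Definition side_length s : int := match s with North | South => w | East | West => h end.

Definition side_depth s : int := match s with North | South => h | East | West => w end.

Lemma side_length_gt0 s : 0 < side_length s.
Proof. by case: s. Qed.

Lemma side_depth_gt0 s : 0 < side_depth s.
Proof. by case: s. Qed.

Definition block_frame s p : int -> int -> cell :=
  frame s match s with
          | South | West => block w h p 0 0
          | North => block w h p 0 (h - 1)
          | East => block w h p (w - 1) 0
          end.

Lemma frame_block_frame s p i j i' j' :
  frame s (block_frame s p i j) i' j' = block_frame s p (i + i') (j + j').
Proof. exact: frame_frame. Qed.

Lemma in_block_exists c : exists p, in_block p c.
Proof. by have [p [i [j ?]]] := block_surj w_gt0 h_gt0 c; exists p, i, j. Qed.

Lemma in_block_uniq p q c : in_block p c -> in_block q c -> p = q.
Proof.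
move=> [i [j [-> i_w j_h]]] [i' [j' [cE i'_w j'_h]]].
by have [] := block_inj w_gt0 h_gt0 i_w i'_w j_h j'_h cE.
Qed.

Lemma in_block_frame s p i j :
  0 <= i < side_length s -> 0 <= j < side_depth s -> in_block p (block_frame s p i j).
Proof.
rewrite /in_block /block_frame /block.
case: s => /= i_itv j_itv;
  [exists (w - 1 - j), i | exists i, (h - 1 - j) | exists j, i | exists i, j];
  by split; [congr pair; lia | lia | lia].
Qed.

Lemma block_frame_outside s p i :
  block_frame s p i (-1) = block_frame s (neighbor s p) i (side_depth s - 1).
Proof. by rewrite /block_frame /block; case: s => /=; congr pair; lia. Qed.

Lemma block_frame_before s p j :
  block_frame s p (-1) j = block_frame s (frame s p (-1) 0) (side_length s - 1) j.
Proof. by rewrite /block_frame /block; case: s => /=; congr pair; lia. Qed.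

Lemma block_frame_after s p j :
  block_frame s p (side_length s) j = block_frame s (frame s p 1 0) 0 j.
Proof. by rewrite /block_frame /block; case: s => /=; congr pair; lia. Qed.

Section Notches.
Variables (T : finType) (side_of : T -> side) (offset width depth : cell -> T -> int).
Variable max_depth : side -> int.
Implicit Types (k : T) (notches : seq (cell * T)) (Y : {fset cell}).

Definition notch p k : cell -> Prop :=
  rectangle (side_of k) (block_frame (side_of k) p (offset p k) 0) (width p k) (depth p k).

Lemma notch_frame p k i j : notch p k (block_frame (side_of k) p i j) <->
  offset p k <= i < offset p k + width p k /\ 0 <= j < depth p k.
Proof.
rewrite /notch (_ : block_frame _ p i j =
    frame (side_of k) (block_frame (side_of k) p (offset p k) 0) (i - offset p k) j).
  by rewrite rectangle_frame; split=> -[]; split; lia.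
by rewrite frame_block_frame add0r addrC subrK.
Qed.

Hypothesis notch_in_side : forall p k,
  [/\ 0 <= offset p k, 0 <= width p k & offset p k + width p k <= side_length (side_of k)].
Hypothesis notch_depth : forall p k, 0 <= depth p k <= max_depth (side_of k).
Hypothesis max_depth_lt : forall s, max_depth s < side_depth s.
Hypothesis notch_apart : forall p k k' i j, k' != k ->
  offset p k <= i < offset p k + width p k -> 0 <= j <= depth p k ->
  ~ notch p k' (block_frame (side_of k) p i j).
Hypothesis notch_outward_closed : forall s p k i j, 0 <= i < side_length s ->
  0 <= j < max_depth s ->
  notch p k (block_frame s p i (j + 1)) -> notch p k (block_frame s p i j).
Hypothesis notch_full_side : forall p k,
  offset p k = 0 \/ offset p k + width p k = side_length (side_of k) ->
  forall q k' i, side_of k' <> side_of k -> 0 <= i < side_length (side_of k) ->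
    ~ notch q k' (block_frame (side_of k) q i 0).

Variables (K : realType) (G : {fset cell}).
Hypothesis scG : simply_connected_region K G.

Definition carved notches Y : Prop := forall p c, in_block p c ->
  c \in Y <-> p \in G /\ forall k, (p, k) \in notches -> ~ notch p k c.

Lemma carved_exists notches : exists Y, carved notches Y.
Proof.
have [Y memY] := scaling_exists w_gt0 h_gt0 G.
exists [fset c in Y | `[< forall p k, in_block p c -> (p, k) \in notches -> ~ notch p k c >]]%fset.
move=> p c cp; have cE : (c \in Y) = (p \in G).
  by have [i [j [-> i_w j_h]]] := cp; apply: memY.
rewrite !inE cE; split=> [/andP[pG /asboolP uncut]|[pG uncut]].
  by split=> // k; apply: uncut.
apply/andP; split=> //; apply/asboolP => q k cq; rewrite -(in_block_uniq cp cq); exact: uncut.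
Qed.

Definition on_boundary (pk : cell * T) : bool :=
  (pk.1 \in G) && (neighbor (side_of pk.2) pk.1 \notin G).

Section RemoveNotch.
Variables (notches : seq (cell * T)) (Y : {fset cell}) (p : cell) (k : T).
Hypotheses (notches_boundary : all on_boundary notches) (carvedY : carved notches Y).
Hypotheses (pk_boundary : on_boundary (p, k)) (pk_new : (p, k) \notin notches).
Let s := side_of k.

Lemma carved_inward q i j : 0 <= i < side_length s -> 0 <= j < max_depth s ->
  block_frame s q i j \in Y -> block_frame s q i (j + 1) \in Y.
Proof.
move=> i_itv j_itv; have depth_lt := max_depth_lt s.
rewrite (carvedY (in_block_frame q i_itv _)); last by lia.
move=> [qG uncut]; apply/(carvedY (in_block_frame q i_itv _)); first by lia.
by split=> // k' /uncut not_cut cut; apply/not_cut/notch_outward_closed.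
Qed.

Lemma carved_outside q i : neighbor s q \notin G -> 0 <= i < side_length s ->
  block_frame s q i (-1) \notin Y.
Proof.
move=> outG i_itv; apply/negP; rewrite block_frame_outside.
have depth_gt0 := side_depth_gt0 s.
case/(carvedY (in_block_frame _ i_itv (_ : 0 <= _ < _)))=> [|nG _]; first by lia.
by rewrite nG in outG.
Qed.

Lemma carved_beside i : offset p k = 0 \/ offset p k + width p k = side_length s ->
  0 <= i < side_length s -> forall d, d = 1 \/ d = -1 ->
  block_frame s (frame s p d 0) i (-1) \in Y -> block_frame s (frame s p d 0) i 0 \in Y.
Proof.
move=> full i_itv d d1; set q := frame s p d 0 => outY.
have /andP[/= pG p_out] := pk_boundary.
have nqG : neighbor s q \in G by apply: contraLR outY => out; apply: carved_outside.
have qG : q \in G.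
  have nqE : frame s p d (-1) = neighbor s q by rewrite -frame_neighbor /q frame_frame addr0 add0r.
  have := @no_pinch_frame K G s p d scG d1 pG; rewrite nqE => /(_ nqG)[//|].
  by rewrite (negbTE p_out).
have depth_gt0 := side_depth_gt0 s.
apply/(carvedY (in_block_frame q i_itv _)); first by lia.
split=> // k' /(allP notches_boundary)/andP[_ /= q_out].
by apply: (notch_full_side full) => // sE; rewrite sE -/s nqG in q_out.
Qed.

Lemma notch_removable :
  removable_rectangle Y s (block_frame s p (offset p k) 0) (width p k) (depth p k).
Proof.
have [offset_ge0 width_ge0 in_side] := notch_in_side p k; rewrite -/s in in_side.
have /andP[depth_ge0 depth_le] : 0 <= depth p k <= max_depth s := notch_depth p k.
have depth_lt := max_depth_lt s; have length_gt0 := side_length_gt0 s.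
have /andP[/= pG p_out] := pk_boundary.
split=> [i j i_itv j_itv|i i_itv|i j i_end j_itv]; rewrite !frame_block_frame !add0r.
- apply/(carvedY (in_block_frame _ _ _)); [lia|lia|].
  split=> // k' k'_in; apply: notch_apart; [|lia|lia].
  by apply: contraNneq pk_new => <-.
- by apply: carved_outside => //; lia.
have [i_lo|[i_hi|i_in]] : offset p k + i = -1 \/ offset p k + i = side_length s \/
    0 <= offset p k + i < side_length s by lia.
- rewrite i_lo !block_frame_before; have [->|j_ge0] : j = -1 \/ 0 <= j by lia.
    by apply: carved_beside; [left | lia | right]; lia.
  by apply: carved_inward; lia.
- rewrite i_hi !block_frame_after; have [->|j_ge0] : j = -1 \/ 0 <= j by lia.
    by apply: carved_beside; [right | lia | left]; lia.
  by apply: carved_inward; lia.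
have [->|j_ge0] : j = -1 \/ 0 <= j by lia.
  by rewrite (negbTE (carved_outside p_out i_in)).
by apply: carved_inward; lia.
Qed.

Lemma edge_simply_connected_carve Y' :
  carved ((p, k) :: notches) Y' -> edge_simply_connected K Y -> edge_simply_connected K Y'.
Proof.
move=> carvedY'; have [_ width_ge0 _] := notch_in_side p k.
have /andP[depth_ge0 _] := notch_depth p k.
have [widthE depthE] : width p k = `|width p k|%N%:Z /\ depth p k = `|depth p k|%N%:Z by lia.
have := notch_removable; rewrite widthE depthE => /edge_simply_connected_remove_rectangle.
rewrite -widthE -depthE; apply=> c; have [q cq] := in_block_exists c.
rewrite (carvedY' _ _ cq) (carvedY cq); split=> [[qG uncut]|[[qG uncut] out]].
  split; first by split=> // k' k'_in; apply: uncut; rewrite inE k'_in orbT.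
  move=> c_notch; suff qE : q = p by apply: (uncut k); rewrite qE ?mem_head.
  apply: in_block_uniq cq _; have [i [j [-> i_itv j_itv]]] := c_notch.
  have [offset_ge0 _ in_side] := notch_in_side p k; rewrite -/s in in_side.
  have /andP[_ depth_le] : 0 <= depth p k <= max_depth s := notch_depth p k.
  have depth_lt := max_depth_lt s.
  by rewrite frame_block_frame add0r; apply: in_block_frame; lia.
split=> // k'; rewrite inE => /orP[/eqP[qE ->]|]; last exact: uncut.
by rewrite qE.
Qed.

End RemoveNotch.

Lemma edge_simply_connected_carved notches Y :
  all on_boundary notches -> carved notches Y -> edge_simply_connected K Y.
Proof.
elim: notches Y => [|[p k] notches IH] Y /= => [_|/andP[pk_boundary notches_boundary]] carvedY.
  have memY : scaling w h G Y.
    move=> p i j i_w j_h; have in_p : in_block p (block w h p i j) by exists i, j.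
    by apply/idP/idP => [/(carvedY _ _ in_p)[]//|pG]; apply/(carvedY _ _ in_p).
  have [regionG connG] := scG; split.
    exact: (edge_connected_scaling _ _ memY (region_edge_connected regionG)).
  exact: (simply_connected_scaling _ _ memY connG).
have [Z carvedZ] := carved_exists notches; have scZ := IH Z notches_boundary carvedZ.
have [pk_in|pk_new] := boolP ((p, k) \in notches).
  apply: IH => // q c cq; rewrite (carvedY _ _ cq); split=> -[qG uncut]; split=> // k' k'_in.
    by apply: uncut; rewrite inE k'_in orbT.
  by apply: uncut; move: k'_in; rewrite inE => /orP[/eqP->|].
exact: (edge_simply_connected_carve notches_boundary carvedZ pk_boundary pk_new carvedY scZ).
Qed.

Lemma carved_region Y : (forall p c, in_block p c ->
    c \in Y <-> p \in G /\ forall k, neighbor (side_of k) p \notin G -> ~ notch p k c) ->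
  simply_connected_region K Y.
Proof.
move=> memY.
pose notches := [seq pk <- [seq (p, k) | p <- enum_fset G, k <- enum T] | on_boundary pk].
have mem_notches p k : ((p, k) \in notches) = (p \in G) && (neighbor (side_of k) p \notin G).
  rewrite mem_filter /on_boundary /=; case pG: (p \in G) => //=.
  rewrite andbC; case: (boolP (_ \in [seq _ | _ <- _, _ <- _])) => //= /negP[].
  by apply: allpairs_f; rewrite ?mem_enum.
have [connY scY] : edge_simply_connected K Y.
  apply: (@edge_simply_connected_carved notches) => [|p c cp]; first exact: filter_all.
  rewrite (memY _ _ cp); split=> -[pG uncut]; split=> // k.
    by rewrite mem_notches => /andP[_]; apply: uncut.
  by move=> p_out; apply: uncut; rewrite mem_notches pG.
split=> //; apply: edge_connected_region => //.
by have [[z [p pY _]] _ _] := scY; apply/fset0Pn; exists p.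
Qed.

End Notches.
End BlockFrames.

(** * A program for the blow-up *)

Section StraightLine.
Implicit Types (st : ram_state) (M : int -> int) (prog : seq instr).

Definition straight (i : instr) : bool :=
  match i with Const _ _ | Add _ _ _ | Sub _ _ _ | Write _ => true | _ => false end.

Definition run st prog : ram_state := foldl (fun st i => exec i st) st prog.

Lemma run_cat st prog1 prog2 : run st (prog1 ++ prog2) = run (run st prog1) prog2.
Proof. exact: foldl_cat. Qed.

Lemma step_at (pre post : seq instr) i st :
  pc st = size pre -> step (pre ++ i :: post) st = exec i st.
Proof. by move=> pcE; rewrite /step pcE onth_cat ltnn subnn. Qed.

Lemma iter_step_run (pre prog post : seq instr) st : all straight prog -> pc st = size pre ->
  iter (size prog) (step (pre ++ prog ++ post)) st = run st prog.
Proof.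
elim: prog pre st => // i prog IH pre st /= /andP[straight_i straight_prog] pcE.
have pc_next : pc (exec i st) = size (rcons pre i).
  by rewrite size_rcons -pcE; case: (st) => n M inp out; case: i straight_i.
by rewrite -iterS iterSr (step_at _ _ pcE) -cat_rcons IH.
Qed.

Definition agree_off (rs : seq int) M M' : Prop := forall r, r \notin rs -> M' r = M r.

Lemma agree_off_trans rs M M' M'' :
  agree_off rs M M' -> agree_off rs M' M'' -> agree_off rs M M''.
Proof. by move=> MM' M'M'' r r_out; rewrite M'M'' // MM'. Qed.

Lemma agree_off_upd rs M r v : r \in rs -> agree_off rs M (upd M r v).
Proof. by move=> r_in r' r'_out; rewrite /upd; case: eqP r'_out => // ->; rewrite r_in. Qed.

Definition computes prog M M' : Prop := forall n inp out,
  run (RamState n M inp out) prog = RamState (n + size prog) M' inp out.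

Lemma computes_cat prog1 prog2 M M' M'' :
  computes prog1 M M' -> computes prog2 M' M'' -> computes (prog1 ++ prog2) M M''.
Proof. by move=> run1 run2 n inp out; rewrite run_cat run1 run2 size_cat addnA. Qed.

Lemma computes_cons i prog M M' M'' :
  computes [:: i] M M' -> computes prog M' M'' -> computes (i :: prog) M M''.
Proof. exact: (@computes_cat [:: i]). Qed.

Lemma computes_const r v M : computes [:: Const r v] M (upd M r v).
Proof. by move=> n inp out; rewrite addn1. Qed.

Lemma computes_add r r1 r2 M : computes [:: Add r r1 r2] M (upd M r (M r1 + M r2)).
Proof. by move=> n inp out; rewrite addn1. Qed.

Definition multiply (k : nat) (dst src : int) : seq instr :=
  Const dst 0 :: nseq k (Add dst dst src).

Lemma straight_multiply k dst src : all straight (multiply k dst src).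
Proof. by rewrite /= all_nseq orbT. Qed.

Lemma computes_multiply k dst src M : dst != src -> exists M',
  [/\ computes (multiply k dst src) M M', agree_off [:: dst] M M' & M' dst = k%:Z * M src].
Proof.
move=> dst_src; have repeat M0 : exists M', [/\ computes (nseq k (Add dst dst src)) M0 M',
    agree_off [:: dst] M0 M' & M' dst = M0 dst + k%:Z * M0 src].
  elim: k M0 => [|k IH] M0.
    by exists M0; split=> [n inp out|//|]; [rewrite addn0 | rewrite mul0r addr0].
  have [M' [run' agree' M'E]] := IH (upd M0 dst (M0 dst + M0 src)).
  exists M'; split; first exact: computes_cons (computes_add _ _ _ _) run'.
    by apply: agree_off_trans agree'; apply: agree_off_upd; rewrite inE.
  by rewrite M'E /upd eqxx eq_sym (negbTE dst_src); lia.
have [M' [run' agree' M'E]] := repeat (upd M dst 0); exists M'; split.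
- exact: computes_cons (computes_const _ _ _) run'.
- by apply: agree_off_trans agree'; apply: agree_off_upd; rewrite inE.
- by rewrite M'E /upd eqxx eq_sym (negbTE dst_src) add0r.
Qed.

Definition horner_steps (b : nat) (acc tmp : int) (rs : seq int) : seq instr :=
  flatten [seq multiply b tmp acc ++ [:: Add acc tmp r] | r <- rs].

Lemma map_agree_off ks M M' rs :
  agree_off ks M M' -> all [predC ks] rs -> [seq M' r | r <- rs] = [seq M r | r <- rs].
Proof. by move=> agree /allP rs_ks; apply/eq_in_map => r /rs_ks /agree. Qed.

Lemma computes_horner_steps b acc tmp rs M :
  tmp != acc -> all [predC [:: acc; tmp]] rs -> exists M',
  [/\ computes (horner_steps b acc tmp rs) M M', agree_off [:: acc; tmp] M M' &
      M' acc = foldl (fun a v => b%:Z * a + v) (M acc) [seq M r | r <- rs]].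
Proof.
move=> tmp_acc; elim: rs M => [|r rs IH] M.
  by exists M; split=> // n inp out; rewrite addn0.
move=> /= /andP[r_out rs_out].
have [M1 [run1 agree1 M1E]] := computes_multiply b M tmp_acc.
have {}agree1 : agree_off [:: acc; tmp] M M1.
  by move=> r' r'_out; apply: agree1; apply: contra r'_out; rewrite !inE orbC => ->.
pose M2 := upd M1 acc (M1 tmp + M1 r).
have agree2 : agree_off [:: acc; tmp] M M2.
  by apply: (agree_off_trans agree1); apply: agree_off_upd; rewrite inE eqxx.
have [M' [run' agree' M'E]] := IH M2 rs_out; exists M'; split.
- rewrite /horner_steps /= -/(horner_steps _ _ _ _) -catA; apply: computes_cat run1 _.
  exact: computes_cons (computes_add _ _ _ _) run'.
- exact: agree_off_trans agree2 agree'.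
- by rewrite M'E (map_agree_off agree2 rs_out) {1}/M2 /upd eqxx M1E agree1.
Qed.

End StraightLine.

(* Registers 0 and 1 hold the coordinates of a cell and registers 2 to 5 the digits of its
   number in base [b], which selects the shape to be printed. *)
Section TableProgram.
Variables (w h b : nat) (shape : seq nat -> seq (nat * nat)).
Implicit Types (M : int -> int) (out : seq int) (ds : seq nat) (os : seq (nat * nat)).

Local Notation origin_x := (Posz 6).
Local Notation origin_y := (Posz 7).
Local Notation number := (Posz 8).
Local Notation scratch := (Posz 9).
Local Notation one := (Posz 10).

Definition print_offset (o : nat * nat) : seq instr :=
  [:: Const scratch o.1%:Z; Add scratch origin_x scratch; Write scratch;
      Const scratch o.2%:Z; Add scratch origin_y scratch; Write scratch].

Definition print_shape os : seq instr := flatten [seq print_offset o | o <- os].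

Definition translate (x y : int) os : seq int :=
  flatten [seq [:: x + o.1%:Z; y + o.2%:Z] | o <- os].

Lemma straight_print_shape os : all straight (print_shape os).
Proof. by elim: os => //= o os; rewrite /print_shape /= all_cat => ->. Qed.

Lemma run_print_shape os n M inp out : exists M', agree_off [:: scratch] M M' /\
  run (RamState n M inp out) (print_shape os) =
  RamState (n + size (print_shape os)) M' inp (out ++ translate (M origin_x) (M origin_y) os).
Proof.
elim: os n M out => [|o os IH] n M out; first by exists M; split=> //; rewrite addn0 cats0.
have -> : print_shape (o :: os) = print_offset o ++ print_shape os by [].
pose x := M origin_x + o.1%:Z; pose y := M origin_y + o.2%:Z.
pose M1 := upd (upd (upd (upd M scratch o.1%:Z) scratch x) scratch o.2%:Z) scratch y.
have agree1 : agree_off [:: scratch] M M1 by move=> r; rewrite inE /M1 /upd => /negbTE ->.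
have offset_run :
    run (RamState n M inp out) (print_offset o) = RamState (n + 6) M1 inp (out ++ [:: x; y]).
  by rewrite /run /= /upd /= !addnS addn0 -!cats1 -catA.
have [M' [agree' run']] := IH (n + 6)%N M1 (out ++ [:: x; y]).
exists M'; split; first exact: agree_off_trans agree1 agree'.
by rewrite run_cat offset_run run' !agree1 // size_cat -catA addnA.
Qed.

Definition prepare : seq instr :=
  multiply w origin_x 0 ++ multiply h origin_y 1 ++
  Const number 0 :: horner_steps b number scratch [:: Posz 5; Posz 4; Posz 3; Posz 2] ++
  [:: Const one 1].

Definition number_of ds : nat := foldr (fun d m => d + b * m)%N 0%N ds.

Lemma straight_prepare : all straight prepare.
Proof. by rewrite /prepare -cat1s !all_cat !straight_multiply. Qed.

Lemma computes_prepare M ds : size ds = 4 ->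
  (forall k, (k < 4)%N -> M (Posz k.+2) = (nth 0%N ds k)%:Z) -> exists M',
  [/\ computes prepare M M', M' origin_x = w%:Z * M 0, M' origin_y = h%:Z * M 1,
      M' number = (number_of ds)%:Z & M' one = 1].
Proof.
move=> ds4 Mds; have [M1 [run1 agree1 M1E]] := computes_multiply w M (isT : origin_x != 0).
have [M2 [run2 agree2 M2E]] := computes_multiply h M1 (isT : origin_y != 1).
pose M3 := upd M2 number 0.
have [//|//|M4 [run4 agree4 M4E]] :=
  @computes_horner_steps b number scratch [:: Posz 5; Posz 4; Posz 3; Posz 2] M3.
exists (upd M4 one 1); split=> //.
- apply: computes_cat run1 _; apply: computes_cat run2 _.
  apply: computes_cons (computes_const _ _ _) _.
  exact: computes_cat run4 (computes_const _ _ _).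
- by rewrite [LHS]agree4 // [LHS]agree2.
- by rewrite [LHS]agree4 // [LHS]M2E agree1.
rewrite [LHS]M4E /= /M3 /upd /= !agree2 // !agree1 // !Mds //.
by case: ds ds4 {Mds} => [|e [|n [|w' [|s []]]]] //= _; rewrite /number_of /=; lia.
Qed.

Definition read_cell (halt : nat) : seq instr := [seq Read k%:Z halt | k <- iota 0 6].

(* Decreases [number] until it reaches 0, skipping one shape each time. *)
Fixpoint dispatch (start : nat) (table : seq (seq (nat * nat))) : seq instr :=
  if table is os :: table' then
    let next := (start + size (print_shape os) + 2)%N in
    JumpPos number next :: print_shape os ++
    JumpPos one 0 :: Sub number number one :: dispatch next.+1 table'
  else [::].

Lemma run_dispatch (table : seq (seq (nat * nat))) (pre : seq instr) (v : nat) M inp out :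
  (v < size table)%N -> M number = v%:Z -> M one = 1 -> exists t M',
  (t <= size (dispatch (size pre) table))%N /\
  iter t (step (pre ++ dispatch (size pre) table)) (RamState (size pre) M inp out) =
  RamState 0 M' inp (out ++ translate (M origin_x) (M origin_y) (nth [::] table v)).
Proof.
elim: table pre v M => [|os table IH] pre v M //=; set len := size (print_shape os).
set jump := JumpPos number _; set prog := pre ++ _ => v_lt M_number M_one.
have prog_print : prog = rcons pre jump ++ print_shape os ++
    JumpPos one 0 :: Sub number number one :: dispatch (size pre + len + 2).+1 table.
  by rewrite /prog cat_rcons.
have first_step :
    step prog (RamState (size pre) M inp out) = exec jump (RamState (size pre) M inp out).
  exact: step_at.
case: v v_lt M_number => [|v] v_lt M_number.
  have [M' [agree' print]] := run_print_shape os (size pre).+1 M inp out.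
  exists len.+2, M'; split; first by rewrite size_cat /=; lia.
  rewrite iterS iterSr first_step /= M_number /= prog_print iter_step_run ?size_rcons //;
    last exact: straight_print_shape.
  by rewrite print catA step_at ?size_cat ?size_rcons //= agree' // M_one.
pose pre' :=
  rcons (rcons (rcons pre jump ++ print_shape os) (JumpPos one 0)) (Sub number number one).
have pre'_size : size pre' = (size pre + len + 2).+1.
  by rewrite !size_rcons size_cat size_rcons /len; lia.
have prog_skip : prog = pre' ++ dispatch (size pre') table.
  by rewrite prog_print pre'_size !cat_rcons -catA.
pose M1 := upd M number (M number - M one).
have [||t [M' [t_le run']]] := IH pre' v M1 v_lt.
- by rewrite /M1 /upd /= M_number M_one; lia.
- by rewrite /M1 /upd /= M_one.
exists t.+2, M'; split; first by move: t_le; rewrite pre'_size /= size_cat /=; lia.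
rewrite !iterSr first_step /= M_number /= prog_skip /pre' cat_rcons step_at /=; last first.
  by rewrite size_rcons size_cat size_rcons /len; lia.
rewrite -/(upd _ _ _) -/M1 -cat_rcons -/pre'.
by move: run'; rewrite pre'_size.
Qed.

Fixpoint digits (n k : nat) : seq nat :=
  if n is n'.+1 then (k %% b)%N :: digits n' (k %/ b) else [::].

Definition is_digit_seq (n : nat) ds : bool := (size ds == n) && all (fun d => (d < b)%N) ds.

Lemma digits_number_of n ds : is_digit_seq n ds -> digits n (number_of ds) = ds.
Proof.
case/andP=> /eqP <-; elim: ds => //= d ds IH /andP[d_lt /IH].
rewrite mulnC addnC modnMDl divnMDl ?modn_small ?divn_small ?addn0 //;
  by rewrite ?(leq_ltn_trans _ d_lt) // => ->.
Qed.

Lemma number_of_lt n ds : is_digit_seq n ds -> (number_of ds < b ^ n)%N.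
Proof. by case/andP=> /eqP <-; elim: ds => //= d ds IH /andP[d_lt /IH]; rewrite expnS; nia. Qed.

Definition shape_table : seq (seq (nat * nat)) := [seq shape (digits 4 k) | k <- iota 0 (b ^ 4)].

Definition dispatch_start : nat := 6 + size prepare.

Definition table_length : nat := dispatch_start + size (dispatch dispatch_start shape_table).

Definition table_program : seq instr :=
  read_cell table_length ++ prepare ++ dispatch dispatch_start shape_table.

Lemma size_table_program : size table_program = table_length.
Proof. by rewrite 2!size_cat addnA. Qed.

Definition cell_input (xy : int * int) ds : seq int := [:: xy.1, xy.2 & [seq d%:Z | d <- ds]].

Definition shape_output (xy : int * int) ds : seq int :=
  translate (w%:Z * xy.1) (h%:Z * xy.2) (shape ds).

Lemma run_table_program_cell xy ds M rest out : is_digit_seq 4 ds -> exists t M',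
  (t <= size table_program)%N /\
  iter t (step table_program) (RamState 0 M (cell_input xy ds ++ rest) out) =
  RamState 0 M' rest (out ++ shape_output xy ds).
Proof.
move=> ds4; have /andP[/eqP size_ds _] := ds4.
have [M0 [M0x M0y M0_digit read6]] : exists M0, [/\ M0 0 = xy.1, M0 1 = xy.2,
    forall k, (k < 4)%N -> M0 (Posz k.+2) = (nth 0%N ds k)%:Z &
    iter 6 (step table_program) (RamState 0 M (cell_input xy ds ++ rest) out) =
    RamState 6 M0 rest out].
  case: (ds) size_ds => [|e [|n [|w' [|s []]]]] //= _.
  exists (upd (upd (upd (upd (upd (upd M 0 xy.1) 1 xy.2) (Posz 2) e%:Z) (Posz 3) n%:Z)
    (Posz 4) w'%:Z) (Posz 5) s%:Z).
  by split=> //; do 4 case=> //.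
have [M1 [run1 M1x M1y M1_number M1_one]] := computes_prepare size_ds M0_digit.
have prepared := @iter_step_run (read_cell table_length) prepare
  (dispatch dispatch_start shape_table) (RamState 6 M0 rest out) straight_prepare erefl.
have start_size : size (read_cell table_length ++ prepare) = dispatch_start by rewrite size_cat.
have number_lt : (number_of ds < size shape_table)%N.
  by rewrite size_map size_iota; apply: number_of_lt.
have := @run_dispatch shape_table (read_cell table_length ++ prepare) _ M1 rest out number_lt
  M1_number M1_one.
rewrite start_size -catA => -[t [M' [t_le dispatched]]].
exists (t + (size prepare + 6))%N, M'; split.
  by rewrite size_table_program /table_length /dispatch_start; move: t_le;
    rewrite /dispatch_start; lia.
rewrite !iterD read6 prepared run1 dispatched M1x M1y M0x M0y.
rewrite (nth_map 0%N) ?size_iota ?number_of_lt // nth_iota ?number_of_lt //.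
by rewrite digits_number_of.
Qed.

Lemma table_program_outputs (xs : seq ((int * int) * seq nat)) :
  all (fun k => is_digit_seq 4 k.2) xs -> exists2 t,
  (t <= size table_program * size xs + 1)%N &
  outputs_within table_program (flatten [seq cell_input k.1 k.2 | k <- xs]) t
    (flatten [seq shape_output k.1 k.2 | k <- xs]).
Proof.
move=> digits_xs; suff run_cells M out : exists t M', (t <= size table_program * size xs + 1)%N /\
    iter t (step table_program)
      (RamState 0 M (flatten [seq cell_input k.1 k.2 | k <- xs]) out) =
    RamState (size table_program) M' [::] (out ++ flatten [seq shape_output k.1 k.2 | k <- xs]).
  have [t [M' [t_le run_t]]] := run_cells (fun=> 0) [::].
  by exists t => //; rewrite /outputs_within run_t.
elim: xs M out digits_xs => [|[xy ds] xs IH] M out.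
  by exists 1%N, M; rewrite size_table_program cats0 muln0.
case/andP=> ds4 digits_xs.
have [t [M1 [t_le run1]]] :=
  run_table_program_cell xy M (flatten [seq cell_input k.1 k.2 | k <- xs]) out ds4.
have [t' [M2 [t'_le run2]]] := IH M1 (out ++ shape_output xy ds) digits_xs.
exists (t' + t)%N, M2; split.
  by rewrite [size (_ :: _)]/= mulnS addnC -addnA leq_add.
by rewrite iterD run1 run2 -catA.
Qed.

End TableProgram.

(** * Tilings by bricks and fillers *)

Local Close Scope ring_scope.
Local Close Scope classical_set_scope.
Local Open Scope Z_scope.

Section Tilings.
Implicit Types (a b w h x y : Z).

Definition in_tile a b w h x y : Prop := a <= x < a + w /\ b <= y < b + h.

Record tiling (inside : Z -> Z -> Prop) (size : Z -> Z -> Prop) (tile : Z -> Z -> Z -> Z -> Prop) :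
    Prop := Tiling {
  tiling_cover : forall x y, inside x y ->
    exists a b w h, tile a b w h /\ in_tile a b w h x y;
  tiling_inside : forall a b w h x y, tile a b w h -> in_tile a b w h x y -> inside x y;
  tiling_uniq : forall a b w h a' b' w' h' x y, tile a b w h -> tile a' b' w' h' ->
    in_tile a b w h x y -> in_tile a' b' w' h' x y -> [/\ a = a', b = b', w = w' & h = h'];
  tiling_size : forall a b w h, tile a b w h -> size w h }.

Lemma sub_tiling_size inside (size size' : Z -> Z -> Prop) tile :
  (forall w h, size w h -> size' w h) -> tiling inside size tile -> tiling inside size' tile.
Proof. by move=> sub [cover ins uniq sz]; split=> // a b w h /sz/sub. Qed.

Variables (inside size : Z -> Z -> Prop) (tile : Z -> Z -> Z -> Z -> Prop).
Hypothesis tileT : tiling inside size tile.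
Hypothesis size_gt0 : forall w h, size w h -> 0 < w /\ 0 < h.

Definition hseam x y : Prop := forall a b w h, tile a b w h ->
  in_tile a b w h x y -> in_tile a b w h x (y - 1) -> False.

Definition vseam x y : Prop := forall a b w h, tile a b w h ->
  in_tile a b w h x y -> in_tile a b w h (x - 1) y -> False.

Lemma tile_gt0 a b w h : tile a b w h -> 0 < w /\ 0 < h.
Proof. by move/(tiling_size tileT)/size_gt0. Qed.

Lemma hseam_tile_bottom x y a b w h : hseam x y -> tile a b w h -> in_tile a b w h x y -> b = y.
Proof.
move=> seam tl xy; have [//|b_lt] : b = y \/ b <= y - 1 by case: xy; lia.
by case: (seam _ _ _ _ tl xy); move: xy; rewrite /in_tile; lia.
Qed.

Lemma vseam_tile_start x y a b w h : vseam x y -> tile a b w h -> in_tile a b w h x y -> a = x.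
Proof.
move=> seam tl xy; have [//|a_lt] : a = x \/ a <= x - 1 by case: xy; lia.
by case: (seam _ _ _ _ tl xy); move: xy; rewrite /in_tile; lia.
Qed.

Lemma hseam_tile_top x a b w h : tile a b w h -> a <= x < a + w -> hseam x (b + h).
Proof.
move=> tl x_in a' b' w' h' tl' above below; have [_ h_gt0] := tile_gt0 tl.
have inner : in_tile a b w h x (b + h - 1) by rewrite /in_tile; lia.
have [? ? ? ?] := tiling_uniq tileT tl tl' inner below.
by move: above; rewrite /in_tile; lia.
Qed.

Lemma vseam_tile_left y a b w h : tile a b w h -> b <= y < b + h -> vseam a y.
Proof.
move=> tl y_in a' b' w' h' tl' right left; have [w_gt0 _] := tile_gt0 tl.
have inner : in_tile a b w h a y by rewrite /in_tile; lia.
have [? ? ? ?] := tiling_uniq tileT tl tl' inner right.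
by move: left; rewrite /in_tile; lia.
Qed.

Lemma vseam_tile_right y a b w h : tile a b w h -> b <= y < b + h -> vseam (a + w) y.
Proof.
move=> tl y_in a' b' w' h' tl' right left; have [w_gt0 _] := tile_gt0 tl.
have inner : in_tile a b w h (a + w - 1) y by rewrite /in_tile; lia.
have [? ? ? ?] := tiling_uniq tileT tl tl' inner left.
by move: right; rewrite /in_tile; lia.
Qed.

Lemma vseam_outside x y : ~ inside x y -> vseam x y.
Proof. by move=> out a b w h tl xy _; exact/out/(tiling_inside tileT tl xy). Qed.

Lemma vseam_outside_left x y : ~ inside (x - 1) y -> vseam x y.
Proof. by move=> out a b w h tl _ xy; exact/out/(tiling_inside tileT tl xy). Qed.

Lemma hseam_outside x y : ~ inside x y -> hseam x y.
Proof. by move=> out a b w h tl xy _; exact/out/(tiling_inside tileT tl xy). Qed.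

Lemma hseam_outside_below x y : ~ inside x (y - 1) -> hseam x y.
Proof. by move=> out a b w h tl _ xy; exact/out/(tiling_inside tileT tl xy). Qed.

Lemma vseam_end_of_hseam x y : hseam (x - 1) y -> ~ hseam x y -> vseam x y.
Proof.
move=> seam no_seam a b w h tl right left; apply: no_seam => a' b' w' h' tl' above below.
have bE := hseam_tile_bottom seam tl left.
have [? ? ? ?] := tiling_uniq tileT tl tl' right above.
by move: below; rewrite /in_tile; lia.
Qed.

Lemma tile_at_corner x y : inside x y -> hseam x y -> vseam x y -> exists w h, tile x y w h.
Proof.
move=> /(tiling_cover tileT)[a [b [w [h [tl xy]]]]] hxy vxy; exists w, h.
by rewrite -(hseam_tile_bottom hxy tl xy) -(vseam_tile_start vxy tl xy).
Qed.

Lemma tile_width_le x x' y w h : tile x y w h -> x < x' -> vseam x' y -> w <= x' - x.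
Proof.
move=> tl xx' seam; have [_ h_gt0] := tile_gt0 tl.
have [//|w_gt] : w <= x' - x \/ x' - x < w by lia.
by case: (seam _ _ _ _ tl); rewrite /in_tile; lia.
Qed.

Lemma tile_top_le x y a b w h : tile a b w h -> a <= x < a + w -> b < y -> hseam x y -> b + h <= y.
Proof.
move=> tl x_in by_ seam; have [//|h_gt] : b + h <= y \/ y < b + h by lia.
by case: (seam _ _ _ _ tl); rewrite /in_tile; lia.
Qed.

Definition floor_on x x' y : Prop := forall z, x <= z < x' -> inside z y /\ hseam z y.

Lemma floor_next_tile x x' y w h : floor_on x x' y -> vseam x' y -> tile x y w h -> w < x' - x ->
  exists w' h', tile (x + w) y w' h' /\ w' <= x' - x - w.
Proof.
move=> floor seam tl w_lt; have [w_gt0 h_gt0] := tile_gt0 tl.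
have [ins bottom] : inside (x + w) y /\ hseam (x + w) y by apply: floor; lia.
have start : vseam (x + w) y by apply: (vseam_tile_right tl); lia.
have [w' [h' tl']] := tile_at_corner ins bottom start; exists w', h'; split=> //.
by have := tile_width_le tl' _ seam; lia.
Qed.

End Tilings.

Section SlotWidths.
Implicit Types s : Z.

Definition slot_width s : Z :=
  if s mod 4 =? 0 then 8 else if s mod 4 =? 1 then 9 else if s mod 4 =? 2 then 12 else 11.

Definition brick_width s : Z := slot_width s + slot_width (s + 1).

Local Ltac Zify.zify_post_hook ::= Z.to_euclidean_division_equations.

Lemma slot_width_bounds s : 8 <= slot_width s <= 12.
Proof. by rewrite /slot_width; repeat case: Z.eqb_spec => ?; lia. Qed.

Lemma slot_width_eq s s' : slot_width s = slot_width s' <-> s mod 4 = s' mod 4.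
Proof.
rewrite /slot_width; have := Z.mod_pos_bound s 4; have := Z.mod_pos_bound s' 4.
by repeat case: Z.eqb_spec => ?; lia.
Qed.

Lemma brick_width_bounds s : 17 <= brick_width s <= 23.
Proof. by rewrite /brick_width /slot_width; repeat case: Z.eqb_spec => ?; lia. Qed.

Lemma slot_width_neq_brick s s' : slot_width s <> brick_width s'.
Proof. by have := slot_width_bounds s; have := brick_width_bounds s'; lia. Qed.

(* The four widths are chosen so that a brick width splits into two slot widths in only
   one way. *)
Lemma brick_width_split s a b : slot_width a + slot_width b = brick_width s ->
  (slot_width a = slot_width s /\ slot_width b = slot_width (s + 1)) \/
  (slot_width a = slot_width (s + 1) /\ slot_width b = slot_width s).
Proof.
rewrite /brick_width; have -> : slot_width (s + 1) = slot_width (s mod 4 + 1).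
  by apply/slot_width_eq; lia.
have -> : slot_width s = slot_width (s mod 4) by apply/slot_width_eq; lia.
have : s mod 4 = 0 \/ s mod 4 = 1 \/ s mod 4 = 2 \/ s mod 4 = 3 by lia.
rewrite {1 2}/slot_width.
by case=> [->|[->|[->|->]]]; rewrite /slot_width /=; repeat case: Z.eqb_spec => ?; lia.
Qed.

End SlotWidths.

(* Bricks of height [t] over two adjacent slots and fillers over one slot, of height
   within [e] of [gap], a multiple of 3 whose parity depends on the slot. *)
Section Columns.
Variables (inside : Z -> Z -> Prop) (tile : Z -> Z -> Z -> Z -> Prop) (t gap e : Z).
Implicit Types (a b w h x y s u : Z).

Definition filler_size s h : Prop :=
  [/\ h mod 3 = 0, gap - e <= h <= gap + e & h mod 2 = (s + 1) mod 2].

Definition column_size w h : Prop :=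
  (h = t /\ exists s, w = brick_width s) \/ (exists s, w = slot_width s /\ filler_size s h).

Record column_params : Prop := ColumnParams {
  column_shift_gt0 : 0 < e;
  column_gap_ge : 100 * e <= gap;
  column_brick_ge : 20 * gap <= t;
  column_brick_mod3 : t mod 3 = 1 }.

Hypothesis params : column_params.
Hypothesis tileT : tiling inside column_size tile.

Let e_gt0 : 0 < e. Proof. exact: column_shift_gt0. Qed.
Let gap_ge : 100 * e <= gap. Proof. exact: column_gap_ge. Qed.
Let t_ge : 20 * gap <= t. Proof. exact: column_brick_ge. Qed.
Let t_mod3 : t mod 3 = 1. Proof. exact: column_brick_mod3. Qed.

Local Notation hseam := (hseam tile).
Local Notation vseam := (vseam tile).
Local Notation floor_on := (floor_on inside tile).

Lemma column_size_ge w h : column_size w h -> 8 <= w /\ gap - e <= h.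
Proof.
case=> [[-> [s ->]]|[s [-> [_ h_bounds _]]]]; first by have := brick_width_bounds s; lia.
by have := slot_width_bounds s; lia.
Qed.

Lemma column_size_gt0 w h : column_size w h -> 0 < w /\ 0 < h.
Proof. by move/column_size_ge; lia. Qed.

Lemma tile_size_ge a b w h : tile a b w h -> 8 <= w /\ gap - e <= h.
Proof. by move/(tiling_size tileT)/column_size_ge. Qed.

Let top_hseam := hseam_tile_top tileT column_size_gt0.
Let left_vseam := vseam_tile_left tileT column_size_gt0.
Let right_vseam := vseam_tile_right tileT column_size_gt0.

Local Ltac Zify.zify_post_hook ::= Z.to_euclidean_division_equations.

Lemma slot_tile_filler a b s h : tile a b (slot_width s) h -> filler_size s h.
Proof.
case/(tiling_size tileT)=> [[_ [s' wE]]|[s' [/slot_width_eq sE]]].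
  by case: (slot_width_neq_brick wE).
by case=> h3 h_bounds h2; split=> //; lia.
Qed.

Lemma brick_tile_height a b s h : tile a b (brick_width s) h -> h = t.
Proof.
by case/(tiling_size tileT)=> [[]|[s' [wE]]] //; case: (@slot_width_neq_brick s' s).
Qed.

(* A floor at height [y] does not extend over a step at a height [z] slightly below it,
   as no tile is short enough to fill the gap. *)
Lemma vseam_above_step x y z : hseam (x - 1) y -> hseam x z -> z < y < z + (gap - e) ->
  (inside x y -> inside x (y - 1)) -> vseam x y.
Proof.
move=> left_seam step_seam yz below_inside a b w h tl right left.
have bE := hseam_tile_bottom left_seam tl left.
have /(tiling_cover tileT)[a' [b' [w' [h' [tl' below]]]]] :=
  below_inside (tiling_inside tileT tl right).
have [_ h'_ge] := tile_size_ge tl'.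
have b'_ge : z <= b'.
  have [//|b'_lt] : z <= b' \/ b' < z by lia.
  have := tile_top_le (y := z) tl' _ b'_lt step_seam; move: below; rewrite /in_tile => below.
  by move=> /(_ ltac:(lia)); lia.
have right' : in_tile a' b' w' h' x y by move: below; rewrite /in_tile; lia.
have [? ? ? ?] := tiling_uniq tileT tl tl' right right'.
by move: below; rewrite /in_tile; lia.
Qed.

(* The column on the left of [x] has a floor at [y], at a level different from the top of
   the tile on the right. *)
Lemma vseam_uneven x y b w h : hseam (x - 1) y -> tile x b w h -> b <= y < b + h + (gap - e) ->
  y <> b + h -> (inside x y -> inside x (y - 1)) -> vseam x y.
Proof.
move=> floor tl y_bounds y_neq below; have [w_ge _] := tile_size_ge tl.
have [y_lt|y_gt] : y < b + h \/ b + h < y by lia.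
  by apply: (left_vseam tl); lia.
by apply: (@vseam_above_step _ _ (b + h)) => //; [apply: top_hseam tl _ | ]; lia.
Qed.

Lemma filler_on_floor x s y : floor_on x (x + slot_width s) y -> vseam x y ->
  vseam (x + slot_width s) y -> exists h, tile x y (slot_width s) h /\ filler_size s h.
Proof.
move=> floor start_seam end_seam; have width := slot_width_bounds s.
have [ins bottom] : inside x y /\ hseam x y by apply: floor; lia.
have [w [h tl]] := tile_at_corner tileT ins bottom start_seam.
have [w_ge h_ge] := tile_size_ge tl.
have w_le := tile_width_le tileT column_size_gt0 tl _ end_seam.
have [wE|w_lt] : w = slot_width s \/ w < slot_width s by lia.
  by exists h; rewrite -wE; split=> //; rewrite wE in tl; apply: slot_tile_filler tl.
have [|w' [h' [tl' w'_le]]] := floor_next_tile tileT column_size_gt0 floor end_seam tl; first lia.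
by have := tile_size_ge tl'; lia.
Qed.

Lemma filler_on_filler a b s h : tile a b (slot_width s) h ->
  (forall z, a <= z < a + slot_width s -> inside z (b + h)) -> vseam a (b + h) ->
  vseam (a + slot_width s) (b + h) ->
  exists h', tile a (b + h) (slot_width s) h' /\ filler_size s h'.
Proof.
move=> tl above; apply: filler_on_floor => z z_in; split; first exact: above.
exact: top_hseam tl z_in.
Qed.

Variant brick_floor_tiles x y s : Prop :=
| FloorBrick of tile x y (brick_width s) t
| FloorFillers h h' of tile x y (slot_width s) h & tile (x + slot_width s) y (slot_width (s + 1)) h'
| FloorSwapped h h' of
    tile x y (slot_width (s + 1)) h & tile (x + slot_width (s + 1)) y (slot_width s) h'.

Lemma tiles_on_brick_floor x s y : floor_on x (x + brick_width s) y -> vseam x y ->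
  vseam (x + brick_width s) y -> brick_floor_tiles x y s.
Proof.
move=> floor start_seam end_seam; have width := brick_width_bounds s.
have [ins bottom] : inside x y /\ hseam x y by apply: floor; lia.
have [w [h tl]] := tile_at_corner tileT ins bottom start_seam.
have [w_ge h_ge] := tile_size_ge tl.
have w_le := tile_width_le tileT column_size_gt0 tl _ end_seam.
have [wE|w_lt] : w = brick_width s \/ w < brick_width s by lia.
  by constructor 1; rewrite wE in tl; rewrite -(brick_tile_height tl).
have [|w' [h' [tl' w'_le]]] := floor_next_tile tileT column_size_gt0 floor end_seam tl; first lia.
have [w'_ge h'_ge] := tile_size_ge tl'.
have ww'E : w + w' = brick_width s.
  have [//|ww'_lt] : w + w' = brick_width s \/ w + w' < brick_width s by lia.
  have floor' : floor_on (x + w) (x + brick_width s) y by move=> z z_in; apply: floor; lia.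
  have [|w2 [h2 [tl2 w2_le]]] := floor_next_tile tileT column_size_gt0 floor' end_seam tl'.
    by lia.
  by have := tile_size_ge tl2; lia.
have [[_ [q wE]]|[q [wE _]]] := tiling_size tileT tl; first by have := brick_width_bounds q; lia.
have [[_ [q' w'E]]|[q' [w'E _]]] := tiling_size tileT tl'.
  by have := brick_width_bounds q'; lia.
have [|[qE q'E]|[qE q'E]] := @brick_width_split s q q'; first by lia.
- by apply: (@FloorFillers _ _ _ h h'); rewrite -qE -?q'E -wE -?w'E.
- by apply: (@FloorSwapped _ _ _ h h'); rewrite -qE -?q'E -wE -?w'E.
Qed.

Lemma pile_height x y1 y2 : y1 <= y2 -> hseam x y1 -> hseam x y2 ->
  (forall y, y1 <= y < y2 -> inside x y) ->
  exists n f, [/\ 0 <= n, f mod 3 = 0, f = 0 \/ gap - e <= f & y2 - y1 = n * t + f].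
Proof.
have [m y12] : exists m : nat, (y2 - y1 <= Z.of_nat m) by exists (Z.to_nat (y2 - y1)); lia.
elim: m y1 y12 => [|m IH] y1 y12 y12_le seam1 seam2 ins.
  by exists 0, 0; split=> //; [left | lia].
have [->|y12_lt] : y1 = y2 \/ y1 < y2 by lia.
  by exists 0, 0; split=> //; [left | lia].
have /(tiling_cover tileT)[a [b [w [h [tl xy1]]]]] := ins y1 ltac:(lia).
have bE := hseam_tile_bottom seam1 tl xy1; have [_ h_ge] := tile_size_ge tl.
have x_in : a <= x < a + w by case: xy1.
have top_le : y1 + h <= y2 by rewrite -bE; apply: (tile_top_le tl x_in) => //; lia.
have seam1' : hseam x (y1 + h) by rewrite -bE; apply: top_hseam tl x_in.
have [||//|//||n [f [n_ge0 f3 f_ge fE]]] := IH (y1 + h); [lia | lia | |].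
  by move=> y y_in; apply: ins; lia.
have [[hE _]|[q [_ [h3 h_bounds _]]]] := tiling_size tileT tl.
  by exists (n + 1), f; split=> //; lia.
by exists n, (f + h); split=> //; lia.
Qed.

Lemma tile_below_ceiling x c a b w h : tile a b w h -> a <= x < a + w ->
  b < c < b + 2 * (gap - e) -> (forall y, b <= y < c -> inside x y) -> ~ inside x c -> b + h = c.
Proof.
move=> tl x_in c_bounds ins ceiling; have [_ h_ge] := tile_size_ge tl.
have [c_lt|[//|c_gt]] : c < b + h \/ b + h = c \/ b + h < c by lia.
  by case: ceiling; apply: (tiling_inside tileT tl); rewrite /in_tile; lia.
have /(tiling_cover tileT)[a' [b' [w' [h' [tl' above]]]]] := ins (b + h) ltac:(lia).
have b'E := hseam_tile_bottom (top_hseam tl x_in) tl' above.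
have [_ h'_ge] := tile_size_ge tl'.
by case: ceiling; apply: (tiling_inside tileT tl'); move: above; rewrite /in_tile; lia.
Qed.

Lemma filler_below_ceiling x s y c : floor_on x (x + slot_width s) y -> vseam x y ->
  vseam (x + slot_width s) y -> filler_size s (c - y) -> (forall z, y <= z < c -> inside x z) ->
  ~ inside x c -> tile x y (slot_width s) (c - y).
Proof.
move=> floor start_seam end_seam [_ c_bounds _] column ceiling; have := slot_width_bounds s.
have [h [tl _]] := filler_on_floor floor start_seam end_seam; move=> width.
have := tile_below_ceiling tl _ _ column ceiling => topE.
by rewrite (_ : c - y = h) //; lia.
Qed.

(* A defect at a brick position over the slot [s] starting at [x]: instead of a filler
   and a brick, three fillers are piled up on the floor [y]. *)
Definition defect x s y : Prop := exists a1 a2 a3 s',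
  [/\ tile x y (slot_width s) a1, tile x (y + a1) (slot_width s') a2,
      tile x (y + a1 + a2) (slot_width s') a3 & s' = s \/ s' = s + 1].

(* The three fillers of a defect cannot be completed to a pile of one brick and fillers
   whose parity is that of the neighboring slot. *)
Lemma defect_no_hseam x s y u : defect x s y ->
  u mod 3 = 0 -> u < 3 * (gap - e) \/ (u <= 3 * (gap + e) /\ u mod 2 = s mod 2) -> 0 <= u ->
  (forall z, y <= z < y + t + u -> inside x z) -> ~ hseam x (y + t + u).
Proof.
move=> [a1 [a2 [a3 [s' [tl1 tl2 tl3 s'E]]]]] u3 u_bounds u_ge0 ins seam.
have [fill1 fill2 fill3] :=
  And3 (slot_tile_filler tl1) (slot_tile_filler tl2) (slot_tile_filler tl3).
case: fill1 fill2 fill3 => [a1_3 a1_bounds a1_2] [a2_3 a2_bounds a2_2] [a3_3 a3_bounds a3_2].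
have seam3 : hseam x (y + a1 + a2 + a3).
  by apply: (top_hseam tl3); have := slot_width_bounds s'; lia.
have [|//|//||n [f [n_ge0 f3 f_ge fE]]] := @pile_height x (y + a1 + a2 + a3) (y + t + u).
- by lia.
- by move=> z z_in; apply: ins; lia.
have [n2|[n0|n1]] : 2 <= n \/ n = 0 \/ n = 1 by lia.
- have : 2 * t <= n * t by apply: Z.mul_le_mono_nonneg_r; lia.
  by lia.
- by rewrite n0 in fE; lia.
- by rewrite n1 in fE; case: s'E => sE; rewrite sE in a2_2 a3_2; lia.
Qed.

Lemma defect_vseam x s y u : defect x s y -> filler_size (s - 1) u ->
  (forall z, y <= z < y + t + u -> inside x z) -> hseam (x - 1) (y + t + u) ->
  vseam x (y + t + u).
Proof.
move=> dfct [u3 u_bounds u2] ins seam; apply: (vseam_end_of_hseam tileT seam).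
by apply: (defect_no_hseam dfct u3 _ _ ins); lia.
Qed.

Lemma defect_step x s y u : defect x s y -> filler_size (s - 1) u ->
  (forall z, y <= z < y + t + 3 * (gap + e) -> inside x z) ->
  let x' := x - slot_width (s - 1) in let y' := y + t + u in
  (forall z z', x' <= z < x -> y' <= z' < y' + t -> inside z z') ->
  (forall z, x' <= z < x -> hseam z y') ->
  (forall z', y' <= z' < y' + t -> vseam x' z') ->
  defect x' (s - 1) y'.
Proof.
move=> dfct [u3 u_bounds u2] ins x' y' ins' floor' wall'.
have width := slot_width_bounds (s - 1).
have x'E : x' + slot_width (s - 1) = x by rewrite /x'; lia.
have filler_at v : v mod 3 = 0 -> gap - e <= v ->
    v <= 2 * (gap + e) \/ (v <= 3 * (gap + e) /\ v mod 2 = s mod 2) ->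
    (forall z, x' <= z < x -> hseam z (y + t + v)) -> y' <= y + t + v < y' + t ->
    exists h, tile x' (y + t + v) (slot_width (s - 1)) h /\ filler_size (s - 1) h.
  move=> v3 v_ge v_le floor v_bounds; apply: filler_on_floor.
  - by rewrite x'E => z z_in; split; [apply: ins'; lia | apply: floor].
  - by apply: wall'; lia.
  - rewrite x'E; apply: (vseam_end_of_hseam tileT); first by apply: floor; lia.
    by apply: (defect_no_hseam dfct v3); try lia; move=> z z_in; apply: ins; lia.
have [|||//||d1 [tl1 [d1_3 d1_bounds d1_2]]] := filler_at u; [lia | lia | lia | lia |].
have [|||||d2 [tl2 [d2_3 d2_bounds d2_2]]] := filler_at (u + d1); [lia | lia | lia | | lia |].
  by move=> z z_in; rewrite Z.add_assoc; apply: (top_hseam tl1); lia.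
have [|||||d3 [tl3 _]] := filler_at (u + d1 + d2); [lia | lia | lia | | lia |].
  by move=> z z_in; rewrite (Z.add_assoc _ (u + d1)); apply: (top_hseam tl2); lia.
exists d1, d2, d3, (s - 1); split=> //; last by left.
- by rewrite /y' -Z.add_assoc.
- by rewrite (_ : y' + d1 + d2 = y + t + (u + d1 + d2)) // /y'; lia.
Qed.

(* What lies on the right of a brick position: either nothing, or a slot with a floor at
   [y] which is open up to [y + t] or closed by a ceiling at the height of a filler. *)
Definition right_context x s y : Prop :=
  (forall z, y <= z < y + t -> ~ inside x z) \/
  [/\ floor_on x (x + slot_width s) y, vseam (x + slot_width s) y &
      (forall x' z, x <= x' < x + slot_width s -> y <= z < y + t -> inside x' z) \/
      (exists c, filler_size s (c - y) /\ forall x', x <= x' < x + slot_width s ->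
         (forall z, y <= z < c -> inside x' z) /\ (forall z, c <= z < c + t -> ~ inside x' z))].

Lemma right_context_inside_below x s y x' z : right_context x s y ->
  inside x y -> x <= x' < x + slot_width s -> y < z < y + t -> inside x' z -> inside x' (z - 1).
Proof.
case=> [out|[_ _ [ins|[c [[_ c_bounds _] ceiling]]]]] xy x'_in z_in x'z.
- by case: (out y _ xy); lia.
- by apply: ins; lia.
- have [below above] := ceiling x' x'_in; apply: below; split; first by lia.
  have [//|c_le] : z - 1 < c \/ c <= z - 1 by lia.
  by case: (above z ltac:(lia)); rewrite ?x'z.
Qed.

Lemma filler_below_ceiling_right x s y c : floor_on x (x + slot_width s) y -> vseam x y ->
  right_context (x + slot_width s) (s + 1) y -> filler_size s (c - y) ->
  (forall z, y <= z < c -> inside x z) -> ~ inside x c -> tile x y (slot_width s) (c - y).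
Proof.
move=> floor start_seam right fill column ceiling; have [_ c_bounds c2] := fill.
have [width width'] := conj (slot_width_bounds s) (slot_width_bounds (s + 1)).
case: right => [out|[right_floor end_seam _]].
  apply: filler_below_ceiling => //.
  by apply: (vseam_outside tileT); apply: out; lia.
case: (@tiles_on_brick_floor x s y) => //.
- move=> x'; rewrite /brick_width => x'_in.
  have [x'_lt|x'_ge] : x' < x + slot_width s \/ x + slot_width s <= x' by lia.
    by apply: floor; lia.
  by apply: right_floor; lia.
- by rewrite /brick_width Z.add_assoc.
- move=> tl; case: ceiling; apply: (tiling_inside tileT tl).
  by rewrite /in_tile /brick_width; lia.
- move=> h _ tl _; have := tile_below_ceiling tl _ _ column ceiling => topE.
  by rewrite (_ : c - y = h) //; lia.
- move=> h _ tl _; have := tile_below_ceiling tl _ _ column ceiling => topE.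
  by have [_ _ h2] := slot_tile_filler tl; lia.
Qed.

Section BrickFloor.
Variables (x s y : Z).
Hypothesis column_inside :
  forall x' z, x <= x' < x + slot_width s -> y <= z < y + t -> inside x' z.
Hypothesis column_floor : forall x', x <= x' < x + slot_width s -> hseam x' y.
Hypothesis start_seam : vseam x y.
Hypothesis right : right_context (x + slot_width s) (s + 1) y.

Lemma fillers_seam s1 s2 h1 h2 : s1 + s2 = s + (s + 1) -> inside (x + slot_width s) y ->
  slot_width s1 < brick_width s -> tile x y (slot_width s1) h1 ->
  tile (x + slot_width s1) y (slot_width s2) h2 -> vseam (x + slot_width s1) (y + h1).
Proof.
move=> s12 right_inside lt_brick tl1 tl2; have width1 := slot_width_bounds s1.
have [_ h1_bounds h1_2] := slot_tile_filler tl1; have [_ h2_bounds h2_2] := slot_tile_filler tl2.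
apply: (@vseam_uneven _ _ y (slot_width s2) h2) => //; [|lia|lia|].
  by apply: (top_hseam tl1); lia.
move=> above; move: lt_brick; rewrite /brick_width => lt_brick.
have [lt_right|ge_right] : slot_width s1 < slot_width s \/ slot_width s <= slot_width s1 by lia.
  by apply: column_inside; lia.
by apply: (right_context_inside_below right right_inside) => //; lia.
Qed.

(* Swapped fillers do not fit below a ceiling, by parity. *)
Lemma swapped_fillers_inside h1 h2 x' : inside (x + slot_width s) y ->
  tile x y (slot_width (s + 1)) h1 -> tile (x + slot_width (s + 1)) y (slot_width s) h2 ->
  x <= x' < x + slot_width (s + 1) -> inside x' (y + h1).
Proof.
move=> right_inside tl1 tl2 x'_in; have := slot_width_bounds s; have := slot_width_bounds (s + 1).
have [_ h1_bounds _] := slot_tile_filler tl1; have [_ h2_bounds h2_2] := slot_tile_filler tl2.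
move=> width' width; have [lt_x'|ge_x'] : x' < x + slot_width s \/ x + slot_width s <= x' by lia.
  by apply: column_inside; lia.
case: right => [out|[_ _ [ins|[c [[_ c_bounds c2] ceiling]]]]].
- by case: (out y); [lia |].
- by apply: ins; lia.
- have [below above] := ceiling (x + slot_width s + slot_width (s + 1) - 1) ltac:(lia).
  have := tile_below_ceiling tl2 _ _ below (above c ltac:(lia)); lia.
Qed.

(* The tile on the floor is a brick over [s] and [s + 1], or a filler whose right upper
   corner is on a vertical seam. *)
Lemma brick_or_filler_on_floor : tile x y (brick_width s) t \/
  exists s' h, [/\ s' = s \/ s' = s + 1, tile x y (slot_width s') h,
    forall x', x <= x' < x + slot_width s' -> inside x' (y + h) &
    vseam (x + slot_width s') (y + h)].
Proof.
have width := slot_width_bounds s; have width' := slot_width_bounds (s + 1).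
have [out|[right_floor end_seam _]] := right.
  have out_seam z : y <= z < y + t -> vseam (x + slot_width s) z.
    by move=> z_in; apply: (vseam_outside tileT); apply: out.
  have [|//||h [tl [_ h_bounds _]]] := @filler_on_floor x s y.
  - by move=> x' x'_in; split; [apply: column_inside; lia | apply: column_floor].
  - by apply: out_seam; lia.
  right; exists s, h; split; [by left | by [] | | by apply: out_seam; lia].
  by move=> x' x'_in; apply: column_inside; lia.
have right_inside : inside (x + slot_width s) y by apply: (right_floor _ _).1; lia.
case: (@tiles_on_brick_floor x s y) => //.
- move=> x'; rewrite /brick_width => x'_in.
  have [x'_lt|x'_ge] : x' < x + slot_width s \/ x + slot_width s <= x' by lia.
    by split; [apply: column_inside | apply: column_floor]; lia.
  by apply: right_floor; lia.
- by rewrite /brick_width Z.add_assoc.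
- by left.
- move=> h1 h2 tl1 tl2; have [_ h1_bounds _] := slot_tile_filler tl1.
  right; exists s, h1; split; [by left | by [] | |].
    by move=> x' x'_in; apply: column_inside; lia.
  by apply: fillers_seam right_inside _ tl1 tl2; rewrite /brick_width; lia.
- move=> h1 h2 tl1 tl2; have [_ h1_bounds _] := slot_tile_filler tl1.
  right; exists (s + 1), h1; split; [by right | by [] | |].
    by move=> x' x'_in; apply: swapped_fillers_inside tl1 tl2 x'_in.
  by apply: fillers_seam right_inside _ tl1 tl2; rewrite /brick_width; lia.
Qed.

End BrickFloor.

Section BrickPosition.
Variables (x0 s yl yr : Z).
Let x1 := x0 + slot_width s.
Let x2 := x1 + slot_width (s + 1).
Hypothesis left_inside : forall x y, x0 <= x < x1 -> yl <= y < yl + t -> inside x y.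
Hypothesis right_inside : forall x y, x1 <= x < x2 -> yr <= y < yr + t -> inside x y.
Hypothesis left_floor : forall x, x0 <= x < x1 -> hseam x yl.
Hypothesis right_floor : forall x, x1 <= x < x2 -> hseam x yr.
Hypothesis left_wall : forall y, yl <= y < yl + t -> vseam x0 y.
Hypothesis uneven : (yl - yr) mod 2 = 1.
Hypothesis level_bounds : - e <= yl - yr <= e.
Hypothesis left_low_seam : yl < yr -> vseam x1 yl.
Hypothesis right_low_seam : yr < yl -> vseam x1 yr.
Hypothesis right : right_context x2 (s + 2) yr.

Let width := slot_width_bounds s.
Let width' := slot_width_bounds (s + 1).

Lemma both_inside x y : x0 <= x < x2 -> yl + e <= y < yl + t - e -> inside x y.
Proof.
have [x_lt|x_ge] : x < x1 \/ x1 <= x by lia.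
  by move=> *; apply: left_inside; lia.
by move=> *; apply: right_inside; lia.
Qed.

Lemma left_filler d : tile x0 yl (slot_width s) d -> vseam x1 (yl + d) ->
  exists d', tile x0 (yl + d) (slot_width s) d' /\ filler_size s d'.
Proof.
move=> tl seam; have [_ d_bounds _] := slot_tile_filler tl.
apply: (filler_on_filler tl) => //; last by apply: left_wall; lia.
by move=> x x_in; apply: both_inside; rewrite /x2 /x1; lia.
Qed.

Lemma defect_of_pile s' d1 d2 : s' = s \/ s' = s + 1 -> tile x0 yl (slot_width s) d1 ->
  tile x0 (yl + d1) (slot_width s') d2 -> vseam (x0 + slot_width s') (yl + d1 + d2) ->
  defect x0 s yl.
Proof.
move=> s'E tl1 tl2 seam; have [_ d1_bounds _] := slot_tile_filler tl1.
have [_ d2_bounds _] := slot_tile_filler tl2.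
have [||//|d3 [tl3 _]] := filler_on_filler tl2; last by exists d1, d2, d3, s'.
- by move=> x x_in; apply: both_inside; rewrite /x2 /x1; case: s'E x_in => ->; lia.
- by apply: left_wall; lia.
Qed.

Lemma defect_of_seam d : tile x0 yl (slot_width s) d -> vseam x1 (yl + d) ->
  (forall d', tile x0 (yl + d) (slot_width s) d' -> vseam x1 (yl + d + d')) -> defect x0 s yl.
Proof.
move=> tl /(left_filler tl)[d' [tl' _]] seam.
by apply: (defect_of_pile _ tl tl') => //; [left | apply: seam].
Qed.

Lemma left_first_filler : exists d, tile x0 yl (slot_width s) d /\ filler_size s d.
Proof.
apply: filler_on_floor; [|by apply: left_wall; lia|].
  by move=> x x_in; split; [apply: left_inside; lia | apply: left_floor].
have [/left_low_seam //|yl_ge] : yl < yr \/ yr < yl by lia.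
apply: (@vseam_above_step _ _ yr);
  [apply: left_floor | apply: right_floor | lia |]; rewrite ?/x2; try lia.
by move=> _; apply: right_inside; rewrite /x2; lia.
Qed.

Lemma defect_of_right_brick w : tile x1 yr w t -> defect x0 s yl.
Proof.
move=> tl; have [d [tl' [_ d_bounds _]]] := left_first_filler.
apply: (defect_of_seam tl'); first by apply: (left_vseam tl); lia.
by move=> d' /slot_tile_filler[_ d'_bounds _]; apply: (left_vseam tl); lia.
Qed.

Lemma fillers_defect s' s2 d h1 h2 : s' = s \/ s' = s + 1 -> s' + s2 = s + (s + 1) ->
  tile x0 yl (slot_width s) d -> tile x0 (yl + d) (slot_width s') h1 ->
  tile (x0 + slot_width s') (yl + d) (slot_width s2) h2 -> defect x0 s yl.
Proof.
move=> s'E s2E tl tl1 tl2; have := slot_width_bounds s'; have [_ d_bounds _] := slot_tile_filler tl.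
have [_ h1_bounds h1_2] := slot_tile_filler tl1; have [_ h2_bounds h2_2] := slot_tile_filler tl2.
move=> width_s'; apply: (defect_of_pile s'E tl tl1).
apply: (@vseam_uneven _ _ (yl + d) (slot_width s2) h2) => //; [|lia|lia|].
  by apply: (top_hseam tl1); lia.
by move=> _; apply: both_inside; rewrite /x2 /x1; lia.
Qed.

Lemma brick_or_defect_on_level d g : tile x0 yl (slot_width s) d ->
  tile x1 yr (slot_width (s + 1)) g -> yl + d = yr + g -> vseam x2 (yr + g) ->
  tile x0 (yl + d) (brick_width s) t \/ defect x0 s yl.
Proof.
move=> tl tlr levelE seam.
have [_ d_bounds _] := slot_tile_filler tl; have [_ g_bounds _] := slot_tile_filler tlr.
have x2E : x2 = x0 + brick_width s by rewrite /x2 /x1 /brick_width; lia.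
case: (@tiles_on_brick_floor x0 s (yl + d)).
- move=> x x_in; split; first by apply: both_inside; lia.
  have [x_lt|x_ge] : x < x1 \/ x1 <= x by lia.
    by apply: (top_hseam tl); lia.
  by rewrite levelE; apply: (top_hseam tlr); lia.
- by apply: left_wall; lia.
- by rewrite -x2E levelE.
- by left.
- by move=> h1 h2 tl1 tl2; right; apply: fillers_defect tl tl1 tl2; [left | lia].
- by move=> h1 h2 tl1 tl2; right; apply: fillers_defect tl tl1 tl2; [right | lia].
Qed.

Lemma defect_of_uneven_tops s' d g : s' = s + 1 \/ s' = s + 2 -> tile x0 yl (slot_width s) d ->
  tile x1 yr (slot_width s') g -> yl + d <> yr + g ->
  (forall x, x1 <= x < x1 + slot_width s' -> inside x (yr + g)) ->
  vseam (x1 + slot_width s') (yr + g) -> defect x0 s yl.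
Proof.
move=> s'E tl tlr neq ins seam; have width_s' := slot_width_bounds s'.
have [_ d_bounds d2] := slot_tile_filler tl; have [_ g_bounds g2] := slot_tile_filler tlr.
have inside_below y : yl + 2 * e <= y < yl + t - e -> inside x1 y -> inside x1 (y - 1).
  by move=> y_in _; apply: both_inside; rewrite /x2; lia.
have seam1 : vseam x1 (yl + d).
  apply: (@vseam_uneven _ _ yr (slot_width s') g) => //; [|lia|by apply: inside_below; lia].
  by apply: (top_hseam tl); lia.
apply: (defect_of_seam tl) => // d' tl'; have [_ d'_bounds d'2] := slot_tile_filler tl'.
have [|g' [tlr' [_ g'_bounds g'2]]] := filler_on_filler tlr ins _ seam.
  have [g_lt|g_ge] : yr + g < yl + d \/ yl + d <= yr + g by lia.
    by apply: (right_vseam tl); lia.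
  by apply: (right_vseam tl'); lia.
apply: (@vseam_uneven _ _ (yr + g) (slot_width s') g') => //; [|lia| |by apply: inside_below; lia].
  by apply: (top_hseam tl'); lia.
by case: s'E => s'E; lia.
Qed.

Lemma brick_or_defect :
  (exists d1 d2, [/\ yl + d1 = yr + d2, tile x0 yl (slot_width s) d1,
     tile x1 yr (slot_width (s + 1)) d2 & tile x0 (yl + d1) (brick_width s) t]) \/
  defect x0 s yl.
Proof.
have [d [tl [_ d_bounds d2]]] := left_first_filler.
have seam1 : vseam x1 yr.
  have [/right_low_seam //|yr_ge] : yr < yl \/ yl <= yr by lia.
  by apply: (right_vseam tl); lia.
have := right; rewrite /x2 (_ : s + 2 = s + 1 + 1); last by lia.
case/(brick_or_filler_on_floor right_inside right_floor seam1) => [tlr|[s' [g [s'E tlr ins seam]]]].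
  by right; apply: defect_of_right_brick tlr.
have [_ g_bounds g2] := slot_tile_filler tlr.
have [levelE|neq] : yl + d = yr + g \/ yl + d <> yr + g by lia.
  have s'E1 : s' = s + 1 by case: s'E => // s'E; rewrite s'E in g2; lia.
  rewrite s'E1 in tlr seam.
  by case: (brick_or_defect_on_level tl tlr levelE seam) => [tlb|dfct]; [left; exists d, g | right].
by right; apply: (defect_of_uneven_tops _ tl tlr neq ins seam); case: s'E => ->;
  [left | right; lia].
Qed.

End BrickPosition.

End Columns.

Fixpoint numeral (base : Z) (n : nat) (a : Z -> Z) (k : Z) : Z :=
  if n is Datatypes.S n' then a k + base * numeral base n' a (k + 1) else 0.

Definition digit (c i : Z) : Z -> Z := fun k => if k =? c then i else 0.

Section Shifts.
Variable I : Z.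
Implicit Types c d i j k : Z.

Definition digit_base : Z := 3 * I + 2.

(* The shift of the bricks of class [c] in state [i]: the classes occupy different digits,
   so that sums of three shifts determine their terms, and the class determines the parity. *)
Definition shift c i : Z := 3 * (2 * digit_base * numeral digit_base 8 (digit c i) 0 + c mod 2).

Definition max_shift : Z := 3 * (2 * digit_base * numeral digit_base 8 (fun=> I) 0 + 1).

Definition gap : Z := 600 * max_shift.

Definition brick_height : Z := 20 * gap + 4.

Local Ltac Zify.zify_post_hook ::= Z.to_euclidean_division_equations.

Lemma numeral_inj base n a b k : 0 < base -> (forall j, 0 <= a j < base) ->
  (forall j, 0 <= b j < base) -> numeral base n a k = numeral base n b k ->
  forall j, k <= j < k + Z.of_nat n -> a j = b j.
Proof.
move=> base_gt0 a_digit b_digit; elim: n k => [|n IH] k /= eq_ab j j_in; first by lia.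
have [ak_digit bk_digit] := conj (a_digit k) (b_digit k).
have [eq_k eq_rest] : a k = b k /\ numeral base n a (k + 1) = numeral base n b (k + 1).
  move: eq_ab; move: (numeral _ _ a _) (numeral _ _ b _) => u v eq_ab.
  have eq_uv : u = v by nia.
  by rewrite eq_uv in eq_ab *; split; lia.
have [->//|j_neq] : j = k \/ j <> k by lia.
by apply: (IH _ eq_rest); lia.
Qed.

Lemma numeral_add base n a b k :
  numeral base n (fun j => a j + b j) k = numeral base n a k + numeral base n b k.
Proof. by elim: n k => [|n IH] k //=; rewrite IH; lia. Qed.

Lemma numeral_le base n a b k : 0 <= base -> (forall j, a j <= b j) ->
  numeral base n a k <= numeral base n b k.
Proof.
move=> base_ge0 le_ab; elim: n k => [|n IH] k //=.
by have := le_ab k; have := Z.mul_le_mono_nonneg_l _ _ _ base_ge0 (IH (k + 1)); lia.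
Qed.

Lemma numeral_ge0 base n a k : 0 <= base -> (forall j, 0 <= a j) -> 0 <= numeral base n a k.
Proof.
move=> base_ge0 a_ge0; elim: n k => [|n IH] k //=.
by have := a_ge0 k; have := Z.mul_nonneg_nonneg _ _ base_ge0 (IH (k + 1)); lia.
Qed.

Lemma digit_bounds c i k : 0 <= i <= I -> 0 <= digit c i k <= I.
Proof. by rewrite /digit; case: Z.eqb; lia. Qed.

Lemma shift_bounds c i : 0 <= i <= I -> 0 <= shift c i <= max_shift.
Proof.
move=> i_in; have base_ge0 : 0 <= digit_base by rewrite /digit_base; lia.
have numeral_c_ge0 : 0 <= numeral digit_base 8 (digit c i) 0.
  by apply: numeral_ge0 => // j; have := digit_bounds c j i_in; lia.
have le_max : numeral digit_base 8 (digit c i) 0 <= numeral digit_base 8 (fun=> I) 0.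
  by apply: numeral_le => // j; have := digit_bounds c j i_in; lia.
have := Z.mul_le_mono_nonneg_l _ _ _ base_ge0 le_max.
have := Z.mul_nonneg_nonneg _ _ base_ge0 numeral_c_ge0.
rewrite /shift /max_shift -!Z.mul_assoc.
by move: (digit_base * _) (digit_base * _) => u v; lia.
Qed.

Lemma shift_mod3 c i : shift c i mod 3 = 0.
Proof. by rewrite /shift; move: (2 * _ * _) => u; lia. Qed.

Lemma shift_mod2 c i : shift c i mod 2 = c mod 2.
Proof. by rewrite /shift -!Z.mul_assoc; move: (digit_base * _) => u; lia. Qed.

Lemma shift_sum_digits c1 c2 c3 d1 d2 d3 i1 i2 i3 j1 j2 j3 :
  shift c1 i1 + shift c2 i2 + shift c3 i3 = shift d1 j1 + shift d2 j2 + shift d3 j3 ->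
  1 <= i1 <= I -> 1 <= i2 <= I -> 1 <= i3 <= I ->
  1 <= j1 <= I -> 1 <= j2 <= I -> 1 <= j3 <= I -> forall k, 0 <= k < 8 ->
  digit c1 i1 k + digit c2 i2 k + digit c3 i3 k = digit d1 j1 k + digit d2 j2 k + digit d3 j3 k.
Proof.
move=> sumE i1_in i2_in i3_in j1_in j2_in j3_in k k_in.
have base_ge5 : 5 <= digit_base by rewrite /digit_base; lia.
have digits3 e1 e2 e3 x1 x2 x3 j : 1 <= x1 <= I -> 1 <= x2 <= I -> 1 <= x3 <= I ->
    0 <= digit e1 x1 j + digit e2 x2 j + digit e3 x3 j < digit_base.
  move=> x1_in x2_in x3_in; have := digit_bounds e1 j (ltac:(lia) : 0 <= x1 <= I).
  have := digit_bounds e2 j (ltac:(lia) : 0 <= x2 <= I).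
  by have := digit_bounds e3 j (ltac:(lia) : 0 <= x3 <= I); rewrite /digit_base; lia.
pose a j := digit c1 i1 j + digit c2 i2 j + digit c3 i3 j.
pose b j := digit d1 j1 j + digit d2 j2 j + digit d3 j3 j.
suff numeralE : numeral digit_base 8 a 0 = numeral digit_base 8 b 0.
  by apply: (numeral_inj _ _ _ numeralE); [lia | by move=> j; apply: digits3 .. | lia].
have aE : shift c1 i1 + shift c2 i2 + shift c3 i3 =
    3 * (2 * (digit_base * numeral digit_base 8 a 0) + c1 mod 2 + c2 mod 2 + c3 mod 2).
  by rewrite /shift /a !numeral_add; ring.
have bE : shift d1 j1 + shift d2 j2 + shift d3 j3 =
    3 * (2 * (digit_base * numeral digit_base 8 b 0) + d1 mod 2 + d2 mod 2 + d3 mod 2).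
  by rewrite /shift /b !numeral_add; ring.
move: sumE; rewrite aE bE; move: (numeral _ _ a _) (numeral _ _ b _) => u v sumE.
have : - 3 <= 2 * digit_base * (u - v) <= 3 by rewrite -Z.mul_assoc Z.mul_sub_distr_l; lia.
by nia.
Qed.

Lemma shift_sum_class c1 c2 c3 d1 d2 d3 i1 i2 i3 j1 j2 j3 :
  shift c1 i1 + shift c2 i2 + shift c3 i3 = shift d1 j1 + shift d2 j2 + shift d3 j3 ->
  1 <= i1 <= I -> 1 <= i2 <= I -> 1 <= i3 <= I ->
  1 <= j1 <= I -> 1 <= j2 <= I -> 1 <= j3 <= I -> 0 <= c1 < 8 -> c1 = d1 \/ c1 = d2 \/ c1 = d3.
Proof.
move=> sumE i1_in i2_in i3_in j1_in j2_in j3_in /(shift_sum_digits sumE).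
move=> /(_ i1_in i2_in i3_in j1_in j2_in j3_in); rewrite /digit Z.eqb_refl.
by repeat case: Z.eqb_spec => ?; lia.
Qed.

Lemma shift_inj c i j : 0 <= c < 8 -> 1 <= i <= I -> 1 <= j <= I -> shift c i = shift c j -> i = j.
Proof.
move=> c_in i_in j_in shiftE.
have : shift c i + shift c i + shift c i = shift c j + shift c j + shift c j by rewrite shiftE.
move/shift_sum_digits => /(_ i_in i_in i_in j_in j_in j_in _ c_in).
by rewrite /digit Z.eqb_refl; lia.
Qed.

Lemma max_shift_gt0 : 1 <= I -> 0 < max_shift.
Proof. by move=> I_ge1; have := shift_bounds 1 (i := 1); have := shift_mod2 1 1; lia. Qed.

Lemma gap_ge : 1 <= I -> 100 * max_shift <= gap.
Proof. by move/max_shift_gt0; rewrite /gap; lia. Qed.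

Lemma gap_mod6 : gap mod 6 = 0.
Proof. by rewrite /gap; lia. Qed.

Lemma brick_height_ge : 20 * gap <= brick_height.
Proof. by rewrite /brick_height; lia. Qed.

Lemma brick_height_mod6 : brick_height mod 6 = 4.
Proof. by rewrite /brick_height; have := gap_mod6; lia. Qed.

End Shifts.

Section Slots.
Implicit Types r s x : Z.

Definition slot_x s : Z :=
  40 * (s / 4) + (if s mod 4 =? 0 then 0 else if s mod 4 =? 1 then 8
                  else if s mod 4 =? 2 then 17 else 29).

(* The bricks of the row [r] start at the slots of the parity of [r]; this is the slot
   where the brick over [s] starts. *)
Definition brick_at r s : Z := s - (s - r) mod 2.

Definition brick_class r s : Z := 2 * (r mod 4) + (s mod 4) / 2.

Local Ltac Zify.zify_post_hook ::= Z.to_euclidean_division_equations.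

Lemma slot_xS s : slot_x (s + 1) = slot_x s + slot_width s.
Proof. by rewrite /slot_x /slot_width; repeat case: Z.eqb_spec => ?; lia. Qed.

Lemma slot_x_brick s : slot_x (s + 2) = slot_x s + brick_width s.
Proof. by rewrite /brick_width Z.add_assoc -!slot_xS -Z.add_assoc. Qed.

Lemma slot_exists x : exists s, slot_x s <= x < slot_x s + slot_width s.
Proof.
have [m m_in] : exists m, (m = 0 /\ 0 <= x mod 40 < 8) \/ (m = 1 /\ 8 <= x mod 40 < 17) \/
    (m = 2 /\ 17 <= x mod 40 < 29) \/ (m = 3 /\ 29 <= x mod 40 < 40).
  have := Z.mod_pos_bound x 40 ltac:(lia).
  have [?|[?|[?|?]]] : x mod 40 < 8 \/ 8 <= x mod 40 < 17 \/ 17 <= x mod 40 < 29 \/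
    29 <= x mod 40 by lia.
  - by exists 0; lia.
  - by exists 1; lia.
  - by exists 2; lia.
  - by exists 3; lia.
exists (4 * (x / 40) + m); rewrite /slot_x /slot_width.
by repeat case: Z.eqb_spec => ?; lia.
Qed.

Lemma slot_uniq s s' x : slot_x s <= x < slot_x s + slot_width s ->
  slot_x s' <= x < slot_x s' + slot_width s' -> s = s'.
Proof. by rewrite /slot_x /slot_width; repeat case: Z.eqb_spec => ?; lia. Qed.

Lemma brick_at_aligned r s : (brick_at r s - r) mod 2 = 0.
Proof. by rewrite /brick_at; lia. Qed.

Lemma brick_at_bounds r s : brick_at r s <= s <= brick_at r s + 1.
Proof. by rewrite /brick_at; lia. Qed.

Lemma brick_at_id r s : (s - r) mod 2 = 0 -> brick_at r s = s.
Proof. by rewrite /brick_at; lia. Qed.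

Lemma brick_atS r s : (s - r) mod 2 = 0 -> brick_at r (s + 1) = s.
Proof. by rewrite /brick_at; lia. Qed.

Lemma brick_at_below r s : (s - r) mod 2 = 0 -> brick_at (r - 1) s = s - 1.
Proof. by rewrite /brick_at; lia. Qed.

Lemma brick_at_belowS r s : (s - r) mod 2 = 0 -> brick_at (r - 1) (s + 1) = s + 1.
Proof. by rewrite /brick_at; lia. Qed.

Lemma slot_in_brick r s x : slot_x s <= x < slot_x s + slot_width s ->
  slot_x (brick_at r s) <= x < slot_x (brick_at r s) + brick_width (brick_at r s).
Proof.
rewrite /brick_width; have := slot_xS (brick_at r s).
have := slot_width_bounds (brick_at r s); have := slot_width_bounds (brick_at r s + 1).
have := brick_at_bounds r s; move: (brick_at r s) => b b_bounds.
have [->|->] : s = b \/ s = b + 1 by lia.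
all: by lia.
Qed.

Lemma brick_at_uniq r b s x : (b - r) mod 2 = 0 -> slot_x s <= x < slot_x s + slot_width s ->
  slot_x b <= x < slot_x b + brick_width b -> brick_at r s = b.
Proof.
move=> rb x_in; rewrite /brick_width Z.add_assoc -slot_xS => x_in_b.
have [x_lt|x_ge] : x < slot_x (b + 1) \/ slot_x (b + 1) <= x by lia.
  by rewrite (slot_uniq x_in (_ : slot_x b <= x < _)) ?brick_at_id // -slot_xS; lia.
by rewrite (slot_uniq x_in (_ : slot_x (b + 1) <= x < _)) ?brick_atS //; lia.
Qed.

Lemma slot_div4 s x : slot_x s <= x < slot_x s + slot_width s -> s / 4 = x / 40.
Proof. by rewrite /slot_x /slot_width; repeat case: Z.eqb_spec => ?; lia. Qed.

Lemma slot_x_periodic c k : slot_x (4 * c + k) = 40 * c + slot_x k.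
Proof. by rewrite /slot_x; repeat case: Z.eqb_spec => ?; lia. Qed.

Lemma brick_width_periodic c k : brick_width (4 * c + k) = brick_width k.
Proof.
by have := slot_x_brick k; have := slot_x_brick (4 * c + k);
  rewrite -Z.add_assoc !slot_x_periodic; lia.
Qed.

Lemma brick_class_bounds r s : 0 <= brick_class r s < 8.
Proof. by rewrite /brick_class; lia. Qed.

Lemma brick_class_mod2 r s : brick_class r s mod 2 = (s mod 4) / 2.
Proof. by rewrite /brick_class; lia. Qed.

Lemma brick_class_row r s r' s' : brick_class r s = brick_class r' s' -> r mod 4 = r' mod 4.
Proof. by rewrite /brick_class; lia. Qed.

Lemma brick_class_at r s r' s' : r mod 4 = r' mod 4 -> s mod 4 = s' mod 4 ->
  brick_class r (brick_at r s) = brick_class r' (brick_at r' s').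
Proof. by rewrite /brick_class /brick_at; lia. Qed.

Lemma brick_class_below r s r' s' : r mod 4 = r' mod 4 -> s mod 4 = s' mod 4 ->
  brick_class (r - 1) (brick_at (r - 1) s) = brick_class (r' - 1) (brick_at (r' - 1) s').
Proof. by move=> rE sE; apply: brick_class_at => //; lia. Qed.

End Slots.

Section Heights.
Variable I : Z.
Implicit Types r s i : Z.

Local Notation t := (brick_height I).
Local Notation gap := (gap I).
Local Notation e := (max_shift I).
Local Notation shift := (shift I).
Local Notation aligned r s := ((s - r) mod 2 = 0).

Local Ltac Zify.zify_post_hook ::= Z.to_euclidean_division_equations.

Definition bottom r s i : Z := r * (t + gap) - gap + shift (brick_class r s) i.

Definition top r s i : Z := bottom r s i + t.

Definition floor r s i : Z := top (r - 1) (brick_at (r - 1) s) i.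

(* The height of a filler over the slot [s] between a brick of the row [r - 1] in state [i']
   and a brick of the row [r] in state [i]. *)
Definition filler_height r s i' i : Z :=
  gap + shift (brick_class r (brick_at r s)) i
      - shift (brick_class (r - 1) (brick_at (r - 1) s)) i'.

Let gap6 : gap mod 6 = 0. Proof. exact: gap_mod6. Qed.

Lemma state_shift_bounds c i : 1 <= i <= I -> 0 <= shift c i <= e.
Proof. by move=> i_in; apply: shift_bounds; lia. Qed.

Lemma bottom_bounds r s i : 1 <= i <= I ->
  r * (t + gap) - gap <= bottom r s i <= r * (t + gap) - gap + e.
Proof. by move/(state_shift_bounds (brick_class r s)); rewrite /bottom; lia. Qed.

Lemma floor_bounds r s i : 1 <= i <= I ->
  r * (t + gap) - 2 * gap <= floor r s i <= r * (t + gap) - 2 * gap + e.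
Proof. by move/(bottom_bounds (r - 1) (brick_at (r - 1) s)); rewrite /floor /top; lia. Qed.

Lemma row_lt r r' : 1 <= I -> r < r' -> r * (t + gap) + (t + gap) <= r' * (t + gap).
Proof.
move=> I_ge1 lt_r; have -> : r * (t + gap) + (t + gap) = (r + 1) * (t + gap) by lia.
have [e_gt0 gap_bound] := conj (max_shift_gt0 I_ge1) (gap_ge I_ge1).
have t_ge := @brick_height_ge I; by apply: Z.mul_le_mono_nonneg_r; lia.
Qed.

Lemma bottom_sub_floor r s i' i :
  bottom r (brick_at r s) i - floor r s i' = filler_height r s i' i.
Proof. by rewrite /filler_height /floor /top /bottom; lia. Qed.

Lemma filler_height_size r s i' i : 1 <= i' <= I -> 1 <= i <= I ->
  filler_size gap e s (filler_height r s i' i).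
Proof.
move=> i'_in i_in; rewrite /filler_height.
set c' := brick_class (r - 1) _; set c := brick_class r _.
have [bounds' bounds] := conj (state_shift_bounds c' i'_in) (state_shift_bounds c i_in).
have [c'3 c3] := conj (shift_mod3 I c' i') (shift_mod3 I c i).
have := conj (shift_mod2 I c' i') (shift_mod2 I c i).
rewrite /c' /c !brick_class_mod2 -/c' -/c /brick_at.
move: (shift c' i') (shift c i) bounds' bounds c'3 c3 => u v bounds' bounds u3 v3 [u2 v2].
by clear c' c; split; lia.
Qed.

Lemma floor_step_size r s i1 i2 : aligned r s -> 1 <= i1 <= I -> 1 <= i2 <= I ->
  filler_size gap e (s - 1) (floor (r + 1) (s - 1) i2 - floor r s i1 - t).
Proof.
move=> rs i1_in i2_in; have := filler_height_size r (s - 1) i1_in i2_in.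
congr filler_size; rewrite -bottom_sub_floor /floor Z.add_simpl_r /top.
by rewrite (_ : brick_at (r - 1) (s - 1) = brick_at (r - 1) s) ; [lia | rewrite /brick_at; lia].
Qed.

Lemma floors_uneven r s i1 i2 : aligned r s -> (floor r s i1 - floor r (s + 1) i2) mod 2 = 1.
Proof.
rewrite /floor /top /bottom => rs; rewrite brick_at_below // brick_at_belowS //.
have := conj (shift_mod2 I (brick_class (r - 1) (s - 1)) i1)
             (shift_mod2 I (brick_class (r - 1) (s + 1)) i2).
rewrite !brick_class_mod2; move: (shift _ _) (shift _ _) => u v [u2 v2].
by lia.
Qed.

Lemma filler_height_inj r s i' i r0 s0 j' j : filler_height r s i' i = filler_height r0 s0 j' j ->
  s mod 4 = s0 mod 4 -> 1 <= i' <= I -> 1 <= i <= I -> 1 <= j' <= I -> 1 <= j <= I ->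
  [/\ r mod 4 = r0 mod 4, i' = j' & i = j].
Proof.
rewrite /filler_height; set c' := brick_class (r - 1) _; set c := brick_class r _.
set d' := brick_class (r0 - 1) _; set d := brick_class r0 _ => heightE sE i'_in i_in j'_in j_in.
have c_neq : c <> c' by move/brick_class_row; lia.
have [c_in c'_in] :=
  conj (brick_class_bounds _ _ : 0 <= c < 8) (brick_class_bounds _ _ : 0 <= c' < 8).
have sumE : shift c i + shift d' j' + shift c' i' = shift d j + shift c' i' + shift c' i' by lia.
have rE : r mod 4 = r0 mod 4.
  by case: (shift_sum_class sumE i_in j'_in i'_in j_in i'_in i'_in c_in) => [/brick_class_row|[|]].
have [cE c'E] : c = d /\ c' = d' by split; [apply: brick_class_at | apply: brick_class_below].
have digits := shift_sum_digits sumE i_in j'_in i'_in j_in i'_in i'_in.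
have := conj (digits c c_in) (digits c' c'_in); rewrite -cE -c'E /digit !Z.eqb_refl.
by repeat case: Z.eqb_spec => ?; split; lia.
Qed.

(* Fillers with tops at the same height over the two slots of a brick of the row [r] fill
   zones below this row, and both are made for the same state of this brick. *)
Lemma level_fillers_inj r s i1 i2 r1 s1 j1' j1 r2 s2 j2' j2 : aligned r s ->
  floor r s i1 + filler_height r1 s1 j1' j1 = floor r (s + 1) i2 + filler_height r2 s2 j2' j2 ->
  s mod 4 = s1 mod 4 -> (s + 1) mod 4 = s2 mod 4 ->
  1 <= i1 <= I -> 1 <= i2 <= I -> 1 <= j1' <= I -> 1 <= j1 <= I -> 1 <= j2' <= I -> 1 <= j2 <= I ->
  [/\ r mod 4 = r1 mod 4, r mod 4 = r2 mod 4, i1 = j1', i2 = j2' & j1 = j2].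
Proof.
rewrite /floor /top /bottom /filler_height => rs.
set a1 := brick_class (r - 1) _; set a2 := brick_class (r - 1) _.
set c1 := brick_class r1 _; set c2 := brick_class r2 _; set d1 := brick_class (r1 - 1) _.
set d2 := brick_class (r2 - 1) _ => levelE s1E s2E i1_in i2_in j1'_in j1_in j2'_in j2_in.
have sumE : shift a1 i1 + shift c1 j1 + shift d2 j2' = shift a2 i2 + shift c2 j2 + shift d1 j1'.
  by lia.
have [a1_in a2_in] :=
  conj (brick_class_bounds _ _ : 0 <= a1 < 8) (brick_class_bounds _ _ : 0 <= a2 < 8).
have a_neq : a1 <> a2 by rewrite /a1 /a2 /brick_class /brick_at; lia.
have r1E : r mod 4 = r1 mod 4.
  case: (shift_sum_class sumE i1_in j1_in j2'_in i2_in j2_in j1'_in a1_in) =>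
    [//|[|/brick_class_row]].
  - by rewrite /a1 /c2 /brick_class /brick_at; lia.
  - by lia.
have r2E : r mod 4 = r2 mod 4.
  case: (shift_sum_class (esym sumE) i2_in j2_in j1'_in i1_in j1_in j2'_in a2_in) =>
    [/esym//|[|/brick_class_row]].
  - by rewrite /a2 /c1 /brick_class /brick_at; lia.
  - by lia.
have [d1E d2E] : a1 = d1 /\ a2 = d2 by split; apply: brick_class_below.
have cE : c2 = c1 by rewrite /c1 /c2 /brick_class /brick_at; lia.
have [c_neq1 c_neq2] : c1 <> a1 /\ c1 <> a2 by split; move/brick_class_row; lia.
have digits := shift_sum_digits sumE i1_in j1_in j2'_in i2_in j2_in j1'_in.
have := And3 (digits _ a1_in) (digits _ a2_in) (digits _ (brick_class_bounds _ _ : 0 <= c1 < 8)).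
rewrite -d1E -d2E cE /digit !Z.eqb_refl; clear -a_neq c_neq1 c_neq2 r1E r2E.
by repeat case: Z.eqb_spec => ?; try lia; case=> *; split; lia.
Qed.

End Heights.

Section InnerBricks.
Variable active : Z -> Z -> bool.

Definition inner r s : bool :=
  [&& active r s, active r (s + 1), active (r + 1) s & active (r + 1) (s + 1)].

Lemma inner_active r s : inner r (brick_at r s) -> active r s /\ active (r + 1) s.
Proof.
case/and4P; have [->|sE] : brick_at r s = s \/ brick_at r s + 1 = s; last by rewrite sE.
  by have := brick_at_bounds r s; lia.
by [].
Qed.

End InnerBricks.

Section Bricks.
Variables (I : Z) (active : Z -> Z -> bool) (outer : Z -> Z -> Z) (rel : Z -> Z -> Z -> Z -> Prop).
Implicit Types r s x y i : Z.

Local Notation t := (brick_height I).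
Local Notation gap := (gap I).
Local Notation e := (max_shift I).
Local Notation shift := (shift I).
Local Notation inner := (inner active).
Local Notation bottom := (bottom I).
Local Notation top := (top I).
Local Notation floor := (floor I).
Local Notation filler_height := (filler_height I).
Local Notation aligned r s := ((s - r) mod 2 = 0).
Local Notation in_slot s x := (slot_x s <= x < slot_x s + slot_width s).

Local Ltac Zify.zify_post_hook ::= Z.to_euclidean_division_equations.

Definition valid r s i : Prop := 1 <= i <= I /\ (inner r s = false -> i = outer r s).

Definition wall_tile w h : Prop :=
  (h = t /\ exists s, w = brick_width s) \/
  (exists r s i' i, [/\ w = slot_width s, h = filler_height r s i' i & rel r s i' i]).

Record layout (inside : Z -> Z -> Prop) : Prop := Layout {
  layout_brick : forall r s i x y, valid r (brick_at r s) i -> in_slot s x ->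
    bottom r (brick_at r s) i <= y < top r (brick_at r s) i ->
    (inside x y <-> inner r (brick_at r s));
  layout_zone : forall r s i' i x y,
    valid (r - 1) (brick_at (r - 1) s) i' -> valid r (brick_at r s) i -> in_slot s x ->
    floor r s i' <= y < bottom r (brick_at r s) i -> (inside x y <-> active r s) }.

Record states_ok : Prop := StatesOk {
  states_nonempty : 1 <= I;
  outer_range : forall r s, 1 <= outer r s <= I;
  rel_range : forall r s i' i, rel r s i' i -> 1 <= i' <= I /\ 1 <= i <= I;
  rel_periodic : forall r s r' s' i' i, r mod 4 = r' mod 4 -> s mod 4 = s' mod 4 ->
    rel r s i' i -> rel r' s' i' i }.

Hypothesis ok : states_ok.

Let I_ge1 := states_nonempty ok.
Let e_gt0 : 0 < e. Proof. exact: max_shift_gt0. Qed.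
Let gap_bound : 100 * e <= gap. Proof. exact: gap_ge. Qed.
Let t_bound : 20 * gap <= t. Proof. exact: brick_height_ge. Qed.
Let t6 : t mod 6 = 4. Proof. exact: brick_height_mod6. Qed.
Let gap6 : gap mod 6 = 0. Proof. exact: gap_mod6. Qed.

Variables (inside : Z -> Z -> Prop) (tile : Z -> Z -> Z -> Z -> Prop).
Hypotheses (insideP : layout inside) (tileT : tiling inside wall_tile tile).

Local Notation hseam := (hseam tile).
Local Notation vseam := (vseam tile).

Lemma column_tiling : tiling inside (column_size t gap e) tile.
Proof.
apply: (sub_tiling_size _ tileT) => w h [|[r [s [i' [i [-> -> /(rel_range ok)[i'_in i_in]]]]]]];
  first by left.
by right; exists s; split=> //; apply: filler_height_size.
Qed.

Lemma column_params_wall : column_params t gap e.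
Proof. by split=> //; lia. Qed.

Let params := column_params_wall.
Let size_gt0 w h : column_size t gap e w h -> 0 < w /\ 0 < h.
Proof. exact: (column_size_gt0 params). Qed.

Lemma wall_filler_rel a b r s i' i : tile a b (slot_width s) (filler_height r s i' i) ->
  1 <= i' <= I -> 1 <= i <= I -> rel r s i' i.
Proof.
move=> tl i'_in i_in; case: (tiling_size tileT tl) => [[_ [s' /slot_width_neq_brick//]]|].
move=> [r0 [s0 [j' [j [/slot_width_eq sE heightE rel0]]]]].
have [j'_in j_in] := rel_range ok rel0.
have [rE -> ->] := filler_height_inj heightE sE i'_in i_in j'_in j_in.
by apply: (rel_periodic ok _ _ rel0).
Qed.

Lemma wall_level_fillers_rel a1 b1 a2 b2 r s i1 i2 h1 h2 : aligned r s ->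
  1 <= i1 <= I -> 1 <= i2 <= I -> tile a1 b1 (slot_width s) h1 ->
  tile a2 b2 (slot_width (s + 1)) h2 -> floor r s i1 + h1 = floor r (s + 1) i2 + h2 ->
  exists i, [/\ h1 = filler_height r s i1 i, h2 = filler_height r (s + 1) i2 i,
    rel r s i1 i & rel r (s + 1) i2 i].
Proof.
move=> rs i1_in i2_in tl1 tl2 levelE.
case: (tiling_size tileT tl1) => [[_ [s' /slot_width_neq_brick//]]|].
move=> [r1 [s1 [j1' [j1 [/slot_width_eq s1E h1E rel1]]]]].
case: (tiling_size tileT tl2) => [[_ [s' /slot_width_neq_brick//]]|].
move=> [r2 [s2 [j2' [j2 [/slot_width_eq s2E h2E rel2]]]]].
have [[j1'_in j1_in] [j2'_in j2_in]] := conj (rel_range ok rel1) (rel_range ok rel2).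
rewrite h1E h2E in levelE.
have [r1E r2E -> -> j12E] :=
  level_fillers_inj rs levelE s1E s2E i1_in i2_in j1'_in j1_in j2'_in j2_in.
exists j1; split.
- rewrite h1E /filler_height.
  by rewrite (brick_class_at r1E s1E) (brick_class_below r1E s1E).
- rewrite h2E j12E /filler_height.
  by rewrite (brick_class_at r2E s2E) (brick_class_below r2E s2E).
- by apply: (rel_periodic ok _ _ rel1).
- by rewrite j12E; apply: (rel_periodic ok _ _ rel2).
Qed.

Definition in_state r s i : Prop := 1 <= i <= I /\
  (if inner r s then tile (slot_x s) (bottom r s i) (brick_width s) t else i = outer r s).

Definition floor_state r s i : Prop := in_state (r - 1) (brick_at (r - 1) s) i.

Definition filled r s i' i : Prop :=
  tile (slot_x s) (floor r s i') (slot_width s) (filler_height r s i' i) /\ rel r s i' i.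

Definition proper r s : Prop := exists i, [/\ in_state r s i,
  active r s -> exists i', floor_state r s i' /\ filled r s i' i &
  active r (s + 1) -> exists i', floor_state r (s + 1) i' /\ filled r (s + 1) i' i].

Lemma outer_valid r s : valid r s (outer r s).
Proof. by split=> //; apply: outer_range. Qed.

Lemma in_state_valid r s i : in_state r s i -> valid r s i.
Proof. by case=> i_in; rewrite /valid; case: inner. Qed.

Lemma in_state_outer r s : inner r s = false -> in_state r s (outer r s).
Proof. by move=> out; split; [apply: outer_range | rewrite out]. Qed.

Lemma proper_in_state r s : proper r s -> exists i, in_state r s i.
Proof. by case=> i [st _ _]; exists i. Qed.

Lemma in_state_uniq r s i i' : in_state r s i -> in_state r s i' -> i = i'.
Proof.
case=> i_in; rewrite /in_state; case: inner => [tl|-> [_ ->] //] [i'_in tl'].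
have [b_bounds b'_bounds] := conj (bottom_bounds r s i_in) (bottom_bounds r s i'_in).
have width := brick_width_bounds s; pose y := r * (t + gap) - gap + e.
have [||_ bE _ _] := tiling_uniq tileT tl tl' (x := slot_x s) (y := y).
- by rewrite /in_tile /y; lia.
- by rewrite /in_tile /y; lia.
by apply: (shift_inj (brick_class_bounds r s) i_in i'_in); move: bE; rewrite /bottom; lia.
Qed.

Lemma inside_brick r s i x y : aligned r s -> valid r s i ->
  slot_x s <= x < slot_x s + brick_width s -> bottom r s i <= y < top r s i ->
  (inside x y <-> inner r s).
Proof.
move=> rs; rewrite /brick_width => st x_in y_in.
have [x_lt|x_ge] : x < slot_x s + slot_width s \/ slot_x s + slot_width s <= x by lia.
  have := @layout_brick _ insideP r s i x y; rewrite brick_at_id //.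
  by apply=> //; lia.
have := @layout_brick _ insideP r (s + 1) i x y; rewrite brick_atS // slot_xS.
by apply=> //; lia.
Qed.

Lemma brick_vseam r s i y : aligned r s -> in_state r s i -> bottom r s i <= y < top r s i ->
  vseam (slot_x s) y /\ vseam (slot_x s + brick_width s) y.
Proof.
move=> rs st y_in; have st_valid := in_state_valid st; have width := brick_width_bounds s.
case: st => _; case: ifP => [inner_rs tl|inner_rs _].
  by split; [apply: (vseam_tile_left column_tiling size_gt0 tl) |
             apply: (vseam_tile_right column_tiling size_gt0 tl)].
have out x : slot_x s <= x < slot_x s + brick_width s -> ~ inside x y.
  by move=> x_in; rewrite (inside_brick rs st_valid) // inner_rs.
split; first by apply: (vseam_outside column_tiling); apply: out; lia.
by apply: (vseam_outside_left column_tiling); apply: out; lia.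
Qed.

Lemma floor_hseam r s i x : floor_state r s i -> in_slot s x -> hseam x (floor r s i).
Proof.
move=> st /(slot_in_brick (r - 1)) x_in; have st_valid := in_state_valid st.
have rs := brick_at_aligned (r - 1) s.
case: st => _; case: ifP => [inner_rs tl|inner_rs _].
  exact: (hseam_tile_top column_tiling size_gt0 tl).
apply: (hseam_outside_below column_tiling); rewrite (inside_brick rs st_valid) // ?inner_rs //.
by rewrite /floor /top; lia.
Qed.

(* The height at which the bricks of the row [r] over the slot [s] start if there are none
   in the region. *)
Definition ceiling r s : Z := bottom r (brick_at r s) (outer r (brick_at r s)).

Lemma ceiling_bounds r s : r * (t + gap) - gap <= ceiling r s <= r * (t + gap) - gap + e.
Proof. by apply/bottom_bounds/outer_range. Qed.

Lemma ceiling_sub_floor r s i : 1 <= i <= I -> filler_size gap e s (ceiling r s - floor r s i).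
Proof.
by move=> i_in; rewrite bottom_sub_floor; apply: filler_height_size => //;
  apply: outer_range.
Qed.

Lemma inside_zone r s i x y : floor_state r s i -> in_slot s x ->
  floor r s i <= y < ceiling r s -> (inside x y <-> active r s).
Proof. by move=> /in_state_valid st; apply: (layout_zone insideP) => //; apply: outer_valid. Qed.

Lemma inside_above_ceiling r s x y : in_slot s x -> ceiling r s <= y < ceiling r s + t ->
  (inside x y <-> inner r (brick_at r s)).
Proof. by apply: (layout_brick insideP); apply: outer_valid. Qed.

Lemma inside_column r s i x y : floor_state r s i -> inner r (brick_at r s) -> in_slot s x ->
  floor r s i <= y < floor r s i + t -> inside x y.
Proof.
move=> st inner_rs x_in y_in; have [active_rs _] := inner_active inner_rs.
have := ceiling_sub_floor r s st.1; case=> _ c_bounds _.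
have [y_lt|y_ge] : y < ceiling r s \/ ceiling r s <= y by lia.
  by apply/(inside_zone st x_in) => //; lia.
by apply/(@inside_above_ceiling r s) => //; lia.
Qed.

Lemma low_floor_vseam r s i1 i2 : aligned r s -> floor_state r s i1 -> floor_state r (s + 1) i2 ->
  (floor r s i1 < floor r (s + 1) i2 -> vseam (slot_x (s + 1)) (floor r s i1)) /\
  (floor r (s + 1) i2 < floor r s i1 -> vseam (slot_x (s + 1)) (floor r (s + 1) i2)).
Proof.
move=> rs st1 st2; have [b1 b2] := conj (floor_bounds r s st1.1) (floor_bounds r (s + 1) st2.1).
move: st1 st2 b1 b2; rewrite /floor_state /floor brick_at_below // brick_at_belowS //.
move=> st1 st2 b1 b2; split=> lt_floor.
  by apply: (brick_vseam _ st2 _).1; move: lt_floor b1 b2; rewrite /top; lia.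
have [||_] := brick_vseam _ st1 (y := top (r - 1) (s + 1) i2).
- by lia.
- by move: lt_floor b1 b2; rewrite /top; lia.
by congr vseam; rewrite -slot_x_brick; congr slot_x; lia.
Qed.

Lemma floor_end_vseam r s i1 i2 : aligned r s -> floor_state r s i1 -> floor_state r (s + 1) i2 ->
  vseam (slot_x (s + 1)) (floor r s i1).
Proof.
move=> rs st1 st2; have [width width'] := conj (slot_width_bounds s) (slot_width_bounds (s + 1)).
have [b1 b2] := conj (floor_bounds r s st1.1) (floor_bounds r (s + 1) st2.1).
have xE := slot_xS s; have uneven := @floors_uneven I r s i1 i2 rs.
have [low _] := low_floor_vseam rs st1 st2.
have [/low //|lt_floor] : floor r s i1 < floor r (s + 1) i2 \/ floor r (s + 1) i2 < floor r s i1.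
  by lia.
have c_bounds := ceiling_bounds r (s + 1).
apply: (vseam_above_step params column_tiling (z := floor r (s + 1) i2)).
- by apply: (floor_hseam st1); lia.
- by apply: (floor_hseam st2); lia.
- by lia.
- by rewrite !(inside_zone st2) //; lia.
Qed.

Lemma left_wall r s i1 y : aligned r s -> floor_state r s i1 -> proper r (s - 2) ->
  floor r s i1 <= y < floor r s i1 + t -> vseam (slot_x s) y.
Proof.
move=> rs st1 [i [st _]]; rewrite (_ : s - 2 + 1 = s - 1); last by lia.
have brickE : brick_at r (s - 1) = s - 2 by rewrite /brick_at; lia.
have floor_brickE : brick_at (r - 1) (s - 1) = brick_at (r - 1) s by rewrite /brick_at; lia.
have xE : slot_x s = slot_x (s - 1) + slot_width (s - 1).
  by rewrite -slot_xS; congr slot_x; lia.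
have x2E : slot_x s = slot_x (s - 2) + brick_width (s - 2).
  by rewrite -slot_x_brick; congr slot_x; lia.
have st1' : floor_state r (s - 1) i1 by rewrite /floor_state floor_brickE.
have floorE : floor r (s - 1) i1 = floor r s i1 by rewrite /floor floor_brickE.
have width := slot_width_bounds (s - 1).
move=> left_filled y_in.
have [y_lt|y_ge] : y < bottom r (s - 2) i \/ bottom r (s - 2) i <= y by lia.
  case: (boolP (active r (s - 1))) left_filled => [active_rs|/negbTE active_rs] left_filled.
    have [i' [st' [tl _]]] := left_filled isT; rewrite xE.
    apply: (vseam_tile_right column_tiling size_gt0 tl).
    rewrite -(in_state_uniq st1' st') floorE -bottom_sub_floor brickE floorE; lia.
  apply: (vseam_outside_left column_tiling).
  have := @layout_zone _ insideP r (s - 1) i1 i (slot_x s - 1) y; rewrite brickE active_rs => ->//.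
  - exact: in_state_valid.
  - exact: in_state_valid.
  - by lia.
  - by lia.
rewrite x2E; apply: (brick_vseam _ st _).2; first by lia.
have b1 := floor_bounds r s st1.1; have b := bottom_bounds r (s - 2) st.1.
by rewrite /top; lia.
Qed.

Lemma right_context_floor r s i : floor_state r s i ->
  (active r s -> vseam (slot_x (s + 1)) (floor r s i)) ->
  right_context inside tile t gap e (slot_x s) s (floor r s i).
Proof.
move=> st; rewrite slot_xS => end_seam; have width := slot_width_bounds s.
have [_ c_bounds _] := ceiling_sub_floor r s st.1.
have zone x y : in_slot s x -> floor r s i <= y < ceiling r s -> (inside x y <-> active r s).
  exact: inside_zone.
have above x y := @inside_above_ceiling r s x y.
case active_rs: (active r s) zone end_seam => zone end_seam; last first.
  left=> y y_in; have [y_lt|y_ge] : y < ceiling r s \/ ceiling r s <= y by lia.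
    by rewrite zone //; lia.
  rewrite above; [|lia|lia].
  by move/inner_active; rewrite active_rs; case.
right; split; last 1 first.
- case inner_rs: (inner r (brick_at r s)) above => above.
    by left=> x y x_in y_in; apply: (inside_column st).
  right; exists (ceiling r s); split; first exact: ceiling_sub_floor st.1.
  by move=> x x_in; split=> y y_in; [apply/zone | rewrite above].
- move=> x x_in; split; last exact: floor_hseam.
  by apply/zone => //; lia.
- exact: end_seam.
Qed.

Lemma brick_or_defect_inner r s i1 i2 : aligned r s -> inner r s ->
  floor_state r s i1 -> floor_state r (s + 1) i2 -> proper r (s - 2) ->
  (active r (s + 2) -> vseam (slot_x (s + 3)) (floor r (s + 1) i2)) ->
  (exists d1 d2, [/\ floor r s i1 + d1 = floor r (s + 1) i2 + d2,
     tile (slot_x s) (floor r s i1) (slot_width s) d1,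
     tile (slot_x (s + 1)) (floor r (s + 1) i2) (slot_width (s + 1)) d2 &
     tile (slot_x s) (floor r s i1 + d1) (brick_width s) t]) \/
  defect tile (slot_x s) s (floor r s i1).
Proof.
move=> rs inner_rs st1 st2 left end_seam; rewrite slot_xS.
have floorE : floor r (s + 2) i2 = floor r (s + 1) i2.
  by rewrite /floor (_ : brick_at (r - 1) (s + 2) = brick_at (r - 1) (s + 1)) // /brick_at; lia.
have b1 := floor_bounds r s st1.1; have b2 := floor_bounds r (s + 1) st2.1.
have [low_left low_right] := low_floor_vseam rs st1 st2.
apply: (brick_or_defect params column_tiling).
- by move=> x y; apply: (inside_column st1); rewrite brick_at_id.
- by rewrite -slot_xS => x y; apply: (inside_column st2); rewrite brick_atS.
- by move=> x; apply: floor_hseam.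
- by rewrite -slot_xS => x; apply: floor_hseam.
- by move=> y; apply: left_wall.
- exact: floors_uneven.
- by lia.
- by rewrite -slot_xS.
- by rewrite -slot_xS.
- rewrite -!slot_xS -Z.add_assoc -floorE; apply: right_context_floor; last first.
    by rewrite -Z.add_assoc floorE.
  by rewrite /floor_state (_ : brick_at (r - 1) (s + 2) = brick_at (r - 1) (s + 1)) // /brick_at;
    lia.
Qed.

Definition has_defect r s : Prop := [/\ aligned r s, inner r s &
  exists i, floor_state r s i /\ defect tile (slot_x s) s (floor r s i)].

Lemma proper_or_defect_inner r s i1 i2 : aligned r s -> inner r s ->
  floor_state r s i1 -> floor_state r (s + 1) i2 -> proper r (s - 2) ->
  (active r (s + 2) -> vseam (slot_x (s + 3)) (floor r (s + 1) i2)) ->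
  proper r s \/ has_defect r s.
Proof.
move=> rs inner_rs st1 st2 left end_seam.
have [|dfct] := brick_or_defect_inner rs inner_rs st1 st2 left end_seam; last first.
  by right; split=> //; exists i1.
move=> [d1 [d2 [levelE tl1 tl2 tlb]]]; left.
have [i [d1E d2E rel1 rel2]] := wall_level_fillers_rel rs st1.1 st2.1 tl1 tl2 levelE.
have [_ i_in] := rel_range ok rel1; rewrite d1E d2E in tl1 tl2 tlb.
exists i; split; last 2 first.
- by move=> _; exists i1.
- by move=> _; exists i2.
- split=> //; rewrite inner_rs; move: tlb; rewrite -bottom_sub_floor brick_at_id //.
  by congr tile; lia.
Qed.

Lemma filled_outer r s i : inner r (brick_at r s) = false -> active r s -> floor_state r s i ->
  vseam (slot_x s) (floor r s i) -> vseam (slot_x (s + 1)) (floor r s i) \/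
    right_context inside tile t gap e (slot_x (s + 1)) (s + 1) (floor r s i) ->
  filled r s i (outer r (brick_at r s)).
Proof.
move=> outer_rs active_rs st start_seam right; have width := slot_width_bounds s.
have fill := ceiling_sub_floor r s st.1; have [_ c_bounds _] := fill.
have x_in : in_slot s (slot_x s) by lia.
have zone_floor : floor_on inside tile (slot_x s) (slot_x s + slot_width s) (floor r s i).
  move=> x x'_in; split; last exact: floor_hseam.
  by apply/(inside_zone st) => //; lia.
have column y : floor r s i <= y < ceiling r s -> inside (slot_x s) y.
  by move=> y_in; apply/(inside_zone st).
have out : ~ inside (slot_x s) (ceiling r s).
  by rewrite (@inside_above_ceiling r s) ?outer_rs //; lia.
suff tl : tile (slot_x s) (floor r s i) (slot_width s) (ceiling r s - floor r s i).
  rewrite bottom_sub_floor in tl; split=> //.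
  by apply: (wall_filler_rel tl st.1); apply: outer_range.
case: right; rewrite slot_xS => right.
  exact: (filler_below_ceiling params column_tiling).
exact: (filler_below_ceiling_right params column_tiling).
Qed.

Lemma filled_outer_left r s i1 i2 : aligned r s -> inner r s = false -> active r s ->
  floor_state r s i1 -> floor_state r (s + 1) i2 -> proper r (s - 2) ->
  filled r s i1 (outer r s).
Proof.
move=> rs outer_rs active_rs st1 st2 left.
rewrite -{2}(brick_at_id rs); apply: filled_outer => //; first by rewrite brick_at_id.
  by apply: (left_wall rs st1) => //; lia.
by left; apply: floor_end_vseam st2.
Qed.

Lemma filled_outer_right r s i1 i2 : aligned r s -> inner r s = false -> active r (s + 1) ->
  floor_state r s i1 -> floor_state r (s + 1) i2 -> proper r (s - 2) ->
  (active r (s + 2) -> vseam (slot_x (s + 3)) (floor r (s + 1) i2)) ->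
  filled r (s + 1) i2 (outer r s).
Proof.
move=> rs outer_rs active_rs st1 st2 left end_seam.
have floor_brickE : brick_at (r - 1) (s + 1 + 1) = brick_at (r - 1) (s + 1).
  by rewrite /brick_at; lia.
have floorE : floor r (s + 1 + 1) i2 = floor r (s + 1) i2 by rewrite /floor floor_brickE.
have [b1 b2] := conj (floor_bounds r s st1.1) (floor_bounds r (s + 1) st2.1).
rewrite -{2}(brick_atS rs); apply: filled_outer; rewrite ?brick_atS //; last first.
  right; rewrite -floorE; apply: right_context_floor; first by rewrite /floor_state floor_brickE.
  by rewrite floorE -!Z.add_assoc.
have [lt_floor|ge_floor] : floor r (s + 1) i2 < floor r s i1 \/ floor r s i1 <= floor r (s + 1) i2.
  by lia.
  exact: (low_floor_vseam rs st1 st2).2.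
case: (boolP (active r s)) => [active_left|/negbTE inactive_left].
  have [tl _] := filled_outer_left rs outer_rs active_left st1 st2 left.
  rewrite slot_xS; apply: (vseam_tile_right column_tiling size_gt0 tl).
  have := filler_height_size r s st1.1 (outer_range ok r s); case=> _ h_bounds _.
  by lia.
apply: (vseam_outside_left column_tiling); rewrite slot_xS.
have width := slot_width_bounds s; have [_ c_bounds _] := ceiling_sub_floor r s st1.1.
by rewrite (inside_zone st1) ?inactive_left //; lia.
Qed.

Lemma proper_or_defect r s i1 i2 : aligned r s ->
  floor_state r s i1 -> floor_state r (s + 1) i2 -> proper r (s - 2) ->
  (active r (s + 2) -> vseam (slot_x (s + 3)) (floor r (s + 1) i2)) ->
  proper r s \/ has_defect r s.
Proof.
move=> rs st1 st2 left end_seam; case: (boolP (inner r s)) => [inner_rs|/negbTE outer_rs].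
  exact: proper_or_defect_inner st1 st2 left end_seam.
left; exists (outer r s); split; first exact: in_state_outer.
- by move=> active_rs; exists i1; split=> //; apply: filled_outer_left st2 left.
- by move=> active_rs; exists i2; split=> //; apply: filled_outer_right st1 st2 left end_seam.
Qed.

Lemma proper_inactive r s : active r s = false -> active r (s + 1) = false -> proper r s.
Proof.
move=> inactive inactive'; exists (outer r s); rewrite inactive inactive'; split=> //.
by apply: in_state_outer; rewrite /inner inactive.
Qed.

Lemma proper_floor_vseam r s i2 : aligned r s -> floor_state r (s + 1) i2 ->
  proper (r - 1) (s + 3) -> vseam (slot_x (s + 3)) (floor r (s + 1) i2).
Proof.
move=> rs st2 /proper_in_state[i3 st3].
have floor_brickE : brick_at (r - 1) (s + 2) = brick_at (r - 1) (s + 1) by rewrite /brick_at; lia.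
have := @floor_end_vseam r (s + 2) i2 i3; rewrite /floor_state /floor floor_brickE -Z.add_assoc.
apply=> //; first by lia.
by rewrite (_ : brick_at (r - 1) (s + 3) = s + 3) // /brick_at; lia.
Qed.

Definition left_proper r s : Prop := forall s', aligned r s' -> s' < s -> proper r s'.

Variable bound : Z.
Hypothesis active_bounded : forall r s, active r s -> - bound < r < bound /\ - bound < s < bound.

Lemma inactive_outside r s : ~ (- bound < r < bound /\ - bound < s < bound) -> active r s = false.
Proof. by move=> out; apply/negP => /active_bounded. Qed.

Lemma left_proper_or_defect r s0 :
  (forall s, aligned r s -> s < s0 -> left_proper r s -> proper r s \/ has_defect r s) ->
  left_proper r s0 \/ exists s, has_defect r s /\ left_proper r s.
Proof.
have [m s0_le] : exists m : nat, s0 <= - bound - 3 + Z.of_nat m.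
  by exists (Z.to_nat (s0 + bound + 3)); lia.
elim: m s0 s0_le => [|m IH] s0 s0_le step.
  by left=> s _ s_lt; apply: proper_inactive; apply: inactive_outside; lia.
case: (IH (s0 - 1)) => [||left|]; [by lia | | | by right].
  by move=> s rs s_lt; apply: step => //; lia.
have [rs|not_rs] : aligned r (s0 - 1) \/ ~ aligned r (s0 - 1) by lia.
  case: (step _ rs _ left) => [|last_proper|dfct]; [by lia | | by right; exists (s0 - 1)].
  left=> s s_rs s_lt; have [->//|s_neq] : s = s0 - 1 \/ s <> s0 - 1 by lia.
  by apply: left => //; lia.
left=> s s_rs s_lt; apply: left => //.
have [s_eq|] : s = s0 - 1 \/ s <> s0 - 1 by lia.
  by case: not_rs; rewrite -s_eq.
by lia.
Qed.

Lemma proper_row_or_defect r : (forall s, aligned (r - 1) s -> proper (r - 1) s) ->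
  (forall s, aligned r s -> proper r s) \/ exists s, has_defect r s /\ left_proper r s.
Proof.
move=> below; have [|row|] := @left_proper_or_defect r (bound + 1); [| |by right].
- move=> s rs s_lt left.
  have /proper_in_state[i1 st1] : proper (r - 1) (s - 1) by apply: below; lia.
  have /proper_in_state[i2 st2] : proper (r - 1) (s + 1) by apply: below; lia.
  rewrite -(brick_at_below rs) in st1; rewrite -(brick_at_belowS rs) in st2.
  apply: (proper_or_defect rs st1 st2); first by apply: left; lia.
  by move=> _; apply: (proper_floor_vseam rs st2); apply: below; lia.
- left=> s rs; have [s_lt|s_ge] : s < bound + 1 \/ bound + 1 <= s by lia.
    exact: row.
  by apply: proper_inactive; apply: inactive_outside; lia.
Qed.

Lemma floor_stateS r s i : floor_state (r + 1) s i = in_state r (brick_at r s) i.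
Proof. by rewrite /floor_state Z.add_simpl_r. Qed.

Lemma floorS r s i : floor (r + 1) s i = top r (brick_at r s) i.
Proof. by rewrite /floor Z.add_simpl_r. Qed.

Lemma inside_two_columns r s i y : aligned r s -> inner r s -> floor_state r s i ->
  floor r s i <= y < ceiling (r + 1) s -> inside (slot_x s) y.
Proof.
move=> rs inner_rs st y_in; have width := slot_width_bounds s.
have [active_rs active_above] : active r s /\ active (r + 1) s by case/and4P: inner_rs.
have [y_lt|y_ge] : y < ceiling r s \/ ceiling r s <= y by lia.
  by apply/(inside_zone st) => //; lia.
have [y_lt|y_top] : y < ceiling r s + t \/ ceiling r s + t <= y by lia.
  by apply/(@inside_above_ceiling r s); rewrite ?brick_at_id //; lia.
have := @layout_zone _ insideP (r + 1) s (outer r s) _ (slot_x s) y _ (outer_valid _ _).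
rewrite Z.add_simpl_r brick_at_id // floorS brick_at_id // => -> //.
- exact: outer_valid.
- by lia.
- by move: y_top y_in; rewrite /ceiling brick_at_id // /top; lia.
Qed.

Lemma defect_inner_above r s : has_defect r s -> inner (r + 1) (s - 1).
Proof.
move=> [rs inner_rs [i [st dfct]]]; apply: contrapT => /negP/negbTE outer_above.
have brickE : brick_at (r + 1) s = s - 1 by rewrite /brick_at; lia.
have width := slot_width_bounds s; have b := floor_bounds r s st.1.
have c_bounds := ceiling_bounds (r + 1) s.
have topE : floor r s i + t + (ceiling (r + 1) s - floor r s i - t) = ceiling (r + 1) s by lia.
apply: (defect_no_hseam params column_tiling dfct (u := ceiling (r + 1) s - floor r s i - t)).
- rewrite /ceiling /floor /top /bottom; have := shift_mod3 I.
  move=> shift3; have := shift3 (brick_class (r - 1) (brick_at (r - 1) s)) i.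
  have := shift3 (brick_class (r + 1) (brick_at (r + 1) s)) (outer (r + 1) (brick_at (r + 1) s)).
  by move: (shift _ _) (shift _ _) => u v; lia.
- by lia.
- by lia.
- by rewrite topE => y; apply: inside_two_columns.
- rewrite topE; apply: (hseam_outside column_tiling).
  by rewrite (@inside_above_ceiling (r + 1) s) ?brickE ?outer_above //; lia.
Qed.

Lemma defect_floor_vseam r s i i2 : aligned r s -> inner r s -> floor_state r s i ->
  defect tile (slot_x s) s (floor r s i) -> floor_state (r + 1) (s - 1) i2 ->
  vseam (slot_x s) (floor (r + 1) (s - 1) i2).
Proof.
move=> rs inner_rs st dfct st2; have width := slot_width_bounds (s - 1).
have xE : slot_x s = slot_x (s - 1) + slot_width (s - 1) by rewrite -slot_xS; congr slot_x; lia.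
have b2 := floor_bounds (r + 1) (s - 1) st2.1; have c_bounds := ceiling_bounds (r + 1) s.
have topE : floor r s i + t + (floor (r + 1) (s - 1) i2 - floor r s i - t) =
  floor (r + 1) (s - 1) i2 by lia.
rewrite -topE; apply: (defect_vseam params column_tiling dfct); rewrite ?topE.
- exact: floor_step_size rs st.1 st2.1.
- by move=> y y_in; apply: (inside_two_columns rs inner_rs st); lia.
- by apply: (floor_hseam st2); lia.
Qed.

Lemma defect_step_above r s i i2 : has_defect r s -> floor_state r s i ->
  floor_state (r + 1) (s - 1) i2 -> proper (r + 1) (s - 3) -> has_defect (r + 1) (s - 1).
Proof.
move=> hd st st2 left; have inner_above := defect_inner_above hd.
case: hd => rs inner_rs [j [st' dfct]]; rewrite (in_state_uniq st' st) in dfct.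
have rs' : aligned (r + 1) (s - 1) by lia.
split=> //; exists i2; split=> //.
have width := slot_width_bounds (s - 1).
have xE : slot_x s - slot_width (s - 1) = slot_x (s - 1).
  by rewrite -[in slot_x s](Z.sub_simpl_r s 1) slot_xS; lia.
have topE : floor r s i + t + (floor (r + 1) (s - 1) i2 - floor r s i - t) =
  floor (r + 1) (s - 1) i2 by lia.
have b := floor_bounds r s st.1; have c_bounds := ceiling_bounds (r + 1) s.
have brickE : brick_at (r + 1) s = s - 1 by rewrite /brick_at; lia.
have := defect_step params column_tiling dfct (floor_step_size rs st.1 st2.1).
cbv zeta; rewrite xE topE; apply.
- move=> y y_in; have [y_lt|y_ge] : y < ceiling (r + 1) s \/ ceiling (r + 1) s <= y by lia.
    by apply: (inside_two_columns rs inner_rs st); lia.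
  have width_s := slot_width_bounds s.
  by apply/(@inside_above_ceiling (r + 1) s); rewrite ?brickE //; lia.
- move=> x y x_in; apply: (inside_column st2); first by rewrite brick_at_id.
  by lia.
- by move=> x x_in; apply: (floor_hseam st2); lia.
- move=> y; apply: (left_wall rs' st2); rewrite (_ : s - 1 - 2 = s - 3) //; lia.
Qed.

Lemma defect_above r s : has_defect r s -> left_proper r s ->
  exists s', has_defect (r + 1) s' /\ left_proper (r + 1) s'.
Proof.
move=> hd left; have [rs inner_rs [i [st dfct]]] := hd.
have rowE : r + 1 - 1 = r by lia.
have /proper_in_state[i2 st2] : proper r (s - 2) by apply: left; lia.
have brickE : brick_at r (s - 1) = s - 2 by rewrite /brick_at; lia.
have st2' : floor_state (r + 1) (s - 1) i2 by rewrite floor_stateS brickE.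
have end_seam := defect_floor_vseam rs inner_rs st dfct st2'.
have [s' s'_rs s'_lt left'|left'|//] := @left_proper_or_defect (r + 1) (s - 1); last first.
  exists (s - 1); split=> //; apply: (defect_step_above hd st st2').
  by apply: left'; lia.
have /proper_in_state[j1 st1] : proper r (s' - 1) by apply: left; lia.
have /proper_in_state[j2 st3] : proper r (s' + 1) by apply: left; lia.
have st1' : floor_state (r + 1) s' j1 by rewrite /floor_state brick_at_below // rowE.
have st3' : floor_state (r + 1) (s' + 1) j2 by rewrite /floor_state brick_at_belowS // rowE.
apply: (proper_or_defect s'_rs st1' st3'); first by apply: left'; lia.
move=> _; have [s'E|s'_neq] : s' + 3 = s \/ s' + 3 <> s by lia.
  have s'1E : s' + 1 = s - 2 by lia.
  rewrite s'1E in st3; rewrite s'E (in_state_uniq st3 st2); congr vseam: end_seam.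
  by rewrite !floorS brickE (_ : brick_at r (s' + 1) = s - 2) // /brick_at; lia.
apply: (proper_floor_vseam s'_rs st3'); rewrite rowE.
by apply: left; lia.
Qed.

(* A defect would climb forever to the left, but the region is bounded. *)
Lemma no_defect r s : has_defect r s -> ~ left_proper r s.
Proof.
have [m r_ge] : exists m : nat, bound <= r + Z.of_nat m by exists (Z.to_nat (bound - r)); lia.
elim: m r s r_ge => [|m IH] r s r_ge hd left.
  by case: hd => _ /and4P[/active_bounded]; lia.
by have [s' [hd' left']] := defect_above hd left; apply: (IH (r + 1) s' _ hd' left'); lia.
Qed.

Lemma all_proper r s : aligned r s -> proper r s.
Proof.
have [m r_le] : exists m : nat, r <= - bound + Z.of_nat m by exists (Z.to_nat (r + bound)); lia.
elim: m r s r_le => [|m IH] r s r_le.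
  by move=> _; apply: proper_inactive; apply: inactive_outside; lia.
move: s; case: (@proper_row_or_defect r) => [s|//|[s [hd left]]].
  by apply: IH; lia.
by case: (no_defect hd left).
Qed.

End Bricks.

Section StandardTilings.
Variables (I : Z) (active : Z -> Z -> bool) (outer : Z -> Z -> Z) (rel : Z -> Z -> Z -> Z -> Prop).
Variable inside : Z -> Z -> Prop.
Implicit Types (r s x y : Z) (st : Z -> Z -> Z).

Local Notation t := (brick_height I).
Local Notation gap := (gap I).
Local Notation e := (max_shift I).
Local Notation aligned r s := ((s - r) mod 2 = 0).
Local Notation in_slot s x := (slot_x s <= x < slot_x s + slot_width s).

Hypothesis ok : states_ok I outer rel.
Hypothesis insideP : layout I active outer inside.

Local Ltac Zify.zify_post_hook ::= Z.to_euclidean_division_equations.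

Let e_gt0 : 0 < e. Proof. exact: max_shift_gt0 (states_nonempty ok). Qed.
Let gap_bound : 100 * e <= gap. Proof. exact: gap_ge (states_nonempty ok). Qed.
Let t_bound : 20 * gap <= t. Proof. exact: brick_height_ge. Qed.

Definition admissible st : Prop :=
  (forall r s, aligned r s -> valid I active outer r s (st r s)) /\
  (forall r s, active r s -> rel r s (st (r - 1) (brick_at (r - 1) s)) (st r (brick_at r s))).

Definition start st r s : Z := bottom I r (brick_at r s) (st r (brick_at r s)).

Definition standard st a b w h : Prop :=
  (exists r s, [/\ aligned r s, inner active r s &
     [/\ a = slot_x s, b = start st r s, w = brick_width s & h = t]]) \/
  (exists r s, active r s /\ [/\ a = slot_x s, b = start st (r - 1) s + t,
     w = slot_width s & h = start st r s - start st (r - 1) s - t]).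

Lemma standard_ext st st' : (forall r s, aligned r s -> st r s = st' r s) ->
  standard st = standard st'.
Proof.
move=> eq_st; rewrite /standard; have -> // : start st = start st'.
by apply/funext => r; apply/funext => s; rewrite /start eq_st //; apply: brick_at_aligned.
Qed.

Section Admissible.
Variable st : Z -> Z -> Z.
Hypothesis stP : admissible st.

Local Notation start := (start st).

Lemma start_valid r s : valid I active outer r (brick_at r s) (st r (brick_at r s)).
Proof. by apply: stP.1; apply: brick_at_aligned. Qed.

Lemma start_bounds r s : r * (t + gap) - gap <= start r s <= r * (t + gap) - gap + e.
Proof. exact: (bottom_bounds _ _ (start_valid r s).1). Qed.

Lemma start_cover s y : exists r,
  start r s <= y < start r s + t \/ start (r - 1) s + t <= y < start r s.
Proof.
pose r := (y + gap) / (t + gap).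
have r_bounds : r * (t + gap) <= y + gap < r * (t + gap) + (t + gap).
  have := Z.div_mod (y + gap) (t + gap) ltac:(lia).
  have := Z.mod_pos_bound (y + gap) (t + gap) ltac:(lia).
  by rewrite -/r; lia.
have b := start_bounds r s; have b' := start_bounds (r - 1) s; have b2 := start_bounds (r + 1) s.
have [y_lt|y_ge] : y < start r s \/ start r s <= y by lia.
  by exists r; right; lia.
have [y_lt|y_top] : y < start r s + t \/ start r s + t <= y by lia.
  by exists r; left.
by exists (r + 1); right; rewrite Z.add_simpl_r; lia.
Qed.

Lemma brick_row_uniq r r' s y :
  start r s <= y < start r s + t -> start r' s <= y < start r' s + t -> r = r'.
Proof.
have b := start_bounds r s; have b' := start_bounds r' s.
have row_lt := row_lt (states_nonempty ok).
by case: (Z.lt_trichotomy r r') => [/row_lt|[//|/row_lt]]; lia.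
Qed.

Lemma zone_row_uniq r r' s y : start (r - 1) s + t <= y < start r s ->
  start (r' - 1) s + t <= y < start r' s -> r = r'.
Proof.
have [b b'] := conj (start_bounds r s) (start_bounds r' s).
have [c c'] := conj (start_bounds (r - 1) s) (start_bounds (r' - 1) s).
have row_lt := row_lt (states_nonempty ok).
by case: (Z.lt_trichotomy r r') => [/row_lt|[//|/row_lt]]; lia.
Qed.

Lemma brick_not_zone r r' s y : start r s <= y < start r s + t ->
  ~ start (r' - 1) s + t <= y < start r' s.
Proof.
have [b b'] := conj (start_bounds r s) (start_bounds r' s); have c := start_bounds (r' - 1) s.
case: (Z.lt_trichotomy r r') => [lt_r|[->|/(row_lt (states_nonempty ok))]]; [|by lia|by lia].
have [->|/(row_lt (states_nonempty ok))] : r = r' - 1 \/ r < r' - 1 by lia.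
  by lia.
by lia.
Qed.

Variant standard_at (a b w h x y : Z) : Prop :=
| StandardBrick r s of in_slot s x & start r s <= y < start r s + t &
    inner active r (brick_at r s) & a = slot_x (brick_at r s) & b = start r s &
    w = brick_width (brick_at r s) & h = t
| StandardFiller r s of in_slot s x & start (r - 1) s + t <= y < start r s & active r s &
    a = slot_x s & b = start (r - 1) s + t & w = slot_width s &
    h = start r s - start (r - 1) s - t.

Lemma standard_tile_at a b w h x y : standard st a b w h -> in_tile a b w h x y ->
  standard_at a b w h x y.
Proof.
case=> [[r [s [rs inner_rs [-> -> -> ->]]]]|[r [s [active_rs [-> -> -> ->]]]]] [x_in y_in];
  last first.
  by apply: (@StandardFiller _ _ _ _ _ _ r s) => //; lia.
have [x_lt|x_ge] : x < slot_x (s + 1) \/ slot_x (s + 1) <= x by lia.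
  by apply: (@StandardBrick _ _ _ _ _ _ r s); rewrite ?brick_at_id // -slot_xS; lia.
have startS : start r (s + 1) = start r s by rewrite /start brick_atS // brick_at_id.
apply: (@StandardBrick _ _ _ _ _ _ r (s + 1)); rewrite ?startS ?brick_atS //.
by move: x_in; rewrite /brick_width slot_xS in x_ge *; lia.
Qed.

Lemma standard_cover x y : inside x y ->
  exists a b w h, standard st a b w h /\ in_tile a b w h x y.
Proof.
have [s x_in] := slot_exists x; have [r [y_in|y_in]] := start_cover s y.
  move/(layout_brick insideP (start_valid r s) x_in y_in) => inner_rs.
  exists (slot_x (brick_at r s)), (start r s), (brick_width (brick_at r s)), t; split.
    left; exists r, (brick_at r s); have rs := brick_at_aligned r s.
    by split=> //; split=> //; rewrite /start (brick_at_id rs).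
  by split=> //; apply: slot_in_brick.
move/(layout_zone insideP (start_valid (r - 1) s) (start_valid r s) x_in y_in) => active_rs.
exists (slot_x s), (start (r - 1) s + t), (slot_width s), (start r s - start (r - 1) s - t).
by split; [right; exists r, s | rewrite /in_tile; lia].
Qed.

Lemma standard_inside a b w h x y : standard st a b w h -> in_tile a b w h x y -> inside x y.
Proof.
move=> std /(standard_tile_at std)[r s x_in y_in inner_rs _ _ _ _|r s x_in y_in active_rs _ _ _ _].
  exact/(layout_brick insideP (start_valid r s) x_in y_in).
exact/(layout_zone insideP (start_valid (r - 1) s) (start_valid r s) x_in y_in).
Qed.

Lemma standard_uniq a b w h a' b' w' h' x y : standard st a b w h -> standard st a' b' w' h' ->
  in_tile a b w h x y -> in_tile a' b' w' h' x y -> [/\ a = a', b = b', w = w' & h = h'].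
Proof.
move=> std std' /(standard_tile_at std) tl /(standard_tile_at std').
case: tl => r s x_in y_in _ -> -> -> -> [] r' s' /(slot_uniq x_in) <- y_in' _ -> -> -> ->.
- by rewrite (brick_row_uniq y_in y_in').
- by case: (brick_not_zone y_in y_in').
- by case: (brick_not_zone y_in' y_in).
- by rewrite (zone_row_uniq y_in y_in').
Qed.

Lemma standard_size a b w h : standard st a b w h -> wall_tile I rel w h.
Proof.
case=> [[r [s [_ _ [_ _ -> ->]]]]|[r [s [active_rs [_ _ -> ->]]]]].
  by left; split=> //; exists s.
right; exists r, s, (st (r - 1) (brick_at (r - 1) s)), (st r (brick_at r s)); split=> //.
  by rewrite -bottom_sub_floor /start /floor /top; lia.
exact: stP.2.
Qed.

Lemma standard_tiling : tiling inside (wall_tile I rel) (standard st).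
Proof.
by split; [exact: standard_cover | exact: standard_inside | exact: standard_uniq |
  exact: standard_size].
Qed.

End Admissible.

Lemma standard_state_inj st st' r s : admissible st -> admissible st' ->
  (forall a b w h, standard st a b w h -> standard st' a b w h) ->
  aligned r s -> inner active r s -> st r s = st' r s.
Proof.
move=> stP st'P sub rs inner_rs; have tileT := standard_tiling st'P.
have state st1 : admissible st1 ->
    (forall a b w h, standard st1 a b w h -> standard st' a b w h) ->
    in_state I active outer (standard st') r s (st1 r s).
  move=> st1P sub1; split; first by have [] := st1P.1 r s rs.
  rewrite inner_rs; apply: sub1; left; exists r, s.
  by split=> //; split=> //; rewrite /start (brick_at_id rs).
exact: (in_state_uniq ok tileT (state _ stP sub) (state _ st'P (fun _ _ _ _ => id))).
Qed.

Lemma sub_tiling_eq (tile1 tile2 : Z -> Z -> Z -> Z -> Prop) :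
  tiling inside (wall_tile I rel) tile1 -> tiling inside (wall_tile I rel) tile2 ->
  (forall a b w h, tile1 a b w h -> tile2 a b w h) ->
  forall a b w h, tile2 a b w h -> tile1 a b w h.
Proof.
move=> tileT1 tileT2 sub a b w h tl2.
have params := column_params_wall ok.
have [w_ge h_ge] := tile_size_ge params (column_tiling ok tileT2) tl2.
have corner : in_tile a b w h a b by rewrite /in_tile; lia.
have /(tiling_cover tileT1)[a' [b' [w' [h' [tl1 corner']]]]] := tiling_inside tileT2 tl2 corner.
by have [-> -> -> ->] := tiling_uniq tileT2 tl2 (sub _ _ _ _ tl1) corner corner'.
Qed.

Section StandardForm.
Variables (bound : Z) (tile : Z -> Z -> Z -> Z -> Prop).
Hypothesis active_bounded : forall r s, active r s -> - bound < r < bound /\ - bound < s < bound.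
Hypothesis tileT : tiling inside (wall_tile I rel) tile.

Lemma brick_states_exist : exists st, forall r s, aligned r s ->
  in_state I active outer tile r s (st r s).
Proof.
have proper_rs := all_proper ok insideP tileT active_bounded.
have states (rs : Z * Z) : exists i, aligned rs.1 rs.2 -> in_state I active outer tile rs.1 rs.2 i.
  have [rs_aligned|not_aligned] := pselect (aligned rs.1 rs.2); last by exists 0.
  by have [i [st _ _]] := proper_rs _ _ rs_aligned; exists i.
by have [f fP] := choice states; exists (fun r s => f (r, s)) => r s; apply: (fP (r, s)).
Qed.

Lemma brick_states_filled st :
  (forall r s, aligned r s -> in_state I active outer tile r s (st r s)) ->
  forall r s, active r s ->
  filled I rel tile r s (st (r - 1) (brick_at (r - 1) s)) (st r (brick_at r s)).
Proof.
move=> stP r s active_rs; have proper_rs := all_proper ok insideP tileT active_bounded.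
have uniq r' s' i : in_state I active outer tile r' s' i -> aligned r' s' -> st r' s' = i.
  by move=> st_i rs'; apply: (in_state_uniq ok tileT (stP _ _ rs')).
have below_aligned := brick_at_aligned (r - 1) s.
have [rs|not_aligned] : aligned r s \/ aligned r (s - 1) by lia.
  have [i [st_i left_filled _]] := proper_rs r s rs;
    have [i' [st_i' fill]] := left_filled active_rs.
  by rewrite (uniq _ _ _ st_i') // brick_at_id // (uniq _ _ _ st_i).
have [i [st_i _]] := proper_rs r (s - 1) not_aligned; rewrite (Z.sub_simpl_r s 1).
move=> /(_ active_rs)[i' [st_i' fill]].
have -> : brick_at r s = s - 1 by rewrite -[in LHS](Z.sub_simpl_r s 1) brick_atS.
by rewrite (uniq _ _ _ st_i') // (uniq _ _ _ st_i).
Qed.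

Lemma tiling_standard : exists st, admissible st /\
  forall a b w h, tile a b w h <-> standard st a b w h.
Proof.
have [st stP] := brick_states_exist; have fillP := brick_states_filled stP.
have adm : admissible st.
  by split=> r s; [move/stP/in_state_valid | case/fillP].
have sub a b w h : standard st a b w h -> tile a b w h.
  case=> [[r [s [rs inner_rs [-> -> -> ->]]]]|[r [s [/fillP[tl _] [-> -> -> ->]]]]].
    by have [_] := stP r s rs; rewrite inner_rs /start (brick_at_id rs).
  by move: tl; rewrite -bottom_sub_floor /start /floor /top; congr tile; lia.
exists st; split=> // a b w h; split; last exact: sub.
exact: (sub_tiling_eq (standard_tiling adm) tileT sub).
Qed.

End StandardForm.
End StandardTilings.

(** * Encoding of Wang tilings *)

Section Zones.
Implicit Types r s x q j k : Z.

Local Ltac Zify.zify_post_hook ::= Z.to_euclidean_division_equations.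

Lemma mod4E x k : 0 <= k < 4 -> (4 * x + k) mod 4 = k.
Proof. by lia. Qed.

Lemma div4E x k : 0 <= k < 4 -> (4 * x + k) / 4 = x.
Proof. by lia. Qed.

Section BoundaryStates.
Variables hstate vstate : Z -> Z -> Z.

(* [hstate x q] is the state of the edge below the cell [(x, q)] and [vstate x q] that of
   the edge on its right. *)
Definition boundary_state r s : Z :=
  if (r mod 4 =? 0) && (2 <=? s mod 4) then hstate (s / 4) (r / 4)
  else if (r mod 4 =? 1) && (s mod 4 =? 3) then vstate (s / 4) (r / 4) else 1.

Lemma boundary_state_row0 q x : boundary_state (4 * q + 0) (4 * x + 0) = 1 /\
  boundary_state (4 * q + 0) (4 * x + 2) = hstate x q.
Proof. by rewrite /boundary_state !mod4E ?div4E. Qed.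

Lemma boundary_state_east q x : boundary_state (4 * q + 1) (4 * x + 3) = vstate x q /\
  boundary_state (4 * q + 3) (4 * x + 3) = 1.
Proof. by rewrite /boundary_state !mod4E ?div4E. Qed.

End BoundaryStates.

Variable inhabited : Z -> Z -> bool.

(* The block of the cell [(x, q)] consists of the slots [4 * x], ..., [4 * x + 3] and of the
   zones [4 * q + 1], ..., [4 * q + 4], each below the row of bricks of the same number. *)
Definition zone_active r s : bool := inhabited (s / 4) ((r - 1) / 4).

Lemma zone_activeE x q k j : 0 <= k < 4 -> 1 <= j <= 4 ->
  zone_active (4 * q + j) (4 * x + k) = inhabited x q.
Proof. by move=> k_in j_in; rewrite /zone_active; congr inhabited; lia. Qed.

Lemma inner_row0 q x k : k = 0 \/ k = 2 ->
  inner zone_active (4 * q + 0) (4 * x + k) = inhabited x (q - 1) && inhabited x q.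
Proof.
move=> kE; rewrite /inner -(Z.add_assoc _ _ 1) (_ : 4 * q + 0 + 1 = 4 * q + 1); last by lia.
rewrite (_ : 4 * q + 0 = 4 * (q - 1) + 4) ?zone_activeE; try lia.
by case: inhabited; case: inhabited.
Qed.

Lemma inner_block q x j k : j = 1 \/ j = 2 \/ j = 3 -> 0 <= k < 3 ->
  inner zone_active (4 * q + j) (4 * x + k) = inhabited x q.
Proof.
move=> j_in k_in; rewrite /inner -!(Z.add_assoc _ _ 1) !zone_activeE; try lia.
by case: inhabited.
Qed.

Lemma inner_east q x j : j = 1 \/ j = 3 ->
  inner zone_active (4 * q + j) (4 * x + 3) = inhabited x q && inhabited (x + 1) q.
Proof.
move=> j_in; rewrite /inner (_ : 4 * x + 3 + 1 = 4 * (x + 1) + 0); last by lia.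
rewrite -!(Z.add_assoc _ _ 1) !zone_activeE; try lia.
by case: inhabited; case: inhabited.
Qed.

End Zones.

Section WangStates.
Variables (ntiles nhcolors nvcolors : Z) (east north west south : Z -> Z).
Implicit Types r s x q j k i : Z.

Local Ltac Zify.zify_post_hook ::= Z.to_euclidean_division_equations.

Definition in_range n i : Prop := 1 <= i <= n.

(* The fillers of the rows 1 and 2 copy the tile of a cell from its central brick and tie
   it to the states of its western, eastern and southern bricks; those of the rows 3 and 0
   carry the northern color to the next row of blocks. *)
Definition wang_rel r s i' i : Prop :=
  if r mod 4 =? 1 then
    if s mod 4 =? 0 then i' = 1 /\ in_range nvcolors i
    else if s mod 4 =? 1 then i' = 1 /\ in_range ntiles i
    else if s mod 4 =? 2 then [/\ in_range nhcolors i', in_range ntiles i & south i = i']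
    else in_range nhcolors i' /\ in_range nvcolors i
  else if r mod 4 =? 2 then
    if s mod 4 =? 0 then [/\ in_range nvcolors i', in_range ntiles i & west i = i']
    else if s mod 4 =? 3 then [/\ in_range nvcolors i', in_range ntiles i & east i = i']
    else i' = i /\ in_range ntiles i
  else if r mod 4 =? 3 then
    if s mod 4 =? 0 then in_range ntiles i' /\ i = 1
    else if s mod 4 =? 3 then in_range ntiles i' /\ i = 1
    else [/\ in_range ntiles i', in_range nhcolors i & north i' = i]
  else if s mod 4 =? 0 then i' = 1 /\ i = 1
    else if s mod 4 =? 1 then in_range nhcolors i' /\ i = 1
    else if s mod 4 =? 2 then i' = i /\ in_range nhcolors i
    else i' = 1 /\ in_range nhcolors i.

Lemma wang_rel_periodic r s r' s' i' i : r mod 4 = r' mod 4 -> s mod 4 = s' mod 4 ->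
  wang_rel r s i' i -> wang_rel r' s' i' i.
Proof. by rewrite /wang_rel => -> ->. Qed.

Lemma wang_rel_range I r s i' i : 1 <= I -> ntiles <= I -> nhcolors <= I -> nvcolors <= I ->
  wang_rel r s i' i -> 1 <= i' <= I /\ 1 <= i <= I.
Proof.
rewrite /wang_rel /in_range => I_ge1 ntiles_le nhcolors_le nvcolors_le.
by do ![case: ifP => _]; case; lia.
Qed.

Section StatesOk.
Variables (I : Z) (hstate vstate : Z -> Z -> Z).
Hypothesis hstate_range : forall x q, in_range nhcolors (hstate x q).
Hypothesis vstate_range : forall x q, in_range nvcolors (vstate x q).
Hypotheses (I_ge1 : 1 <= I) (ntiles_le : ntiles <= I) (nhcolors_le : nhcolors <= I)
  (nvcolors_le : nvcolors <= I).

Lemma wang_states_ok : states_ok I (boundary_state hstate vstate) wang_rel.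
Proof.
split=> // [r s|r s i' i|]; [|exact: wang_rel_range|exact: wang_rel_periodic].
rewrite /boundary_state; case: ifP => _.
  by have := hstate_range (s / 4) (r / 4); rewrite /in_range; lia.
by case: ifP => _; first have := vstate_range (s / 4) (r / 4); rewrite /in_range; lia.
Qed.

End StatesOk.

Variables (inhabited : Z -> Z -> bool) (hstate vstate : Z -> Z -> Z).

Local Notation active := (zone_active inhabited).
Local Notation outer := (boundary_state hstate vstate).

Definition matching (tau : Z -> Z -> Z) : Prop := forall x q, inhabited x q ->
  [/\ in_range ntiles (tau x q),
      east (tau x q) = (if inhabited (x + 1) q then west (tau (x + 1) q) else vstate x q),
      north (tau x q) = (if inhabited x (q + 1) then south (tau x (q + 1)) else hstate x (q + 1)),
      inhabited (x - 1) q = false -> west (tau x q) = vstate (x - 1) q &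
      inhabited x (q - 1) = false -> south (tau x q) = hstate x q].

Definition wang_state (tau : Z -> Z -> Z) r s : Z :=
  if inner active r s then
    if r mod 4 =? 0 then if s mod 4 =? 0 then 1 else north (tau (s / 4) (r / 4 - 1))
    else if r mod 4 =? 1 then
      if s mod 4 =? 1 then tau (s / 4) (r / 4) else east (tau (s / 4) (r / 4))
    else if r mod 4 =? 2 then tau (s / 4) (r / 4)
    else if s mod 4 =? 1 then north (tau (s / 4) (r / 4)) else 1
  else outer r s.

Section Ranges.
Hypothesis east_range : forall i, in_range ntiles i -> in_range nvcolors (east i).
Hypothesis north_range : forall i, in_range ntiles i -> in_range nhcolors (north i).
Hypothesis west_range : forall i, in_range ntiles i -> in_range nvcolors (west i).
Hypothesis south_range : forall i, in_range ntiles i -> in_range nhcolors (south i).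
Hypothesis hstate_range : forall x q, in_range nhcolors (hstate x q).
Hypothesis vstate_range : forall x q, in_range nvcolors (vstate x q).
Variable I : Z.
Hypotheses (I_ge1 : 1 <= I) (ntiles_le : ntiles <= I) (nhcolors_le : nhcolors <= I)
  (nvcolors_le : nvcolors <= I).

(* The states of the bricks around the block of the cell [(x, q)] that are forced by its
   central brick. *)
Record block_states (st : Z -> Z -> Z) x q (around := fun j k => st (4 * q + j) (4 * x + k))
    (i := around 1 1) : Prop := BlockStates {
  block_tile : in_range ntiles i;
  block_south : around 0 2 = south i;
  block_west : around 1 (-1) = west i;
  block_east : around 1 3 = east i;
  block_copy0 : around 2 0 = i;
  block_copy2 : around 2 2 = i;
  block_north3 : around 3 1 = north i;
  block_north : around 4 2 = north i;
  block_unit : [/\ around 0 0 = 1, around 3 (-1) = 1, around 3 3 = 1 & around 4 0 = 1] }.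

Lemma zone_rel_blocks (st : Z -> Z -> Z) :
  (forall r s, active r s ->
     wang_rel r s (st (r - 1) (brick_at (r - 1) s)) (st r (brick_at r s))) <->
  (forall x q j k, inhabited x q -> 1 <= j <= 4 -> 0 <= k < 4 -> wang_rel j k
     (st (4 * q + (j - 1)) (4 * x + brick_at (j - 1) k)) (st (4 * q + j) (4 * x + brick_at j k))).
Proof.
have brickE x q j k : brick_at (4 * q + j) (4 * x + k) = 4 * x + brick_at j k.
  by rewrite /brick_at; lia.
split=> [relP x q j k xq j_in k_in|relP r s rs].
  have := relP (4 * q + j) (4 * x + k); rewrite zone_activeE // => /(_ xq).
  by rewrite -Z.add_sub_assoc !brickE; apply: wang_rel_periodic; lia.
have [x [k [sE k_in]]] : exists x k, s = 4 * x + k /\ 0 <= k < 4.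
  by exists (s / 4), (s mod 4); lia.
have [q [j [rE j_in]]] : exists q j, r = 4 * q + j /\ 1 <= j <= 4.
  by exists ((r - 1) / 4), ((r - 1) mod 4 + 1); lia.
move: rs; rewrite sE rE zone_activeE // => /relP/(_ j_in k_in).
by rewrite -Z.add_sub_assoc !brickE; apply: wang_rel_periodic; lia.
Qed.

Lemma block_states_rel st x q j k : block_states st x q -> 1 <= j <= 4 -> 0 <= k < 4 ->
  wang_rel j k (st (4 * q + (j - 1)) (4 * x + brick_at (j - 1) k))
               (st (4 * q + j) (4 * x + brick_at j k)).
Proof.
case; set i := st _ _ => i_in southE westE eastE copy0 copy2 north3 northE
  [unit0 unit3 unit3' unit4].
have centerE : st (4 * q + 1) (4 * x + 1) = i by [].
have [i_east i_north] := conj (east_range i_in) (north_range i_in).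
have [i_west i_south] := conj (west_range i_in) (south_range i_in).
move=> j_in k_in; have jE : j = 1 \/ j = 2 \/ j = 3 \/ j = 4 by lia.
have kE : k = 0 \/ k = 1 \/ k = 2 \/ k = 3 by lia.
case: jE => [->|[->|[->|->]]]; case: kE => [->|[->|[->|->]]].
all: rewrite ![brick_at _ _]/= ![(_ - _)%Z]/=.
all: rewrite ?southE ?westE ?eastE ?copy0 ?copy2 ?north3 ?northE ?unit0 ?unit3 ?unit3' ?unit4
  ?centerE.
all: by rewrite /wang_rel /=; split.
Qed.

Lemma rel_block_states st x q :
  (forall j k, 1 <= j <= 4 -> 0 <= k < 4 -> wang_rel j k
     (st (4 * q + (j - 1)) (4 * x + brick_at (j - 1) k)) (st (4 * q + j) (4 * x + brick_at j k))) ->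
  block_states st x q.
Proof.
move=> relP; have rel_at j k j' b' b : 1 <= j <= 4 -> 0 <= k < 4 -> j' = j - 1 ->
    b' = brick_at (j - 1) k -> b = brick_at j k ->
    wang_rel j k (st (4 * q + j') (4 * x + b')) (st (4 * q + j) (4 * x + b)).
  by move=> j_in k_in -> -> ->; apply: relP.
have [unit0 i_in] := rel_at 1 1 0 0 1 ltac:(lia) ltac:(lia) erefl erefl erefl.
have [_ _ southE] := rel_at 1 2 0 2 1 ltac:(lia) ltac:(lia) erefl erefl erefl.
have [copy0 _] := rel_at 2 1 1 1 0 ltac:(lia) ltac:(lia) erefl erefl erefl.
have [copy2 _] := rel_at 2 2 1 1 2 ltac:(lia) ltac:(lia) erefl erefl erefl.
have [_ _ westE] := rel_at 2 0 1 (-1) 0 ltac:(lia) ltac:(lia) erefl erefl erefl.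
have [_ _ eastE] := rel_at 2 3 1 3 2 ltac:(lia) ltac:(lia) erefl erefl erefl.
have [_ _ north3] := rel_at 3 1 2 0 1 ltac:(lia) ltac:(lia) erefl erefl erefl.
have [_ unit3] := rel_at 3 0 2 0 (-1) ltac:(lia) ltac:(lia) erefl erefl erefl.
have [_ unit3'] := rel_at 3 3 2 2 3 ltac:(lia) ltac:(lia) erefl erefl erefl.
have [_ unit4] := rel_at 4 1 3 1 0 ltac:(lia) ltac:(lia) erefl erefl erefl.
have [northE _] := rel_at 4 2 3 1 2 ltac:(lia) ltac:(lia) erefl erefl erefl.
rewrite -copy0 in westE north3; rewrite -copy2 in eastE.
by split; rewrite // -northE -north3.
Qed.

Section Values.
Variables (tau : Z -> Z -> Z) (x q : Z).

Local Notation state := (wang_state tau).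

Lemma wang_state00 : state (4 * q + 0) (4 * x + 0) = 1.
Proof. by rewrite /wang_state !mod4E //= (boundary_state_row0 _ _ _ _).1 if_same. Qed.

Lemma wang_state02 : state (4 * q + 0) (4 * x + 2) =
  if inhabited x (q - 1) && inhabited x q then north (tau x (q - 1)) else hstate x q.
Proof.
rewrite /wang_state !mod4E ?div4E //= (boundary_state_row0 _ _ _ _).2 inner_row0 //.
by right.
Qed.

Lemma wang_state11 : inhabited x q -> state (4 * q + 1) (4 * x + 1) = tau x q.
Proof. by move=> xq; rewrite /wang_state inner_block ?xq ?mod4E ?div4E //; lia. Qed.

Lemma wang_state13 : state (4 * q + 1) (4 * x + 3) =
  if inhabited x q && inhabited (x + 1) q then east (tau x q) else vstate x q.
Proof.
rewrite /wang_state !mod4E ?div4E //= (boundary_state_east _ _ _ _).1 inner_east //.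
by left.
Qed.

Lemma wang_state2 k : k = 0 \/ k = 2 -> inhabited x q -> state (4 * q + 2) (4 * x + k) = tau x q.
Proof. by move=> kE xq; rewrite /wang_state inner_block ?xq ?mod4E ?div4E //; lia. Qed.

Lemma wang_state31 : inhabited x q -> state (4 * q + 3) (4 * x + 1) = north (tau x q).
Proof. by move=> xq; rewrite /wang_state inner_block ?xq ?mod4E ?div4E //; lia. Qed.

Lemma wang_state33 : state (4 * q + 3) (4 * x + 3) = 1.
Proof. by rewrite /wang_state !mod4E //= (boundary_state_east _ _ _ _).2 if_same. Qed.

End Values.

Lemma block_states_wang_state tau x q : matching tau -> inhabited x q ->
  block_states (wang_state tau) x q.
Proof.
move=> tauP xq; have [range eastE northE westE southE] := tauP x q xq.
have prev k j : 4 * k + -1 = 4 * (k - 1) + 3 /\ 4 * j + 4 = 4 * (j + 1) + 0 by lia.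
split; rewrite ?wang_state11 ?wang_state2 ?wang_state31 //; try by [left | right].
- rewrite wang_state02 xq andbT; case: ifP => [xq'|/southE//].
  by have [_ _ -> _ _] := tauP _ _ xq'; rewrite Z.sub_add xq.
- rewrite (prev x q).1 wang_state13 Z.sub_add xq andbT; case: ifP => [xq'|/westE//].
  by have [_ -> _ _ _] := tauP _ _ xq'; rewrite Z.sub_add xq.
- by rewrite wang_state13 xq; case: ifP eastE => [_|_ ->].
- rewrite (prev x q).2 wang_state02 Z.add_simpl_r xq.
  by case: ifP northE => [_|_ ->].
- split; rewrite ?(prev x q).1 ?(prev x q).2 ?wang_state00 ?wang_state33 //.
Qed.

Lemma wang_state_valid tau r s : matching tau -> valid I active outer r s (wang_state tau r s).
Proof.
move=> tauP; split; last by rewrite /wang_state => ->.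
rewrite /wang_state; case: ifP => [/and4P[below _ above _]|_]; last first.
  apply: outer_range.
  exact: wang_states_ok hstate_range vstate_range I_ge1 ntiles_le nhcolors_le nvcolors_le.
have above_cell : inhabited (s / 4) (r / 4).
  by move: above; rewrite /zone_active; congr (is_true (inhabited _ _)); lia.
have [range _ _ _ _] := tauP _ _ above_cell.
have [east_in north_in] := conj (east_range range) (north_range range).
case: Z.eqb_spec => r0.
  have below_cell : inhabited (s / 4) (r / 4 - 1).
    by move: below; rewrite /zone_active; congr (is_true (inhabited _ _)); lia.
  have [/north_range below_in _ _ _ _] := tauP _ _ below_cell.
  by case: ifP => _; move: below_in; rewrite /in_range; lia.
by move: range east_in north_in; rewrite /in_range; do ![case: ifP => _]; lia.
Qed.

Lemma wang_state_admissible tau : matching tau ->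
  admissible I active outer wang_rel (wang_state tau).
Proof.
move=> tauP; split=> [r s _|]; first exact: wang_state_valid.
apply/zone_rel_blocks => x q j k xq; apply: block_states_rel.
exact: block_states_wang_state.
Qed.

Section StatesMatch.
Variable st : Z -> Z -> Z.
Hypothesis stP : admissible I active outer wang_rel st.
Let tau x q := st (4 * q + 1) (4 * x + 1).

Lemma admissible_block_states x q : inhabited x q -> block_states st x q.
Proof.
by move=> xq; apply: rel_block_states => j k; have /zone_rel_blocks := stP.2; apply.
Qed.

Lemma admissible_outer r s : (s - r) mod 2 = 0 -> inner active r s = false -> st r s = outer r s.
Proof. by move=> rs out; have [_ ->] := stP.1 r s rs. Qed.

Lemma admissible_hstate x q : inhabited x (q - 1) && inhabited x q = false ->
  st (4 * q + 0) (4 * x + 2) = hstate x q.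
Proof.
move=> out; rewrite admissible_outer ?(boundary_state_row0 _ _ _ _).2 //; first by lia.
by rewrite inner_row0 //; right.
Qed.

Lemma admissible_vstate x q : inhabited x q && inhabited (x + 1) q = false ->
  st (4 * q + 1) (4 * x + 3) = vstate x q.
Proof.
move=> out; rewrite admissible_outer ?(boundary_state_east _ _ _ _).1 //; first by lia.
by rewrite inner_east //; left.
Qed.

Lemma admissible_matching : matching tau.
Proof.
have prev k j : 4 * k + -1 = 4 * (k - 1) + 3 /\ 4 * j + 4 = 4 * (j + 1) + 0 by lia.
move=> x q xq; have := admissible_block_states xq; rewrite /tau.
case=> range southE westE eastE _ _ _ northE _; split=> //.
- rewrite -eastE; case: ifP => xq'; last by rewrite admissible_vstate // xq' andbF.
  by have [_ _ <- _ _ _ _ _ _] := admissible_block_states xq'; rewrite (prev _ 0).1 Z.add_simpl_r.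
- rewrite -northE (prev 0 q).2; case: ifP => xq'; last by rewrite admissible_hstate // xq' andbF.
  by have [_ <- _ _ _ _ _ _ _] := admissible_block_states xq'.
- by move=> out; rewrite -westE (prev x 0).1 admissible_vstate ?out.
- by move=> out; rewrite -southE admissible_hstate ?out.
Qed.

Lemma admissible_wang_state r s : (s - r) mod 2 = 0 -> st r s = wang_state tau r s.
Proof.
have next j : 4 * j + 0 = 4 * (j - 1) + 4 by lia.
have [x [k [-> k_in]]] : exists x k, s = 4 * x + k /\ (k = 0 \/ k = 1 \/ k = 2 \/ k = 3).
  by exists (s / 4), (s mod 4); lia.
have [q [j [-> j_in]]] : exists q j, r = 4 * q + j /\ (j = 0 \/ j = 1 \/ j = 2 \/ j = 3).
  by exists (r / 4), (r mod 4); lia.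
case inner_rs: (inner active (4 * q + j) (4 * x + k)) => rs; last first.
  by rewrite /wang_state inner_rs; apply: admissible_outer.
case: j_in inner_rs rs => [->|[->|[->|->]]]; case: k_in => [->|[->|[->|->]]] inner_rs rs; try lia.
- move: inner_rs; rewrite wang_state00 inner_row0; last by left.
  by case/andP=> _ /admissible_block_states[_ _ _ _ _ _ _ _ [->]].
- move: inner_rs; rewrite wang_state02 inner_row0; last by right.
  move=> xq; rewrite xq; case/andP: xq => /admissible_block_states[_ _ _ _ _ _ _ northE _] _.
  by rewrite next northE.
- by move: inner_rs; rewrite inner_block; [move/wang_state11-> | left | lia].
- move: inner_rs; rewrite wang_state13 inner_east; last by left.
  by move=> xq; rewrite xq; case/andP: xq => /admissible_block_states[_ _ _ -> _ _ _ _ _] _.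
- move: inner_rs; rewrite inner_block; [move=> xq | by right; left | by lia].
  by rewrite wang_state2 //; [have [_ _ _ _ -> _ _ _ _] := admissible_block_states xq | left].
- move: inner_rs; rewrite inner_block; [move=> xq | by right; left | by lia].
  by rewrite wang_state2 //; [have [_ _ _ _ _ -> _ _ _] := admissible_block_states xq | right].
- move: inner_rs; rewrite inner_block; [move=> xq | by right; right | by lia].
  by rewrite wang_state31 //; have [_ _ _ _ _ _ -> _ _] := admissible_block_states xq.
- move: inner_rs; rewrite wang_state33 inner_east; last by right.
  by case/andP=> /admissible_block_states[_ _ _ _ _ _ _ _ [_ _ ->]].
Qed.

End StatesMatch.
End Ranges.

Section MatchingExtensional.
Variables (tau tau' : Z -> Z -> Z).
Hypothesis eq_tau : forall x q, inhabited x q -> tau x q = tau' x q.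

Lemma matching_ext : matching tau' -> matching tau.
Proof.
move=> tauP x q xq; have [range eastE northE westE southE] := tauP x q xq.
rewrite eq_tau //; split=> //.
- by rewrite eastE; case: ifP => // xq'; rewrite eq_tau.
- by rewrite northE; case: ifP => // xq'; rewrite eq_tau.
Qed.

Lemma wang_state_ext r s : wang_state tau r s = wang_state tau' r s.
Proof.
rewrite /wang_state; case: ifP => // /and4P[below _ above _]; rewrite /zone_active in below above.
case: Z.eqb_spec => r0.
  by rewrite eq_tau //; have -> : r / 4 - 1 = (r - 1) / 4 by lia.
rewrite !eq_tau //; move: above; by congr (is_true (inhabited _ _)); lia.
Qed.

End MatchingExtensional.
End WangStates.

Section Layout.
Variable I : Z.
Implicit Types r s x y b c q i j : Z.

Local Notation t := (brick_height I).
Local Notation gap := (gap I).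
Local Notation e := (max_shift I).
Local Notation bottom := (bottom I).
Local Notation top := (top I).
Local Notation aligned r s := ((s - r) mod 2 = 0).

Local Ltac Zify.zify_post_hook ::= Z.to_euclidean_division_equations.

Definition block_height : Z := 4 * (t + gap).

Definition brick_covers r b i x y : Prop :=
  slot_x b <= x < slot_x b + brick_width b /\ bottom r b i <= y < top r b i.

Hypothesis I_ge1 : 1 <= I.

Let e_gt0 : 0 < e. Proof. exact: max_shift_gt0. Qed.
Let gap_bound : 100 * e <= gap. Proof. exact: gap_ge. Qed.
Let t_bound : 20 * gap <= t. Proof. exact: brick_height_ge. Qed.

Lemma block_height_div r y : r * (t + gap) <= y < r * (t + gap) + (t + gap) ->
  y / block_height = r / 4.
Proof.
move=> y_in; rewrite /block_height Z.mul_comm -Z.div_div; try lia.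
congr (_ / 4); apply/esym/(Z.div_unique _ _ _ (y - r * (t + gap))); last by ring.
by left; lia.
Qed.

Lemma brick_row_bounds r b i y : 1 <= i <= I -> bottom r b i <= y < top r b i ->
  r * (t + gap) - gap <= y < r * (t + gap) + t - gap + e.
Proof. by move=> /(bottom_bounds r b); rewrite /top; lia. Qed.

Lemma brick_row_lt r r' b b' i i' y y' : 1 <= i <= I -> 1 <= i' <= I -> r < r' ->
  bottom r b i <= y < top r b i -> bottom r' b' i' <= y' -> y + (gap - e) <= y'.
Proof.
move=> i_in i'_in /(row_lt I_ge1) lt_r /(brick_row_bounds i_in) y_in y'_ge.
by have := bottom_bounds r' b' i'_in; lia.
Qed.

Variables (inhabited : Z -> Z -> bool) (hstate vstate : Z -> Z -> Z).

Local Notation active := (zone_active inhabited).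
Local Notation outer := (boundary_state hstate vstate).

Hypothesis outer_in : forall r s, 1 <= outer r s <= I.

(* The region consists of the blocks of the cells, without the bricks that do not lie
   completely in such blocks; these are put in the states of the boundary. *)
Definition carved_inside x y : Prop := inhabited (x / 40) (y / block_height) /\
  forall r b, aligned r b -> inner active r b = false -> ~ brick_covers r b (outer r b) x y.

Lemma carved_layout_brick r s i x y : valid I active outer r (brick_at r s) i ->
  slot_x s <= x < slot_x s + slot_width s ->
  bottom r (brick_at r s) i <= y < top r (brick_at r s) i ->
  carved_inside x y <-> inner active r (brick_at r s).
Proof.
move=> [i_in iE] x_in y_in; have x_in_b := slot_in_brick r x_in.
have rb := brick_at_aligned r s; split=> [[_ uncovered]|inner_rb].
  apply: contrapT => /negP/negbTE out; apply: (uncovered r (brick_at r s)) => //.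
  by split=> //; rewrite -iE.
split=> [|r' b rb' out [x_in_b' y_in']]; last first.
  have rE : r' = r.
    case: (Z.lt_trichotomy r r') => [lt_r|[//|lt_r]].
      by have := brick_row_lt i_in (outer_in r' b) lt_r y_in y_in'.1; lia.
    by have := brick_row_lt (outer_in r' b) i_in lt_r y_in' y_in.1; lia.
  by move: out; rewrite rE in rb' *; rewrite -(brick_at_uniq rb' x_in x_in_b') inner_rb.
have [] := inner_active inner_rb; rewrite /zone_active Z.add_simpl_r (slot_div4 x_in).
have y_bounds := brick_row_bounds i_in y_in.
have [y_lt|y_ge] : y < r * (t + gap) \/ r * (t + gap) <= y by lia.
  by rewrite (block_height_div (r := r - 1)) //; lia.
by rewrite (block_height_div (r := r)) //; lia.
Qed.

Lemma carved_layout_zone r s i' i x y :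
  valid I active outer (r - 1) (brick_at (r - 1) s) i' ->
  valid I active outer r (brick_at r s) i -> slot_x s <= x < slot_x s + slot_width s ->
  floor I r s i' <= y < bottom r (brick_at r s) i -> carved_inside x y <-> active r s.
Proof.
move=> [i'_in i'E] [i_in iE] x_in y_in.
have y_bounds : (r - 1) * (t + gap) + (t - gap) <= y < r * (t + gap) - gap + e.
  have low := floor_bounds r s i'_in; have high := bottom_bounds r (brick_at r s) i_in.
  by split; lia.
have -> : active r s = inhabited (x / 40) (y / block_height).
  by rewrite /zone_active (slot_div4 x_in) (block_height_div (r := r - 1)) //; lia.
split=> [[]//|inhab]; split=> // r' b rb out [x_in_b y_in'].
have y_in_r' := brick_row_bounds (outer_in r' b) y_in'.
have bE := brick_at_uniq rb x_in x_in_b.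
have [rE|[rE|[/(row_lt I_ge1) lt_r|/(row_lt I_ge1) lt_r]]] :
    r' = r \/ r' = r - 1 \/ r < r' \/ r' < r - 1 by lia.
- by move: y_in y_in'; rewrite rE in bE out *; rewrite iE ?bE //; lia.
- move: y_in y_in'; rewrite rE in bE out *; rewrite /floor i'E ?bE //; lia.
- by lia.
- by lia.
Qed.

Lemma carved_layout : layout I active outer carved_inside.
Proof. by split; [exact: carved_layout_brick | exact: carved_layout_zone]. Qed.

End Layout.

Section Notches.
Variable I : Z.
Implicit Types (k : side * bool) (c q i j : Z).

Local Notation t := (brick_height I).
Local Notation gap := (gap I).
Local Notation e := (max_shift I).

Local Ltac Zify.zify_post_hook ::= Z.to_euclidean_division_equations.

(* On each side of a block there are two bricks that may stick out of it, and that are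
   cut off along the boundary: those of the rows 0 and 4 on the southern and on the
   northern side, those of the rows 1 and 3 on the other sides. *)
Definition notch_row k : Z :=
  match k.1 with South => 0 | North => 4 | East | West => if k.2 then 3 else 1 end.

Definition notch_slot k : Z :=
  match k.1 with South | North => if k.2 then 2 else 0 | East => 3 | West => -1 end.

(* Only one of the two bricks represents the color of the edge. *)
Definition notch_colored k : bool :=
  match k.1 with South | North => k.2 | East | West => ~~ k.2 end.

Definition notch_state k c : Z := if notch_colored k then c else 1.

Definition notch_bottom k c : Z := bottom I (notch_row k) (notch_slot k) (notch_state k c).

Definition in_notch k c i j : bool :=
  [&& slot_x (notch_slot k) <=? i, i <? slot_x (notch_slot k) + brick_width (notch_slot k),
      notch_bottom k c <=? j & j <? notch_bottom k c + t].

Lemma in_notchP k c i j : in_notch k c i j <->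
  brick_covers I (notch_row k) (notch_slot k) (notch_state k c) i j.
Proof.
rewrite /in_notch /brick_covers -/(notch_bottom k c) /top -/(notch_bottom k c).
split=> [/and4P[/Z.leb_le ? /Z.ltb_lt ? /Z.leb_le ? /Z.ltb_lt ?] //|[[? ?] [? ?]]].
by apply/and4P; split; [apply/Z.leb_le | apply/Z.ltb_lt | apply/Z.leb_le | apply/Z.ltb_lt].
Qed.

Lemma brick_covers_periodic q c r s st i j :
  brick_covers I (4 * q + r) (4 * c + s) st (40 * c + i) (q * block_height I + j) <->
  brick_covers I r s st i j.
Proof.
have bottomE : bottom I (4 * q + r) (4 * c + s) st = q * block_height I + bottom I r s st.
  have classE : brick_class (4 * q + r) (4 * c + s) = brick_class r s by rewrite /brick_class; lia.
  by rewrite /bottom classE /block_height; lia.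
rewrite /brick_covers /top bottomE slot_x_periodic brick_width_periodic; lia.
Qed.

Variables (inhabited : Z -> Z -> bool) (hstate vstate : Z -> Z -> Z).

Local Notation active := (zone_active inhabited).
Local Notation outer := (boundary_state hstate vstate).

Definition edge_state (s : side) c q : Z :=
  match s with
  | East => vstate c q | North => hstate c (q + 1) | West => vstate (c - 1) q | South => hstate c q
  end.

Definition inhabited_beyond (s : side) c q : bool :=
  match s with
  | East => inhabited (c + 1) q | North => inhabited c (q + 1)
  | West => inhabited (c - 1) q | South => inhabited c (q - 1)
  end.

Lemma inner_notch k c q : inhabited c q ->
  inner active (4 * q + notch_row k) (4 * c + notch_slot k) = inhabited_beyond k.1 c q.
Proof.
move=> cq; case: k => -[] b; rewrite /notch_row /notch_slot /inhabited_beyond.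
- by case: b; rewrite inner_east ?cq //; [right | left].
- rewrite (_ : 4 * q + 4 = 4 * (q + 1) + 0); last by lia.
  by case: b; rewrite inner_row0 ?Z.add_simpl_r ?cq //; [right | left].
- rewrite (_ : 4 * c + -1 = 4 * (c - 1) + 3); last by lia.
  by case: b; rewrite inner_east ?Z.sub_add ?cq ?andbT //; [right | left].
- by case: b; rewrite inner_row0 ?cq ?andbT //; [right | left].
Qed.

Lemma boundary_state_notch k c q :
  outer (4 * q + notch_row k) (4 * c + notch_slot k) = notch_state k (edge_state k.1 c q).
Proof.
have [row0 row0_color] := boundary_state_row0 hstate vstate q c.
have [row4 row4_color] := boundary_state_row0 hstate vstate (q + 1) c.
have [east1 east3] := boundary_state_east hstate vstate q c.
have [west1 west3] := boundary_state_east hstate vstate q (c - 1).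
have prev : 4 * c + -1 = 4 * (c - 1) + 3 by lia.
have next : 4 * q + 4 = 4 * (q + 1) + 0 by lia.
by case: k => -[] []; rewrite /notch_row /notch_slot /notch_state /= ?prev ?next.
Qed.

Hypothesis I_ge1 : 1 <= I.
Hypothesis outer_in : forall r s, 1 <= outer r s <= I.

Lemma outer_brick_notch r b c q i j : inhabited c q -> 0 <= i < 40 -> 0 <= j < block_height I ->
  (b - r) mod 2 = 0 -> inner active r b = false ->
  brick_covers I r b (outer r b) (40 * c + i) (q * block_height I + j) ->
  exists k, r = 4 * q + notch_row k /\ b = 4 * c + notch_slot k.
Proof.
move=> cq i_in j_in rb out [x_in y_in].
have [e_gt0 gap_e] := conj (max_shift_gt0 I_ge1) (gap_ge I_ge1).
have t_gap := @brick_height_ge I; have r_in : 4 * q <= r <= 4 * q + 4.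
  have := brick_row_bounds (outer_in r b) y_in; rewrite /block_height in j_in * => y_bounds.
  have [gt_r|[//|lt_r]] : 4 * q + 4 < r \/ 4 * q <= r <= 4 * q + 4 \/ r < 4 * q by lia.
    by have := row_lt I_ge1 gt_r; lia.
  by have := row_lt I_ge1 lt_r; lia.
have b_in : 4 * c - 1 <= b <= 4 * c + 3.
  by move: x_in; rewrite /brick_width Z.add_assoc -!slot_xS /slot_x; repeat case: Z.eqb_spec => ?;
    lia.
have [r' [rE r'_in]] :
    exists r', r = 4 * q + r' /\ (r' = 0 \/ r' = 1 \/ r' = 2 \/ r' = 3 \/ r' = 4).
  by exists (r - 4 * q); lia.
have [b' [bE b'_in]] :
    exists b', b = 4 * c + b' /\ (b' = -1 \/ b' = 0 \/ b' = 1 \/ b' = 2 \/ b' = 3).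
  by exists (b - 4 * c); lia.
rewrite rE bE in rb out *.
case: r'_in rb out => [->|[->|[->|[->|->]]]]; case: b'_in => [->|[->|[->|[->|->]]]] rb out; try lia.
- by exists (South, false).
- by exists (South, true).
- by exists (West, false).
- by move: out; rewrite inner_block ?cq //; lia.
- by exists (East, false).
- by move: out; rewrite inner_block ?cq //; lia.
- by move: out; rewrite inner_block ?cq //; lia.
- by exists (West, true).
- by move: out; rewrite inner_block ?cq //; lia.
- by exists (East, true).
- by exists (North, false).
- by exists (North, true).
Qed.

Lemma carved_inside_block c q i j : 0 <= i < 40 -> 0 <= j < block_height I ->
  carved_inside I inhabited hstate vstate (40 * c + i) (q * block_height I + j) <->
  inhabited c q /\ forall k, inhabited_beyond k.1 c q = false ->
    ~ in_notch k (edge_state k.1 c q) i j.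
Proof.
move=> i_in j_in; rewrite /carved_inside.
have -> : (40 * c + i) / 40 = c by lia.
have -> : (q * block_height I + j) / block_height I = q.
  by apply/esym/(Z.div_unique _ _ _ j); lia.
split=> -[cq uncovered]; split=> //.
- move=> k out; rewrite in_notchP -(brick_covers_periodic q c) -boundary_state_notch.
  apply: uncovered; last by rewrite inner_notch.
  have : notch_slot k mod 2 = notch_row k mod 2 by case: (k) => -[] [].
  by lia.
- move=> r b rb out covered; have [k [rE bE]] := outer_brick_notch cq i_in j_in rb out covered.
  rewrite rE bE in out covered; rewrite inner_notch // in out.
  apply: (uncovered k out); apply/in_notchP/(brick_covers_periodic q c).
  by rewrite -boundary_state_notch.
Qed.

End Notches.

(** * The reduction *)

Local Notation toZ := ssrZ.Z_of_int.
Local Notation toI := ssrZ.int_of_Z.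

Section RectTilings.
Variables (F : {fset cell}) (R : {fset rect}) (size : Z -> Z -> Prop).
Implicit Types (T : {fset placement}) (P Q : placement) (tile : Z -> Z -> Z -> Z -> Prop).

Hypothesis R_size : forall w h : nat, ((w, h) : rect) \in R <-> size (Z.of_nat w) (Z.of_nat h).
Hypothesis size_gt0 : forall w h, size w h -> 0 < w /\ 0 < h.

Definition inside_region x y : Prop := ((toI x, toI y) : cell) \in F.

Definition tile_at tile P : Prop :=
  tile (toZ P.1.1) (toZ P.1.2) (Z.of_nat P.2.1) (Z.of_nat P.2.2).

Definition placed T a b w h : Prop := exists2 P : placement, P \in T &
  [/\ a = toZ P.1.1, b = toZ P.1.2, w = Z.of_nat P.2.1 & h = Z.of_nat P.2.2].

Lemma mem_placed_cells P x y : ((toI x, toI y) : cell) \in placed_cells P <->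
  in_tile (toZ P.1.1) (toZ P.1.2) (Z.of_nat P.2.1) (Z.of_nat P.2.2) x y.
Proof.
case: P => [[a b] [w h]]; rewrite /placed_cells /in_tile /=; split.
  case/imfset2P => i /=; rewrite mem_iota => i_w [j /=]; rewrite mem_iota => j_h [xE yE].
  by lia.
move=> [x_in y_in]; apply/imfset2P; exists (Z.to_nat (x - toZ a));
  first by rewrite /= mem_iota; lia.
exists (Z.to_nat (y - toZ b)); first by rewrite /= mem_iota; lia.
by rewrite /=; congr pair; lia.
Qed.

Lemma mem_placed_cells_int P (c : cell) : c \in placed_cells P <->
  in_tile (toZ P.1.1) (toZ P.1.2) (Z.of_nat P.2.1) (Z.of_nat P.2.2) (toZ c.1) (toZ c.2).
Proof. by rewrite -mem_placed_cells !ssrZ.Z_of_intK -surjective_pairing. Qed.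

Lemma placement_inj P Q : toZ P.1.1 = toZ Q.1.1 -> toZ P.1.2 = toZ Q.1.2 ->
  Z.of_nat P.2.1 = Z.of_nat Q.2.1 -> Z.of_nat P.2.2 = Z.of_nat Q.2.2 -> P = Q.
Proof.
case: P => [[a b] [w h]]; case: Q => [[a' b'] [w' h']] /= aE bE wE hE.
by congr (_, _, (_, _)); lia.
Qed.

Lemma placedP T P : tile_at (placed T) P <-> P \in T.
Proof.
split=> [[Q QT [aE bE wE hE]]|PT]; last by exists P.
by rewrite (placement_inj aE bE wE hE).
Qed.

Lemma rect_tiling_placed T : is_rect_tiling R F T -> tiling inside_region size (placed T).
Proof.
case/and3P=> /allP rects /allP disjoint /eqP union; split.
- move=> x y; rewrite /inside_region -union => /bigfcupP[P /andP[PT _] in_P].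
  exists (toZ P.1.1), (toZ P.1.2), (Z.of_nat P.2.1), (Z.of_nat P.2.2).
  by split; [exact/placedP | exact/mem_placed_cells].
- move=> a b w h x y [P PT [-> -> -> ->]] /mem_placed_cells in_P.
  by rewrite /inside_region -union; apply/bigfcupP; exists P; rewrite ?PT.
- move=> a b w h a' b' w' h' x y [P PT [-> -> -> ->]] [Q QT [-> -> -> ->]].
  move=> /mem_placed_cells in_P /mem_placed_cells in_Q; have [->//|PQ] := eqVneq P Q.
  by have /allP/(_ Q QT) := disjoint _ PT; rewrite PQ => /fdisjointP/(_ _ in_P); rewrite in_Q.
- move=> a b w h [P PT [_ _ -> ->]].
  by apply/R_size; rewrite -surjective_pairing; apply: rects.
Qed.

Lemma placed_rect_tiling T : tiling inside_region size (placed T) -> is_rect_tiling R F T.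
Proof.
case=> cover ins uniq sz; apply/and3P; split.
- by apply/allP => P /placedP/sz/R_size; rewrite -surjective_pairing.
- apply/allP => P /placedP PT; apply/allP => Q /placedP QT; apply/implyP => PQ.
  apply/fdisjointP => c /mem_placed_cells_int in_P; apply/negP => /mem_placed_cells_int in_Q.
  have [aE bE wE hE] := uniq _ _ _ _ _ _ _ _ _ _ PT QT in_P in_Q.
  by rewrite (placement_inj aE bE wE hE) eqxx in PQ.
- apply/eqP/fsetP => -[x y]; have insideE : inside_region (toZ x) (toZ y) = ((x, y) \in F).
    by rewrite /inside_region !ssrZ.Z_of_intK.
  apply/bigfcupP/idP => [[P /andP[/placedP PT _] /mem_placed_cells_int in_P]|].
    by rewrite -insideE; apply: ins PT in_P.
  rewrite -insideE => /cover[a [b [w [h [[P PT [-> -> -> ->]] in_P]]]]].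
  by exists P; [rewrite PT | apply/mem_placed_cells_int].
Qed.

Lemma tile_in_product tile P : tiling inside_region size tile -> tile_at tile P ->
  P \in (F `*` R)%fset.
Proof.
move=> tileT tl; have P_size := tiling_size tileT tl; have [w_gt0 h_gt0] := size_gt0 P_size.
have : inside_region (toZ P.1.1) (toZ P.1.2).
  by apply: (tiling_inside tileT tl); rewrite /in_tile; lia.
move/R_size: P_size; rewrite /inside_region !ssrZ.Z_of_intK -!surjective_pairing => PR PF.
by rewrite in_fsetM PR PF.
Qed.

Definition tile_set tile : {fset placement} :=
  [fset P in (F `*` R)%fset | `[< tile_at tile P >]]%fset.

Lemma mem_tile_set tile P : tiling inside_region size tile ->
  P \in tile_set tile <-> tile_at tile P.
Proof.
move=> tileT; rewrite !inE -in_fsetM; split=> [/andP[_ /asboolP]//|tl].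
by rewrite (tile_in_product tileT tl); apply/asboolP.
Qed.

Lemma placed_tile_set tile : tiling inside_region size tile -> placed (tile_set tile) = tile.
Proof.
move=> tileT; apply/funext => a; apply/funext => b; apply/funext => w; apply/funext => h.
apply/propext; split=> [[P /(mem_tile_set _ tileT) tl [-> -> -> ->]] //|tl].
have [w_gt0 h_gt0] := size_gt0 (tiling_size tileT tl).
pose P : placement := ((toI a, toI b), (Z.to_nat w, Z.to_nat h)).
have [aE bE wE hE] : [/\ a = toZ P.1.1, b = toZ P.1.2, w = Z.of_nat P.2.1 & h = Z.of_nat P.2.2].
  by rewrite /P /=; split; lia.
by exists P => //; apply/(mem_tile_set _ tileT); rewrite /tile_at -aE -bE -wE -hE.
Qed.

Lemma rect_tiling_tile_set tile : tiling inside_region size tile ->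
  is_rect_tiling R F (tile_set tile).
Proof. by move=> tileT; apply: placed_rect_tiling; rewrite placed_tile_set. Qed.

Lemma tile_set_placed T : is_rect_tiling R F T -> tile_set (placed T) = T.
Proof.
move/rect_tiling_placed => tileT; apply/fsetP => P.
by apply/idP/idP => [/(mem_tile_set _ tileT)/placedP|/placedP/(mem_tile_set _ tileT)].
Qed.

Lemma rect_tiling_powerset T : is_rect_tiling R F T -> T \in fpowerset (F `*` R)%fset.
Proof.
move/rect_tiling_placed => tileT; rewrite fpowersetE; apply/fsubsetP => P /placedP.
exact: tile_in_product.
Qed.

End RectTilings.

Section WallRects.
Variables (ntiles nhcolors nvcolors : nat) (east north west south : Z -> Z) (I : Z).

Local Notation rel :=
  (wang_rel (Z.of_nat ntiles) (Z.of_nat nhcolors) (Z.of_nat nvcolors) east north west south).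

Local Ltac Zify.zify_post_hook ::= Z.to_euclidean_division_equations.

Definition range_seq (n : nat) : seq Z := [seq Z.of_nat k.+1 | k <- iota 0 n].

Lemma mem_range_seq n z : z \in range_seq n <-> in_range (Z.of_nat n) z.
Proof.
rewrite /in_range; split; first by case/mapP => k; rewrite mem_iota => k_lt ->; lia.
by move=> z_in; apply/mapP; exists (Z.to_nat z).-1; [rewrite mem_iota; lia | lia].
Qed.

(* The row and the slot modulo 4 of a filler, and the states of the bricks below and above. *)
Definition filler_kinds : seq (Z * Z * Z * Z) :=
  [seq (1, 0, 1, i) | i <- range_seq nvcolors] ++ [seq (1, 1, 1, i) | i <- range_seq ntiles] ++
  [seq (1, 2, south i, i) | i <- range_seq ntiles] ++
  [seq (1, 3, i', i) | i' <- range_seq nhcolors, i <- range_seq nvcolors] ++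
  [seq (2, 0, west i, i) | i <- range_seq ntiles] ++ [seq (2, 1, i, i) | i <- range_seq ntiles] ++
  [seq (2, 2, i, i) | i <- range_seq ntiles] ++ [seq (2, 3, east i, i) | i <- range_seq ntiles] ++
  [seq (3, 0, i, 1) | i <- range_seq ntiles] ++ [seq (3, 1, i, north i) | i <- range_seq ntiles] ++
  [seq (3, 2, i, north i) | i <- range_seq ntiles] ++ [seq (3, 3, i, 1) | i <- range_seq ntiles] ++
  [seq (0, 1, i, 1) | i <- range_seq nhcolors] ++ [seq (0, 2, i, i) | i <- range_seq nhcolors] ++
  [seq (0, 3, 1, i) | i <- range_seq nhcolors] ++ [:: (0, 0, 1, 1)].

Local Ltac mem_family := match goal with
  | z_in : in_range _ ?z |- _ => apply/mapP; exists z; [by apply/mem_range_seq | by []]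
  | z_in : in_range _ ?z, z'_in : in_range _ ?z' |- _ =>
      apply/allpairsP; exists (z, z'); split;
        [by apply/mem_range_seq | by apply/mem_range_seq | by []]
  end.
Local Ltac mem_some_family := rewrite mem_cat; apply/orP;
  first [solve [left; mem_family] | right; first [mem_some_family | by rewrite inE]].

Lemma mod4_cases r : r mod 4 = 0 \/ r mod 4 = 1 \/ r mod 4 = 2 \/ r mod 4 = 3.
Proof. by lia. Qed.

Lemma mem_filler_kinds r s i' i : rel r s i' i -> (r mod 4, s mod 4, i', i) \in filler_kinds.
Proof.
rewrite /wang_rel.
case: (mod4_cases r) => [->|[->|[->|->]]]; case: (mod4_cases s) => [->|[->|[->|->]]] /=;
  case=> *; subst; rewrite /filler_kinds; mem_some_family.
Qed.

Lemma size_filler_kinds :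
  size filler_kinds = (nhcolors * nvcolors + nvcolors + 3 * nhcolors + 10 * ntiles + 1)%N.
Proof. by rewrite /filler_kinds !size_cat size_allpairs !size_map !size_iota /=; lia. Qed.

Definition wall_rects : seq rect :=
  [seq (Z.to_nat (brick_width s), Z.to_nat (brick_height I)) | s <- [:: 0; 1; 2; 3]] ++
  [seq (Z.to_nat (slot_width q.1.1.2), Z.to_nat (filler_height I q.1.1.1 q.1.1.2 q.1.2 q.2))
     | q <- [seq q <- filler_kinds | `[< rel q.1.1.1 q.1.1.2 q.1.2 q.2 >]]].

Lemma size_wall_rects :
  (size wall_rects <= nhcolors * nvcolors + nvcolors + 3 * nhcolors + 10 * ntiles + 5)%N.
Proof.
rewrite size_cat !size_map size_filter /=.
have := count_size (fun q => `[< rel q.1.1.1 q.1.1.2 q.1.2 q.2 >]) filler_kinds.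
by rewrite size_filler_kinds; lia.
Qed.

Lemma filler_height_mod4 r s i' i :
  filler_height I (r mod 4) (s mod 4) i' i = filler_height I r s i' i.
Proof.
have [rE sE] : r mod 4 mod 4 = r mod 4 /\ s mod 4 mod 4 = s mod 4 by lia.
by rewrite /filler_height (brick_class_at rE sE) (brick_class_below rE sE).
Qed.

Lemma slot_width_mod4 s : slot_width (s mod 4) = slot_width s.
Proof. by apply/slot_width_eq; lia. Qed.

Lemma brick_width_mod4 s : brick_width (s mod 4) = brick_width s.
Proof. by rewrite {2}(_ : s = 4 * (s / 4) + s mod 4) ?brick_width_periodic; lia. Qed.

Hypotheses (I_ge1 : 1 <= I) (ntiles_le : Z.of_nat ntiles <= I)
  (nhcolors_le : Z.of_nat nhcolors <= I) (nvcolors_le : Z.of_nat nvcolors <= I).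

Lemma wall_tile_gt0 w h : wall_tile I rel w h -> 0 < w /\ 0 < h.
Proof.
have e_gt0 := max_shift_gt0 I_ge1; have gap_bound := gap_ge I_ge1.
case=> [[-> [s ->]]|[r [s [i' [i [-> -> rel_i]]]]]].
  by have := brick_width_bounds s; have := @brick_height_ge I; lia.
have [i'_in i_in] := wang_rel_range I_ge1 ntiles_le nhcolors_le nvcolors_le rel_i.
have [_ h_bounds _] := filler_height_size r s i'_in i_in.
by have := slot_width_bounds s; lia.
Qed.

Lemma mem_wall_rects (w h : nat) :
  ((w, h) : rect) \in wall_rects <-> wall_tile I rel (Z.of_nat w) (Z.of_nat h).
Proof.
split.
  rewrite mem_cat => /orP[/mapP[s _ [-> ->]]|/mapP[[[[r s] i'] i]]].
    have [w_gt0 h_gt0] : 0 < brick_width s /\ 0 < brick_height I.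
      by apply: wall_tile_gt0; left; split=> //; exists s.
    by left; split; [lia | exists s; lia].
  rewrite mem_filter => /andP[/asboolP /= rel_i _] [-> ->].
  have [w_gt0 h_gt0] : 0 < slot_width s /\ 0 < filler_height I r s i' i.
    by apply: wall_tile_gt0; right; exists r, s, i', i.
  by right; exists r, s, i', i; split=> //; lia.
case=> [[hE [s wE]]|[r [s [i' [i [wE hE rel_i]]]]]]; rewrite mem_cat; apply/orP.
  left; apply/mapP; exists (s mod 4); last by rewrite brick_width_mod4; congr pair; lia.
  by case: (mod4_cases s) => [->|[->|[->|->]]].
right; apply/mapP; exists (r mod 4, s mod 4, i', i).
  rewrite mem_filter; apply/andP; split; last exact: mem_filler_kinds.
  by apply/asboolP; apply: wang_rel_periodic rel_i; rewrite Z.mod_mod.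
cbn [fst snd]; rewrite slot_width_mod4 filler_height_mod4.
by congr pair; lia.
Qed.

End WallRects.

Lemma neighbor_toZ (p : cell) :
  [/\ toI (toZ p.1 + 1) = (p.1 + 1)%R, toI (toZ p.1 - 1) = (p.1 - 1)%R,
      toI (toZ p.2 + 1) = (p.2 + 1)%R & toI (toZ p.2 - 1) = (p.2 - 1)%R].
Proof. by split; lia. Qed.

Section TileNumbers.
Variables (C : choiceType) (W : {fset wang_tile C}) (B : {fset C}).
Implicit Types (s : side) (a : C) (w : wang_tile C) (i : Z) (p q : cell) (d : edge).

Definition parallel_sides s : seq side :=
  match s with East | West => [:: East; West] | North | South => [:: North; South] end.

(* The colors of [B] come first, so that the numbers of the input encoding can
   be used as states. *)
Definition palette s : seq C := enum_fset B ++
  [seq a <- undup [seq (w : wang_tile C) s' | w <- enum_fset W, s' <- parallel_sides s] |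
     a \notin enum_fset B].

Definition color_number s a : Z := Z.of_nat (index a (palette s)).+1.

Definition tile_number w : Z := Z.of_nat (index w (enum_fset W)).+1.

Definition side_color s i : Z :=
  nth 0 [seq color_number s ((w : wang_tile C) s) | w <- enum_fset W] (Z.to_nat i).-1.

Definition ntiles : nat := size (enum_fset W).
Definition nhcolors : nat := size (palette North).
Definition nvcolors : nat := size (palette East).

Lemma size_palette s : (size (palette s) <= 2 * #|` W| + #|` B|)%N.
Proof.
rewrite size_cat addnC leq_add //; apply: leq_trans (size_subseq (filter_subseq _ _)) _.
by apply: leq_trans (size_undup _) _; rewrite size_allpairs mulnC; case: s.
Qed.

Lemma mem_palette s w : w \in W -> w s \in palette s.
Proof.
move=> wW; rewrite mem_cat mem_filter mem_undup; case: (w s \in enum_fset B) => //=.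
by apply/allpairsP; exists (w, s); split=> //; case: s.
Qed.

Lemma color_number_inj s a a' : a \in palette s -> a' \in palette s ->
  color_number s a = color_number s a' -> a = a'.
Proof.
by move=> aP a'P numberE; apply: (index_inj a aP a'P); move: numberE;
  rewrite /color_number; lia.
Qed.

Lemma color_number_boundary s a : a \in B -> color_number s a = Z.of_nat (index a (enum_fset B)).+1.
Proof. by move=> aB; rewrite /color_number index_cat aB. Qed.

Lemma color_number_range s a : a \in palette s ->
  in_range (Z.of_nat (size (palette s))) (color_number s a).
Proof.
move=> aP; have : (index a (palette s) < size (palette s))%N by rewrite index_mem.
by rewrite /in_range /color_number; lia.
Qed.

Lemma tile_number_inj w w' : w \in W -> w' \in W -> tile_number w = tile_number w' -> w = w'.
Proof.
by move=> wW w'W numberE; apply: (index_inj w wW w'W); move: numberE; rewrite /tile_number;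
  lia.
Qed.

Lemma tile_number_range w : w \in W -> in_range (Z.of_nat ntiles) (tile_number w).
Proof.
move=> wW; have : (index w (enum_fset W) < ntiles)%N by rewrite index_mem.
by rewrite /in_range /tile_number; lia.
Qed.

Lemma tile_number_surj i : in_range (Z.of_nat ntiles) i -> exists2 w, w \in W & i = tile_number w.
Proof.
rewrite /in_range /ntiles => i_in; have lt_i : ((Z.to_nat i).-1 < size (enum_fset W))%N by lia.
have w0 : wang_tile C by case: (enum_fset W) lt_i.
exists (nth w0 (enum_fset W) (Z.to_nat i).-1); first exact: mem_nth.
by rewrite /tile_number index_uniq ?fset_uniq //; lia.
Qed.

Lemma side_colorE s w : w \in W -> side_color s (tile_number w) = color_number s (w s).
Proof.
move=> wW; rewrite /side_color (_ : (Z.to_nat (tile_number w)).-1 = index w (enum_fset W)).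
  by rewrite (nth_map w) ?index_mem // nth_index.
by rewrite /tile_number; lia.
Qed.

Lemma side_color_range s i : in_range (Z.of_nat ntiles) i ->
  in_range (Z.of_nat (size (palette s))) (side_color s i).
Proof.
by move=> /tile_number_surj[w wW ->]; rewrite side_colorE //;
  apply/color_number_range/mem_palette.
Qed.

Section ColoredRegion.
Variable G : colored_region C.
Hypothesis colors_B : (codomf (color G) `<=` B)%fset.

Definition edge_code d : nat :=
  if (color G).[? d]%fmap is Some a then (index a (enum_fset B)).+1 else 0%N.

(* Edges that are not on the boundary have the code 0, which is not a state. *)
Definition code_state (k : nat) : Z := Z.max 1 (Z.of_nat k).

Lemma boundary_color_in d a : (color G).[? d]%fmap = Some a -> a \in B.
Proof. by move=> colorE; apply: (fsubsetP colors_B); apply/codomfP; exists d. Qed.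

Lemma edge_code_lt d : (edge_code d < (size (enum_fset B)).+1)%N.
Proof.
rewrite /edge_code; case colorE: fnd => [a|] //.
by rewrite ltnS index_mem; apply: boundary_color_in colorE.
Qed.

Lemma edge_code_neq0 d : (edge_code d != 0%N) = boundary_edge (cells G) d.
Proof. by rewrite -color_dom /edge_code; case: fndP. Qed.

Lemma boundary_edge_neighbor p s : p \in cells G ->
  boundary_edge (cells G) (cell_edge p s) = (neighbor s p \notin cells G).
Proof. by case: p => x y pG; case: s => /=; rewrite ?GRing.addrK ?pG ?addbT. Qed.

Lemma boundary_colorP p s : p \in cells G -> neighbor s p \notin cells G ->
  exists a, [/\ a \in B, (color G).[? cell_edge p s]%fmap = Some a &
    code_state (edge_code (cell_edge p s)) = color_number s a].
Proof.
move=> pG out; have := edge_code_neq0 (cell_edge p s); rewrite boundary_edge_neighbor // out.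
rewrite /edge_code; case colorE: fnd => [a|] // _; have aB := boundary_color_in colorE.
by exists a; split=> //; rewrite color_number_boundary // /code_state; lia.
Qed.

Lemma code_state_range s d : (0 < #|` B|)%N ->
  in_range (Z.of_nat (size (palette s))) (code_state (edge_code d)).
Proof.
by move=> B_gt0; have := edge_code_lt d; rewrite /in_range /code_state /palette size_cat; lia.
Qed.

Definition in_cells (x y : Z) : bool := ((toI x, toI y) : cell) \in cells G.
Definition hstate (x y : Z) : Z := code_state (edge_code (true, (toI x, toI y))).
Definition vstate (x y : Z) : Z := code_state (edge_code (false, (toI (x + 1), toI y))).

Lemma in_cellsE p : in_cells (toZ p.1) (toZ p.2) = (p \in cells G).
Proof. by rewrite /in_cells !ssrZ.Z_of_intK -surjective_pairing. Qed.

Lemma in_cells_exists x y : in_cells x y ->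
  exists p : cells G, x = toZ (val p).1 /\ y = toZ (val p).2.
Proof. by move=> xyG; exists [` xyG]%fset; rewrite /= !ssrZ.int_of_ZK. Qed.

Lemma inhabited_beyondE s p :
  inhabited_beyond in_cells s (toZ p.1) (toZ p.2) = (neighbor s p \in cells G).
Proof.
by have [xS xP yS yP] := neighbor_toZ p; case: s;
  rewrite /= /in_cells ?xS ?xP ?yS ?yP !ssrZ.Z_of_intK.
Qed.

Lemma edge_stateE s p :
  edge_state hstate vstate s (toZ p.1) (toZ p.2) = code_state (edge_code (cell_edge p s)).
Proof.
have [xS xP yS yP] := neighbor_toZ p.
by case: s; rewrite /= /hstate /vstate ?Z.sub_add ?xS ?yS !ssrZ.Z_of_intK -?surjective_pairing.
Qed.

Section Tilings.
Implicit Types (tl : {ffun cells G -> W}) (x y : Z).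

Definition numbering tl x y : Z :=
  if insub ((toI x, toI y) : cell) is Some p then tile_number (val (tl p)) else 1.

Lemma numberingE tl (p : cells G) :
  numbering tl (toZ (val p).1) (toZ (val p).2) = tile_number (val (tl p)).
Proof. by rewrite /numbering !ssrZ.Z_of_intK -surjective_pairing valK. Qed.

Definition edge_matching tl : Prop :=
  [/\ forall p q : cells G, val q = neighbor East (val p) -> val (tl p) East = val (tl q) West,
      forall p q : cells G, val q = neighbor North (val p) -> val (tl p) North = val (tl q) South &
      forall (p : cells G) s a, (color G).[? cell_edge (val p) s]%fmap = Some a ->
        val (tl p) s = a].

Lemma is_wang_tilingP tl : is_wang_tiling tl <-> edge_matching tl.
Proof.
split.
  case/andP=> /forallP inner_edges /forallP boundary_edges; split.
  - move=> p q qE; have /forallP/(_ q)/forallP/(_ East)/forallP/(_ West)/implyP := inner_edges p.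
    by rewrite qE => /(_ (eqxx _))/eqP.
  - move=> p q qE; have /forallP/(_ q)/forallP/(_ North)/forallP/(_ South)/implyP := inner_edges p.
    by rewrite qE => /(_ (eqxx _))/eqP.
  - by move=> p s a colorE; have /forallP/(_ s) := boundary_edges p; rewrite colorE => /eqP.
case=> east north boundary; apply/andP; split; last first.
  apply/forallP => p; apply/forallP => s.
  by case colorE: fnd => [a|] //; apply/eqP/boundary.
apply/forallP => p; apply/forallP => q; apply/forallP => s; apply/forallP => s'.
have same_cell : (val p).1 = (val q).1 -> (val p).2 = (val q).2 -> p = q.
  by move=> xE yE; apply/val_inj; rewrite [LHS]surjective_pairing xE yE -surjective_pairing.
apply/implyP => /eqP edgeE; apply/eqP; case: s s' edgeE => -[] //= -[].
- by move=> /GRing.addIr xE yE; rewrite (same_cell xE yE).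
- by move=> qE; apply: east; exact: esym qE.
- by move=> xE /GRing.addIr yE; rewrite (same_cell xE yE).
- by move=> qE; apply: north; exact: esym qE.
- by move=> pE; apply/esym/east.
- by move/val_inj->.
- by move=> pE; apply/esym/north.
- by move/val_inj->.
Qed.

Lemma boundary_side_colorP tl (p : cells G) s : neighbor s (val p) \notin cells G ->
  side_color s (tile_number (val (tl p))) = code_state (edge_code (cell_edge (val p) s)) <->
  (forall a, (color G).[? cell_edge (val p) s]%fmap = Some a -> val (tl p) s = a).
Proof.
move=> out; have [a [aB colorE ->]] := boundary_colorP (valP p) out.
rewrite side_colorE ?(valP (tl p)) // colorE; split=> [numberE b [<-]|/(_ a erefl)->//].
apply: color_number_inj numberE; first exact/mem_palette/(valP (tl p)).
by rewrite mem_cat aB.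
Qed.

Lemma inner_side_colorP tl (p q : cells G) s s' : palette s = palette s' ->
  side_color s (tile_number (val (tl p))) = side_color s' (tile_number (val (tl q))) <->
  val (tl p) s = val (tl q) s'.
Proof.
move=> paletteE; rewrite !side_colorE ?(valP (tl _)) // /color_number -paletteE.
split=> [|->//]; apply: color_number_inj; first exact/mem_palette/(valP (tl p)).
by rewrite paletteE; apply/mem_palette/(valP (tl q)).
Qed.

Local Notation wang_matching := (matching (Z.of_nat ntiles) (side_color East) (side_color North)
  (side_color West) (side_color South) in_cells hstate vstate).

Lemma numbering_matching tl : edge_matching tl -> wang_matching (numbering tl).
Proof.
case=> east north boundary x y /in_cells_exists[p [-> ->]].
have out s : inhabited_beyond in_cells s (toZ (val p).1) (toZ (val p).2) = false ->
    side_color s (tile_number (val (tl p))) =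
    edge_state hstate vstate s (toZ (val p).1) (toZ (val p).2).
  rewrite inhabited_beyondE edge_stateE => /negbT outG.
  by apply/boundary_side_colorP => // a; apply: boundary.
rewrite numberingE; split; [exact/tile_number_range/(valP (tl p)) | | | exact: (out West) |
  exact: (out South)].
- case: ifP => [/in_cells_exists[q [xE yE]]|/(out East)//]; rewrite xE yE numberingE.
  apply/inner_side_colorP => //; apply: east; rewrite [LHS]surjective_pairing /=.
  by congr pair; move: xE yE => /=; lia.
- case: ifP => [/in_cells_exists[q [xE yE]]|/(out North)//]; rewrite xE yE numberingE.
  apply/inner_side_colorP => //; apply: north; rewrite [LHS]surjective_pairing /=.
  by congr pair; move: xE yE => /=; lia.
Qed.

Lemma matching_numbering tl : wang_matching (numbering tl) -> edge_matching tl.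
Proof.
move=> tlP; have tlP_at (p : cells G) := tlP _ _ (etrans (in_cellsE (val p)) (valP p)).
split=> [p q qE|p q qE|p s a colorE].
- have [_ + _ _ _] := tlP_at p.
  have [xE yE] : toZ (val p).1 + 1 = toZ (val q).1 /\ toZ (val p).2 = toZ (val q).2.
    by rewrite qE /=; lia.
  by rewrite xE yE in_cellsE (valP q) numberingE -yE numberingE => /inner_side_colorP ->.
- have [_ _ + _ _] := tlP_at p.
  have [xE yE] : toZ (val p).1 = toZ (val q).1 /\ toZ (val p).2 + 1 = toZ (val q).2.
    by rewrite qE /=; lia.
  by rewrite xE yE in_cellsE (valP q) numberingE -xE numberingE => /inner_side_colorP ->.
have out : neighbor s (val p) \notin cells G.
  by rewrite -boundary_edge_neighbor ?(valP p) // -color_dom; move: colorE; case: fndP.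
move: a colorE; apply/boundary_side_colorP => //; rewrite -edge_stateE.
have := inhabited_beyondE s (val p); rewrite (negbTE out).
have [_ eastE northE westE southE] := tlP_at p; rewrite numberingE in eastE northE westE southE.
by case: (s) => /= outE; rewrite ?eastE ?northE ?westE ?southE ?outE.
Qed.

Lemma is_wang_tiling_numbering tl : is_wang_tiling tl <-> wang_matching (numbering tl).
Proof.
by rewrite is_wang_tilingP; split; [exact: numbering_matching |
  exact: matching_numbering].
Qed.

Lemma numbering_exists tau : wang_matching tau -> exists tl,
  forall x y, in_cells x y -> numbering tl x y = tau x y.
Proof.
move=> tauP; have tiles (p : cells G) : exists w : W,
    tau (toZ (val p).1) (toZ (val p).2) = tile_number (val w).
  have pG : in_cells (toZ (val p).1) (toZ (val p).2) by rewrite in_cellsE (valP p).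
  by have [/tile_number_surj[w wW ->] _ _ _ _] := tauP _ _ pG; exists [` wW]%fset.
have [f fP] := choice tiles; exists [ffun p => f p] => x y /in_cells_exists[p [-> ->]].
by rewrite numberingE ffunE -fP.
Qed.

End Tilings.
End ColoredRegion.
End TileNumbers.

Section CarvedBlocks.
Variables (I : Z) (state : cell -> side -> Z).
Hypothesis I_ge1 : 1 <= I.
Hypothesis state_in : forall p s, 1 <= state p s <= I.
Implicit Types (p : cell) (s : side) (k : side * bool) (i j : int).

Local Notation t := (brick_height I).
Local Notation gap := (gap I).
Local Notation e := (max_shift I).

Definition height : nat := Z.to_nat (block_height I).

Local Notation bottom p k := (notch_bottom I k (state p k.1)).

Definition notch_offset p k : int := toI
  match k.1 with North | South => slot_x (notch_slot k) | East | West => bottom p k end.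

Definition notch_width p k : int := toI
  match k.1 with North | South => brick_width (notch_slot k) | East | West => t end.

Definition notch_depth p k : int := toI
  match k.1 with
  | South => bottom p k + t
  | North => block_height I - bottom p k
  | East => 40 - slot_x (notch_slot k)
  | West => slot_x (notch_slot k) + brick_width (notch_slot k)
  end.

Definition max_notch_depth s : int := toI
  match s with South => t - gap + e | North => gap | East => 11 | West => 8 end.

Definition frame_x s i j : int :=
  match s with South | North => i | East => (39 - j)%R | West => j end.

Definition frame_y s i j : int :=
  match s with South => j | North => (Posz height - 1 - j)%R | East | West => i end.

Let e_gt0 : 0 < e. Proof. exact: max_shift_gt0. Qed.
Let gap_bound : 100 * e <= gap. Proof. exact: gap_ge. Qed.
Let t_bound : 20 * gap <= t. Proof. exact: brick_height_ge. Qed.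

Lemma heightE : Z.of_nat height = 4 * (t + gap).
Proof. by rewrite /height /block_height; lia. Qed.

Lemma notch_columnsE k : slot_x (notch_slot k) =
    match k.1 with South | North => if k.2 then 17 else 0 | East => 29 | West => -11 end /\
  brick_width (notch_slot k) =
    match k.1 with South | North => if k.2 then 23 else 17 | East | West => 19 end.
Proof. by case: k => -[] []. Qed.

Lemma notch_bottom_bounds p k :
  notch_row k * (t + gap) - gap <= bottom p k <= notch_row k * (t + gap) - gap + e.
Proof.
apply: bottom_bounds; rewrite /notch_state.
by case: ifP => _; [exact: state_in | lia].
Qed.

Lemma block_frameE s p i j :
  block_frame (Posz 40) (Posz height) s p i j =
  block (Posz 40) (Posz height) p (frame_x s i j) (frame_y s i j).
Proof. by rewrite /block_frame /block; case: s => /=; congr pair; lia. Qed.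

Local Notation cut p k :=
  (notch (Posz 40) (Posz height) fst notch_offset notch_width notch_depth p k).

Lemma cutE p k i j : (0 <= i < 40)%R -> (0 <= j < Posz height)%R ->
  cut p k (block (Posz 40) (Posz height) p i j) <-> in_notch I k (state p k.1) (toZ i) (toZ j).
Proof.
move=> i_in j_in; have hE := heightE; have height_gt0 : (0 < Posz height)%R by lia.
have b := notch_bottom_bounds p k.
have [xE wE] := notch_columnsE k.
have -> : block (Posz 40) (Posz height) p i j = block_frame (Posz 40) (Posz height) k.1 p
    (match k.1 with South | North => i | East | West => j end)
    (match k.1 with South => j | North => (Posz height - 1 - j)%R | East => (39 - i)%R
      | West => i end).
  by rewrite block_frameE; case: (k.1) => /=; congr block; lia.
rewrite (@notch_frame (Posz 40) (Posz height) isT height_gt0) in_notchP /brick_covers.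
rewrite -/(bottom p k) /top -/(bottom p k).
rewrite /notch_offset /notch_width /notch_depth /block_height xE wE {xE wE}.
move: (bottom p k) b => b; case: k => s c; rewrite /notch_row; cbn [fst snd].
case: s => b_bounds; try (case: c b_bounds => b_bounds).
all: lia.
Qed.

Lemma cut_frame s p k i j : (0 <= i < side_length (Posz 40) (Posz height) s)%R ->
  (0 <= j < side_depth (Posz 40) (Posz height) s)%R ->
  cut p k (block_frame (Posz 40) (Posz height) s p i j) <->
  slot_x (notch_slot k) <= toZ (frame_x s i j) <
    slot_x (notch_slot k) + brick_width (notch_slot k) /\
  bottom p k <= toZ (frame_y s i j) < bottom p k + t.
Proof.
move=> i_in j_in; rewrite block_frameE cutE ?in_notchP //.
  by case: s i_in j_in => /=; lia.
by case: s i_in j_in => /=; lia.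
Qed.

Lemma notch_in_side p k : [/\ (0 <= notch_offset p k)%R, (0 <= notch_width p k)%R &
  (notch_offset p k + notch_width p k <= side_length (Posz 40) (Posz height) k.1)%R].
Proof.
have hE := heightE; have b := notch_bottom_bounds p k; have [xE wE] := notch_columnsE k.
rewrite /notch_offset /notch_width xE wE {xE wE}.
move: (bottom p k) b => b; case: k => s c; rewrite /notch_row /side_length; cbn [fst snd].
by case: s => b_bounds; case: c b_bounds => b_bounds; split; lia.
Qed.

Lemma notch_depth_bounds p k : (0 <= notch_depth p k <= max_notch_depth k.1)%R.
Proof.
have hE := heightE; have b := notch_bottom_bounds p k; have [xE wE] := notch_columnsE k.
rewrite /notch_depth /max_notch_depth /block_height xE wE {xE wE}.
move: (bottom p k) b => b; case: k => s c; rewrite /notch_row; cbn [fst snd].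
by case: s => b_bounds; case: c b_bounds => b_bounds; lia.
Qed.

Lemma max_notch_depth_lt s : (max_notch_depth s < side_depth (Posz 40) (Posz height) s)%R.
Proof. by have hE := heightE; rewrite /max_notch_depth /side_depth; case: s; lia. Qed.

Lemma notch_apart p k k' i j : k' != k ->
  (notch_offset p k <= i < notch_offset p k + notch_width p k)%R -> (0 <= j <= notch_depth p k)%R ->
  ~ cut p k' (block_frame (Posz 40) (Posz height) k.1 p i j).
Proof.
move=> neq i_in j_in; have [offset_ge0 width_ge0 in_side] := notch_in_side p k.
have depth := notch_depth_bounds p k; have max_depth := max_notch_depth_lt k.1.
rewrite cut_frame; [|lia|lia]; move: i_in j_in {offset_ge0 width_ge0 in_side depth max_depth}.
have hE := heightE; rewrite /notch_offset /notch_width /notch_depth /block_height.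
have [b b'] := conj (notch_bottom_bounds p k) (notch_bottom_bounds p k').
have [[xE wE] [xE' wE']] := conj (notch_columnsE k) (notch_columnsE k').
rewrite xE wE xE' wE' {xE wE xE' wE'}; move: (bottom p k) (bottom p k') b b' => b b'.
move: k k' neq => [s c] [s' c']; rewrite /notch_row /frame_x /frame_y; cbn [fst snd].
case: s; case: s'; case: c; case: c'; rewrite ?eqxx // => _ b_bounds b'_bounds i_in j_in; lia.
Qed.

Lemma notch_outward_closed s p k i j : (0 <= i < side_length (Posz 40) (Posz height) s)%R ->
  (0 <= j < max_notch_depth s)%R ->
  cut p k (block_frame (Posz 40) (Posz height) s p i (j + 1)%R) ->
  cut p k (block_frame (Posz 40) (Posz height) s p i j).
Proof.
move=> i_in j_in; have max_depth := max_notch_depth_lt s.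
rewrite !cut_frame; try lia; have hE := heightE; have b := notch_bottom_bounds p k.
have [xE wE] := notch_columnsE k; rewrite xE wE {xE wE}; move: (bottom p k) b j_in {max_depth} => b.
rewrite /max_notch_depth; case: k => s' c; rewrite /notch_row /frame_x /frame_y; cbn [fst snd].
by case: s i_in; case: s'; case: c; rewrite /side_length => i_in b_bounds j_in; lia.
Qed.

Lemma notch_full_side p k : notch_offset p k = 0%R \/
    (notch_offset p k + notch_width p k)%R = side_length (Posz 40) (Posz height) k.1 ->
  forall q k' i, k'.1 <> k.1 -> (0 <= i < side_length (Posz 40) (Posz height) k.1)%R ->
  ~ cut q k' (block_frame (Posz 40) (Posz height) k.1 q i 0%R).
Proof.
move=> full q k' i s_neq i_in; have hE := heightE; rewrite cut_frame //; last first.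
  by rewrite /side_depth; case: (k.1); lia.
move: full; rewrite /notch_offset /notch_width.
have [b b'] := conj (notch_bottom_bounds p k) (notch_bottom_bounds q k').
have [[xE wE] [xE' wE']] := conj (notch_columnsE k) (notch_columnsE k').
rewrite xE wE xE' wE' {xE wE xE' wE'}; move: (bottom p k) (bottom q k') b b' i_in => b b'.
move: k k' s_neq => [s c] [s' c']; rewrite /notch_row /frame_x /frame_y /side_length; cbn [fst snd].
by case: s; case: s' => // _; case: c; case: c' => b_bounds b'_bounds i_in; lia.
Qed.

Lemma carved_blocks_region (K : realType) (G Y : {fset cell}) : simply_connected_region K G ->
  (forall p i j, (0 <= i < 40)%R -> (0 <= j < Posz height)%R ->
     block (Posz 40) (Posz height) p i j \in Y <-> p \in G /\
     forall k, neighbor k.1 p \notin G -> ~ in_notch I k (state p k.1) (toZ i) (toZ j)) ->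
  simply_connected_region K Y.
Proof.
move=> scG memY; have hE := heightE.
have height_gt0 : (0 < Posz height)%R by lia.
apply: (@carved_region (Posz 40) (Posz height) isT height_gt0 _ fst notch_offset notch_width
  notch_depth max_notch_depth notch_in_side notch_depth_bounds max_notch_depth_lt notch_apart
  notch_outward_closed notch_full_side K G scG) => p c [i [j [-> i_in j_in]]].
rewrite memY //; split=> -[pG uncut]; split=> // k out.
  by rewrite cutE //; apply: uncut.
by rewrite -cutE //; apply: uncut.
Qed.

End CarvedBlocks.

Lemma cells_bounded (F : {fset cell}) :
  exists bound : Z, forall p, p \in F -> - bound < toZ p.1 < bound /\ - bound < toZ p.2 < bound.
Proof.
suff bounded (s : seq cell) : exists bound : Z, forall p, p \in s ->
    - bound < toZ p.1 < bound /\ - bound < toZ p.2 < bound by exact: (bounded (enum_fset F)).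
elim: s => [|c s [bound IH]]; first by exists 0.
exists (Z.max bound (Z.max (Z.abs (toZ c.1) + 1) (Z.abs (toZ c.2) + 1))) => p.
by rewrite inE => /orP[/eqP ->|/IH]; lia.
Qed.

(* Without colors there are no boundary edges, so that a region extends to infinity. *)
Lemma uncolored_region_false (K : realType) (C : choiceType) (G : colored_region C) :
  ~ input_region K fset0 G.
Proof.
move=> [[[G_neq0 _] _] uncolored].
have no_boundary d : boundary_edge (cells G) d = false.
  rewrite -color_dom; apply/negbTE/negP => d_colored.
  have : (color G).[d_colored]%fmap \in codomf (color G) by apply/codomfP; exists d; rewrite in_fnd.
  by move/(fsubsetP uncolored); rewrite inE.
have [p pG] := fset0Pn _ G_neq0.
have west n : (((p.1 - Posz n)%R, p.2) : cell) \in cells G.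
  elim: n => [|n IH]; first by rewrite GRing.subr0 -surjective_pairing.
  have := no_boundary (cell_edge ((p.1 - Posz n)%R, p.2) West).
  rewrite boundary_edge_neighbor // => /negbFE; rewrite /neighbor /=.
  by have -> : (p.1 - Posz n - 1)%R = (p.1 - Posz n.+1)%R by lia.
have [bound boundP] := cells_bounded (cells G).
by have [] := boundP _ (west (Z.to_nat (toZ p.1 + bound))); cbn [fst]; lia.
Qed.

Section Reduction.
Variables (C : choiceType) (W : {fset wang_tile C}) (B : {fset C}).
Hypothesis B_gt0 : (0 < #|` B|)%N.

Definition nstates : Z := Z.of_nat (ntiles W + nhcolors W B + nvcolors W B).+1.

Local Notation I := nstates.
Local Notation rel := (wang_rel (Z.of_nat (ntiles W)) (Z.of_nat (nhcolors W B))
  (Z.of_nat (nvcolors W B)) (side_color W B East) (side_color W B North)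
  (side_color W B West) (side_color W B South)).
Local Notation height := (height I).

Lemma nstates_ge : [/\ 1 <= I, Z.of_nat (ntiles W) <= I, Z.of_nat (nhcolors W B) <= I &
  Z.of_nat (nvcolors W B) <= I].
Proof. by rewrite /nstates; split; lia. Qed.

Let I_ge1 : 1 <= I. Proof. by case: nstates_ge. Qed.
Let ntiles_le : Z.of_nat (ntiles W) <= I. Proof. by case: nstates_ge. Qed.
Let nhcolors_le : Z.of_nat (nhcolors W B) <= I. Proof. by case: nstates_ge. Qed.
Let nvcolors_le : Z.of_nat (nvcolors W B) <= I. Proof. by case: nstates_ge. Qed.

Definition reduction_rects : {fset rect} := seq_fset tt (wall_rects (ntiles W) (nhcolors W B)
  (nvcolors W B) (side_color W B East) (side_color W B North) (side_color W B West)
  (side_color W B South) I).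

Lemma rel_wall_tile_gt0 w h : wall_tile I rel w h -> 0 < w /\ 0 < h.
Proof. exact: wall_tile_gt0. Qed.

Lemma mem_reduction_rects (w h : nat) :
  ((w, h) : rect) \in reduction_rects <-> wall_tile I rel (Z.of_nat w) (Z.of_nat h).
Proof. by rewrite seq_fsetE; apply: mem_wall_rects. Qed.

Lemma rect_tile_set_reduction : rect_tile_set reduction_rects.
Proof. by case=> w h /mem_reduction_rects/rel_wall_tile_gt0 /=; lia. Qed.

Lemma card_reduction_rects k c : (#|` W| <= k)%N -> (#|` B| <= c)%N ->
  (#|` reduction_rects| <= 8 * (k + 4 * c) ^ 2)%N.
Proof.
move=> W_le B_le; rewrite size_seq_fset; apply: leq_trans (size_undup _) _.
apply: leq_trans (size_wall_rects _ _ _ _ _ _ _ _) _.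
have palette_le s : (size (palette W B s) <= 2 * k + c)%N.
  by apply: leq_trans (size_palette W B s) _; rewrite leq_add ?leq_mul2l ?W_le.
have ntiles_k : (ntiles W <= k)%N by [].
have c_gt0 : (0 < c)%N by apply: leq_trans B_le.
have product_le := leq_mul (palette_le North) (palette_le East).
have [h_le v_le] := conj (palette_le North) (palette_le East).
rewrite -/(nhcolors W B) -/(nvcolors W B) in product_le h_le v_le.
move: product_le h_le v_le ntiles_k c_gt0; clear.
move: (nhcolors W B) (nvcolors W B) (ntiles W) => x y z product_le x_le y_le z_le c_gt0.
have k_le : (k <= k * c)%N by rewrite leq_pmulr.
have c_le : (c <= c * c)%N by rewrite leq_pmulr.
by rewrite expnS expn1; move: product_le; move: (x * y)%N => xy; nia.
Qed.

Definition code_sides : seq side := [:: East; North; West; South].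

Definition code_at s (codes : seq nat) : nat := nth 0%N codes (index s code_sides).

Definition block_shape (codes : seq nat) : seq (nat * nat) :=
  [seq o <- [seq (i, j) | i <- iota 0 40, j <- iota 0 height] |
    [forall k : side * bool, (code_at k.1 codes != 0%N) ==>
       ~~ in_notch I k (code_state (code_at k.1 codes)) (Z.of_nat o.1) (Z.of_nat o.2)]].

Lemma block_shape_bounds codes o : o \in block_shape codes -> (o.1 < 40)%N /\ (o.2 < height)%N.
Proof. by rewrite mem_filter => /andP[_ /allpairsP[ij []]]; rewrite !mem_iota => ? ? ->. Qed.

Section OneRegion.
Variable G : colored_region C.
Hypothesis colors_B : (codomf (color G) `<=` B)%fset.

Definition edge_codes (p : cell) : seq nat :=
  [seq edge_code B G (cell_edge p s) | s <- code_sides].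

Definition blow_up_seq (s : seq cell) : seq cell :=
  [seq block (Posz 40) (Posz height) p (Posz o.1) (Posz o.2) |
    p <- s, o <- block_shape (edge_codes p)].

Definition blow_up : {fset cell} := seq_fset tt (blow_up_seq (cells G)).

Let width_gt0 : (0 < Posz 40)%R. Proof. by []. Qed.

Let height_gt0 : (0 < Posz height)%R.
Proof.
have := heightE I_ge1; have := max_shift_gt0 I_ge1; have := gap_ge I_ge1.
by have := @brick_height_ge I; lia.
Qed.

Lemma mem_block_shape p (i j : nat) : p \in cells G -> (i < 40)%N -> (j < height)%N ->
  (i, j) \in block_shape (edge_codes p) <->
  forall k, neighbor k.1 p \notin cells G ->
    ~ in_notch I k (code_state (edge_code B G (cell_edge p k.1))) (Z.of_nat i) (Z.of_nat j).
Proof.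
move=> pG i_lt j_lt; rewrite mem_filter andbC.
have -> : (i, j) \in [seq (i, j) | i <- iota 0 40, j <- iota 0 height].
  by apply/allpairsP; exists (i, j); split; rewrite ?mem_iota.
have codeE s : code_at s (edge_codes p) = edge_code B G (cell_edge p s) by case: s.
split=> [/forallP uncut k out|uncut].
  have := uncut k; rewrite codeE edge_code_neq0 boundary_edge_neighbor // out.
  by move=> /negP.
apply/forallP => k; rewrite codeE edge_code_neq0 boundary_edge_neighbor //.
by apply/implyP => /uncut/negP.
Qed.

Lemma mem_blow_up p (i j : int) : (0 <= i < 40)%R -> (0 <= j < Posz height)%R ->
  block (Posz 40) (Posz height) p i j \in blow_up <-> p \in cells G /\
  forall k, neighbor k.1 p \notin cells G ->
    ~ in_notch I k (code_state (edge_code B G (cell_edge p k.1))) (toZ i) (toZ j).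
Proof.
case: i j => // i [] // j i_in j_in; have [i_lt j_lt] : (i < 40)%N /\ (j < height)%N by lia.
have natE n : toZ (Posz n) = Z.of_nat n by lia.
rewrite seq_fsetE !natE; split.
  case/allpairsPdep=> q [ij [qG shape blockE]]; have [i_bound j_bound] := block_shape_bounds shape.
  have [pE [iE] [jE]] : [/\ p = q, Posz i = Posz ij.1 & Posz j = Posz ij.2].
    by apply: (block_inj width_gt0 height_gt0 _ _ _ _ blockE); rewrite le0z_nat ltz_nat.
  by rewrite pE iE jE; split=> //; apply/mem_block_shape; rewrite // -surjective_pairing.
case=> pG /(mem_block_shape pG i_lt j_lt) shape.
by apply/allpairsPdep; exists p, (i, j).
Qed.

Lemma uniq_blow_up_seq s : uniq s -> uniq (blow_up_seq s).
Proof.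
move=> s_uniq; apply: allpairs_uniq_dep => // [p _|].
  apply: filter_uniq; apply: allpairs_uniq; rewrite ?iota_uniq //.
  by move=> [i j] [i' j'] _ _ /= [-> ->].
move=> po po' /allpairsPdep[p [ij [_ /block_shape_bounds[i_lt j_lt] ->]]].
move=> /allpairsPdep[p' [ij' [_ /block_shape_bounds[i'_lt j'_lt] ->]]] /= blockE.
have [-> [iE] [jE]] : [/\ p = p', Posz ij.1 = Posz ij'.1 & Posz ij.2 = Posz ij'.2].
  by apply: (block_inj width_gt0 height_gt0 _ _ _ _ blockE); rewrite le0z_nat ltz_nat.
by congr (Tagged _ _); rewrite [LHS]surjective_pairing iE jE -surjective_pairing.
Qed.

Lemma code_state_in d : 1 <= code_state (edge_code B G d) <= I.
Proof.
by have := @code_state_range _ W _ _ colors_B North d B_gt0;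
  rewrite /in_range -/(nhcolors W B); lia.
Qed.

Lemma blow_up_region (K : realType) : simply_connected_region K (cells G) ->
  simply_connected_region K blow_up.
Proof.
move=> scG; apply: (carved_blocks_region I_ge1 _ scG) => [p s|p i j i_in j_in].
  exact: code_state_in (cell_edge p s).
exact: mem_blow_up.
Qed.

Local Notation hstate := (hstate B G).
Local Notation vstate := (vstate B G).
Local Notation inhabited := (in_cells G).
Local Notation active := (zone_active inhabited).
Local Notation outer := (boundary_state hstate vstate).

Lemma reduction_states_ok : states_ok I outer rel.
Proof. by apply: wang_states_ok => // x y; apply: code_state_range. Qed.

Lemma inside_blow_up : inside_region blow_up = carved_inside I inhabited hstate vstate.
Proof.
apply/funext => x; apply/funext => y; apply/propext.
have [p [i [j [xyE i_in j_in]]]] := block_surj width_gt0 height_gt0 (toI x, toI y).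
rewrite /inside_region xyE mem_blow_up //.
have hE : block_height I = Z.of_nat height by rewrite (heightE I_ge1).
have [-> ->] : x = 40 * toZ p.1 + toZ i /\ y = toZ p.2 * block_height I + toZ j.
  by case: p xyE => px py [xE yE]; rewrite hE -(ssrZ.int_of_ZK x) -(ssrZ.int_of_ZK y) xE yE;
    cbn [fst snd]; split; lia.
rewrite carved_inside_block //; last 3 first.
- exact: outer_range reduction_states_ok.
- by lia.
- by rewrite hE; lia.
rewrite in_cellsE; split=> -[pG uncut]; split=> // k.
  by rewrite inhabited_beyondE edge_stateE => /negbT; apply: uncut.
by rewrite -edge_stateE => out; apply: uncut; rewrite inhabited_beyondE; apply: negbTE.
Qed.

Lemma blow_up_layout : layout I active outer (inside_region blow_up).
Proof.
by rewrite inside_blow_up; apply: carved_layout => //;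
  apply: outer_range reduction_states_ok.
Qed.

Local Ltac Zify.zify_post_hook ::= Z.to_euclidean_division_equations.

Definition tile_state (tl : {ffun cells G -> W}) : Z -> Z -> Z :=
  wang_state (side_color W B East) (side_color W B North) inhabited hstate vstate (numbering tl).

Definition rect_tiling_of (tl : {ffun cells G -> W}) : {fset placement} :=
  tile_set blow_up reduction_rects (standard I active (tile_state tl)).

Lemma tile_state_admissible tl : is_wang_tiling tl -> admissible I active outer rel (tile_state tl).
Proof.
move/(is_wang_tiling_numbering colors_B) => tlP.
by apply: wang_state_admissible tlP => // [i|i|i|i|x y|x y];
  [exact: side_color_range | exact: side_color_range | exact: (side_color_range B West) |
   exact: (side_color_range B South) | exact: code_state_range | exact: code_state_range].
Qed.

Lemma tile_state_center tl (p : cells G) :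
  tile_state tl (4 * toZ (val p).2 + 1) (4 * toZ (val p).1 + 1) = tile_number W (val (tl p)).
Proof. by rewrite /tile_state wang_state11 ?numberingE // in_cellsE (valP p). Qed.

Lemma standard_tile_state_tiling tl : is_wang_tiling tl ->
  tiling (inside_region blow_up) (wall_tile I rel) (standard I active (tile_state tl)).
Proof.
by move/tile_state_admissible; apply: (standard_tiling reduction_states_ok blow_up_layout).
Qed.

Lemma rect_tiling_of_tiling tl : is_wang_tiling tl ->
  is_rect_tiling reduction_rects blow_up (rect_tiling_of tl).
Proof.
move/standard_tile_state_tiling.
exact: (rect_tiling_tile_set mem_reduction_rects rel_wall_tile_gt0).
Qed.

Lemma rect_tiling_of_inj tl tl' : is_wang_tiling tl -> is_wang_tiling tl' ->
  rect_tiling_of tl = rect_tiling_of tl' -> tl = tl'.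
Proof.
move=> tlP tl'P eq_tiling.
have placedE tl1 : is_wang_tiling tl1 ->
    placed (rect_tiling_of tl1) = standard I active (tile_state tl1).
  move/standard_tile_state_tiling.
  exact: (placed_tile_set mem_reduction_rects rel_wall_tile_gt0).
apply/ffunP => p; apply/val_inj/(@tile_number_inj _ W); try exact: valP.
rewrite -!tile_state_center.
apply: (standard_state_inj reduction_states_ok blow_up_layout (tile_state_admissible tlP)
  (tile_state_admissible tl'P)).
- by move=> a b w h; rewrite -(placedE _ tlP) -(placedE _ tl'P) eq_tiling.
- by lia.
- by rewrite inner_block ?in_cellsE; [exact: (valP p) | left | lia].
Qed.

Lemma rect_tiling_of_surj T : is_rect_tiling reduction_rects blow_up T ->
  exists2 tl : {ffun cells G -> W}, is_wang_tiling tl & T = rect_tiling_of tl.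
Proof.
move=> T_tiling; have [bound boundP] := cells_bounded (cells G).
have active_bounded r s : active r s ->
    - (4 * bound + 10) < r < 4 * bound + 10 /\ - (4 * bound + 10) < s < 4 * bound + 10.
  by move/boundP; cbn [fst snd]; rewrite !ssrZ.int_of_ZK; lia.
have tileT := rect_tiling_placed mem_reduction_rects T_tiling.
have [st [stP placedE]] := tiling_standard reduction_states_ok blow_up_layout active_bounded tileT.
have [tl tlE] := numbering_exists (admissible_matching stP).
exists tl.
  apply/(is_wang_tiling_numbering colors_B).
  exact: (matching_ext tlE (admissible_matching stP)).
rewrite -(tile_set_placed mem_reduction_rects rel_wall_tile_gt0 T_tiling); congr tile_set.
apply/funext => a; apply/funext => b; apply/funext => w; apply/funext => h; apply/propext.
rewrite placedE; suff -> : standard I active st = standard I active (tile_state tl) by [].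
apply: standard_ext => r s /(admissible_wang_state stP) ->.
by apply/esym/wang_state_ext.
Qed.

Lemma tileable_blow_up : wang_tileable W G <-> rect_tileable reduction_rects blow_up.
Proof.
split=> [[tl /rect_tiling_of_tiling tlP]|[T /rect_tiling_of_surj[tl tlP _]]].
  by exists (rect_tiling_of tl).
by exists tl.
Qed.

Lemma nb_tilings_blow_up : nb_wang_tilings W G = nb_rect_tilings reduction_rects blow_up.
Proof.
pose wang_tilings := enum [pred tl : {ffun cells G -> W} | is_wang_tiling tl].
have -> : nb_rect_tilings reduction_rects blow_up =
    #|` seq_fset tt [seq rect_tiling_of tl | tl <- wang_tilings]|.
  congr (#|` _|); apply/fsetP => T; rewrite seq_fsetE !inE.
  apply/andP/mapP => [[_ /rect_tiling_of_surj[tl tlP ->]]|[tl]].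
    by exists tl; rewrite ?mem_enum.
  rewrite mem_enum => /rect_tiling_of_tiling T_tiling ->; split=> //.
  exact: (rect_tiling_powerset mem_reduction_rects rel_wall_tile_gt0 T_tiling).
rewrite size_seq_fset undup_id; first by rewrite size_map -cardE.
have inj : {in wang_tilings &, injective rect_tiling_of}.
  by move=> tl tl'; rewrite !mem_enum; exact: rect_tiling_of_inj.
by rewrite (map_inj_in_uniq inj) enum_uniq.
Qed.

End OneRegion.

Lemma encode_cell_input (G : colored_region C) (p : cell) :
  encode_colored_cell B G p = cell_input p (edge_codes G p).
Proof.
rewrite /encode_colored_cell /cell_input /edge_codes -map_comp; do 2 congr cons.
by apply: eq_map => s /=; rewrite /color_code /edge_code; case: fnd.
Qed.

Lemma shape_output_cells (G : colored_region C) (s : seq cell) :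
  flatten [seq shape_output 40 height block_shape p (edge_codes G p) | p <- s] =
  flatten [seq [:: c.1; c.2] | c <- blow_up_seq G s].
Proof.
elim: s => // p s IH; rewrite [LHS]/= IH /blow_up_seq [in RHS]/= map_cat flatten_cat.
by rewrite -map_comp.
Qed.

Lemma blow_up_linear (K : realType) : linear_time_computable B (input_region K B) blow_up.
Proof.
pose program := table_program 40 height (#|` B|).+1 block_shape.
exists program, (size program), 1%N => G [_ colors_B] w [s s_cells ->].
pose coded_cells := [seq (p : int * int, edge_codes G p) | p <- s].
have digits : all (fun k => is_digit_seq (#|` B|).+1 4 k.2) coded_cells.
  by apply/allP => k /mapP[p _ ->]; rewrite /is_digit_seq /= !edge_code_lt.
have [t t_le] := table_program_outputs 40 height block_shape digits.
rewrite -!map_comp shape_output_cells => outputs.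
have inputE : flatten [seq encode_colored_cell B G p | p <- s] =
    flatten [seq cell_input p (edge_codes G p) | p <- s].
  by congr flatten; apply: eq_map => p; exact: encode_cell_input.
exists t, (flatten [seq [:: c.1; c.2] | c <- blow_up_seq G s]); split.
- apply: leq_trans t_le _; rewrite size_map leq_add2r leq_mul2l; apply/orP; right.
  by elim: (s) => //= p s' IH; rewrite ltnS !leqW.
- by rewrite inputE.
have s_uniq : uniq s by rewrite (perm_uniq s_cells) fset_uniq.
exists (blow_up_seq G s) => //; apply: uniq_perm; [exact: uniq_blow_up_seq | exact: fset_uniq |].
move=> c; rewrite seq_fsetE; apply/allpairsPdep/allpairsPdep => -[p [ij [p_in ij_in cE]]];
  by exists p, ij; split=> //; move: p_in; rewrite (perm_mem s_cells).
Qed.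

End Reduction.

Theorem lemma3p3 (K : realType) (C : choiceType) (k c : nat)
    (W : {fset wang_tile C}) (B : {fset C}) :
  (#|` W| <= k)%N -> (#|` B| <= c)%N ->
  exists R : {fset rect},
    rect_tile_set R /\ (#|` R| <= 8 * (k + 4 * c) ^ 2)%N /\
    exists f : colored_region C -> {fset cell},
      linear_time_computable B (input_region K B) f /\
      forall G : colored_region C, input_region K B G ->
        simply_connected_region K (f G) /\
        (wang_tileable W G <-> rect_tileable R (f G)) /\
        nb_wang_tilings W G = nb_rect_tilings R (f G).
Proof.
move=> W_le B_le; have [B0|B_gt0] := posnP #|` B|.
  have -> : B = fset0 by apply: cardfs0_eq.
  exists fset0; split=> [r|]; first by rewrite inE.
  split; first by rewrite cardfs0.
  exists (fun=> fset0); split=> [|G /uncolored_region_false//].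
  by exists [::], 0%N, 0%N => G /uncolored_region_false.
exists (reduction_rects W B); split; first exact: rect_tile_set_reduction.
split; first exact: card_reduction_rects.
exists (blow_up W B); split; first exact: blow_up_linear.
move=> G [scG colors_B]; split; first exact: blow_up_region.
by split; [exact: tileable_blow_up | exact: nb_tilings_blow_up].
Qed.
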